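(* Let $p$ be a prime with $p\equiv 3\pmod 4$ and $p>3$, and suppose that $8$ has multiplicative order exactly $(p-1)/2$ modulo $p$. Write the octal expansion $1/p=\sum_{j=1}^{\infty}a_j8^{-j}$ with digits $a_j\in\{0,\ldots,7\}$, and for $k\in\{0,\ldots,7\}$ let $$n_k=|\{j : 1\le j\le (p-1)/2,\ a_j=k\}|.$$ Let $h_1$ be the class number of $\mathbb{Q}(\sqrt{-p})$ and $h_2$ the class number of $\mathbb{Q}(\sqrt{-2p})$. Then for $k=0,\ldots,3$, $$n_k=\frac12\left(\left\lfloor\frac{(k+1)p}{8}\right\rfloor-\left\lfloor\frac{kp}{8}\right\rfloor+\delta_k\right)\quad\text{and}\quad n_{7-k}=n_k-\delta_k,$$ where $$\delta_0=h_1-\tfrac{h_2}{4},\quad \delta_1=\delta_2=\tfrac{h_2}{4},\quad \delta_3=-\delta_1.$$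
   Context: $\lfloor x\rfloor$ denotes the integer part of $x$. The digits $a_j$ are the (unique, non-terminating) base-8 digits of $1/p$; $(a_1,\ldots,a_{(p-1)/2})$ is a period of this expansion. *)

(* Defs.v *)
From HB Require Import structures.
From mathcomp Require Import all_boot all_order all_algebra all_field.
From mathcomp Require Import finmap.
From mathcomp Require Import all_classical all_reals all_analysis.

Set Implicit Arguments.
Unset Strict Implicit.
Unset Printing Implicit Defensive.

Import Order.TTheory GRing.Theory Num.Theory.
Import numFieldNormedType.Exports.

Local Open Scope ring_scope.
Local Open Scope classical_set_scope.

(* Q(sqrt d), as a subset of the algebraic numbers. *)
Definition quadratic_field (d : int) : set algC :=
  [set z | exists x y : rat, z = ratr x + ratr y * sqrtC d%:~R].

(* For K a subfield of algC. *)
Definition ring_of_integers (K : set algC) : set algC :=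
  [set z | K z /\ z \in Aint].

Definition is_ideal (O I : set algC) : Prop :=
  [/\ I `<=` O, I 0,
      forall x y, I x -> I y -> I (x + y)
    & forall c x, O c -> I x -> I (c * x)].

Definition nonzero_ideals (O : set algC) : set (set algC) :=
  [set I | is_ideal O I /\ exists2 x, I x & x != 0].

(* I and J are equivalent when a I = b J for some nonzero a, b in O. *)
Definition ideal_equiv (O I J : set algC) : Prop :=
  exists a b : algC, [/\ O a, O b, a != 0, b != 0 &
    [set a * x | x in I] = [set b * y | y in J]].

Definition ideal_class (O I : set algC) : set (set algC) :=
  [set J | nonzero_ideals O J /\ ideal_equiv O I J].

Definition ideal_classes (O : set algC) : set (set (set algC)) :=
  [set ideal_class O I | I in nonzero_ideals O].

(* fset_set A is empty if A is infinite, so this would be 0 if there were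
   infinitely many classes. *)
Definition class_number (K : set algC) : nat :=
  #|` fset_set (ideal_classes (ring_of_integers K))|%fset.

(* The digits are indexed from 1; a 0 is irrelevant. *)
Definition is_octal_expansion (R : realType) (a : nat -> nat) (x : R) : Prop :=
  (forall j, (0 < j)%N -> (a j <= 7)%N) /\
  ((\sum_(1 <= j < n.+1) (a j)%:R * 8 ^- j : R) @[n --> \oo] --> x).

Definition digit_count (a : nat -> nat) (m k : nat) : nat :=
  #|[set j : 'I_m.+1 | (1 <= j)%N && (a j == k)]%SET|.

Definition delta (h1 h2 k : nat) : rat :=
  match k with
  | 0 => h1%:R - h2%:R / 4
  | 1 | 2 => h2%:R / 4
  | _ => - (h2%:R / 4)
  end.

(* Main.v *)
Require Import Defs.
From HB Require Import structures.
From mathcomp Require Import all_boot all_order all_algebra all_field cyclic.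
From mathcomp Require Import finmap.
From mathcomp Require Import all_classical all_reals all_analysis.
From mathcomp Require Import ring lra zify.

Set Implicit Arguments.
Unset Strict Implicit.
Unset Printing Implicit Defensive.

Import Order.TTheory GRing.Theory Num.Theory.
Import numFieldNormedType.Exports.
Local Open Scope ring_scope.

(** Since 8 generates the group of squares mod p, the digits of 1/p are the
    integer parts of 8t/p where t runs over the quadratic residues, so that the
    theorem amounts to evaluating the sums of the Legendre symbol over the
    intervals (kp/8, (k+1)p/8).  These sums are linked to each other and to the
    moments sum_r r chi(r) by multiplying the residues by 4 and 8, and what
    remains is Dirichlet's formula f h = - sum_(1 <= r <= f) r chi(r).

    That formula is proved without analysis.  Put u(n) = max(N - n, 0)^2 and
    w(n) = u(n) - 4 u(4n).  The nonzero ideals in one ideal class correspond,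
    up to sign, to the nonzero values of a positive binary quadratic form Q, and
    sum_(v in Z^2) w(Q(v)) is a combination of alternating sums of u o Q, hence
    O(N^(3/2)).  As w(0) = -3 N^2, summing w(norm) over all ideals gives
    (3/2) h N^2 + O(N^(3/2)).  On the other hand the number of ideals of norm n
    is sum_(d | n) chi(d), so the same sum equals sum_(d, m) chi(d) c(m) u(dm)
    with c(m) = 1 - 4 [4 | m], which the hyperbola method evaluates as
    (3/2) N^2 (- sum_r r chi(r) / f) + o(N^2). *)

(** * Weighted sums over periodic sequences *)

(** In analytic terms the class number formula is zeta_K(s) = zeta(s) L(s, chi) taken at s = 0,
    where it reads - h / 2 = - L(0, chi) / 2. Every quantity there is rational, whereas s = 1 would
    bring in pi and a volume. The factor 1 - 4^(1 - s), which turns zeta into the Dirichlet series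
    of c, removes the pole at s = 1 from both sides and equals -3 at s = 0; hence the 3/2. On the
    lattice side it reflects 4 Q(v) = Q(2 v): even vectors have density 1/4, so the volume terms
    cancel and only the origin is left. The truncation has to be squared. Each of the O(N^(1/2))
    rows of the lattice then has an alternating sum O(N), against a main term N^2; with the first
    power the rows would be O(N^(1/2)) and their total as large as the main term N. The hypothesis
    on 8 makes 2 a square modulo p, hence p = 7 mod 8. So 4 and 8 divide p + 1 and have symbol 1,
    which is what ties the octants to the residue classes modulo 8. *)

Lemma PoszX (n k : nat) : (n ^ k)%N%:Z = n%:Z ^+ k.
Proof. by rewrite -[LHS]natz natrX natz. Qed.

(* Truncated subtraction makes this vanish for N <= n. *)
Definition trunc_sqr (N n : nat) : int := ((N - n)%N)%:Z ^+ 2.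

Lemma trunc_sqr_eq0 N n : (N <= n)%N -> trunc_sqr N n = 0.
Proof. by rewrite /trunc_sqr -subn_eq0 => /eqP ->; rewrite expr0n. Qed.

Lemma trunc_sqrE N n : (n <= N)%N -> trunc_sqr N n = (N%:Z - n%:Z) ^+ 2.
Proof. by move=> le_nN; rewrite /trunc_sqr -subzn. Qed.

Lemma sum_nat_tail (V : nmodType) (g : nat -> V) (l M M' : nat) :
  (l <= M)%N -> (l <= M')%N ->
  (forall m, (M <= m)%N -> g m = 0) -> (forall m, (M' <= m)%N -> g m = 0) ->
  \sum_(l <= m < M) g m = \sum_(l <= m < M') g m.
Proof.
wlog leMM : M M' / (M <= M')%N.
  move=> W lM lM' gM gM'; case/orP: (leq_total M M') => leMM; first exact: W.
  by rewrite (W M' M).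
move=> lM _ gM _; rewrite [RHS](big_cat_nat lM leMM) /=.
rewrite [X in _ = _ + X]big_nat_cond [X in _ = _ + X]big1 ?addr0 // => m.
by case/andP => /andP[Mm _] _; apply: gM.
Qed.

Lemma sum_nat_shift (V : nmodType) (g : nat -> V) (k l : nat) :
  \sum_(k.+1 <= i < (k + l).+1) g i = \sum_(1 <= i < l.+1) g (i + k)%N.
Proof. by rewrite -[k.+1]add1n big_addn -addnS addnC addnK. Qed.

Lemma sum_periodic_zero (c : nat -> int) (f q : nat) :
  (forall m, c (m + f)%N = c m) -> \sum_(1 <= m < f.+1) c m = 0 ->
  \sum_(1 <= m < (f * q).+1) c m = 0.
Proof.
move=> per zs; elim: q => [|q IH]; first by rewrite muln0 big_geq.
rewrite (@big_cat_nat _ _ _ (f * q).+1) /= ?ltnS ?leq_mul2l ?leqnSn ?orbT //.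
rewrite IH add0r mulnSr (sum_nat_shift _ (f * q)) -[RHS]zs.
apply: eq_bigr => m _; elim: q {IH} => [|q IH]; first by rewrite muln0 addn0.
by rewrite mulnS addnCA addnC per.
Qed.

Lemma sum_periodic_id (c : nat -> int) (f q : nat) :
  (forall m, c (m + f)%N = c m) -> \sum_(1 <= m < f.+1) c m = 0 ->
  \sum_(1 <= m < (f * q).+1) c m * m%:Z = q%:Z * \sum_(1 <= m < f.+1) c m * m%:Z.
Proof.
move=> per zs; elim: q => [|q IH]; first by rewrite muln0 big_geq // mul0r.
rewrite (@big_cat_nat _ _ _ (f * q).+1) /= ?ltnS ?leq_mul2l ?leqnSn ?orbT //.
rewrite IH mulnSr (sum_nat_shift _ (f * q)).
have perq m : c (m + f * q)%N = c m.
  elim: q {IH} => [|q IH]; first by rewrite muln0 addn0.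
  by rewrite mulnS addnCA addnC per.
under [X in _ + X = _]eq_bigr => m _ do rewrite perq PoszD mulrDr.
by rewrite big_split /= -mulr_suml zs mul0r addr0 intS; ring.
Qed.

Section PeriodicSums.

Variables (c : nat -> int) (f : nat).
Hypothesis f_gt0 : (0 < f)%N.
Hypothesis per : forall m, c (m + f)%N = c m.
Hypothesis zs : \sum_(1 <= m < f.+1) c m = 0.

Definition psum N d : int := \sum_(1 <= m < N.+1) c m * trunc_sqr N (d * m).

(** This is f times the value at s = 0 of the Dirichlet series of [c]: the Hurwitz values 1/2 - m /
    f are summed against [c], which has mean zero. *)
Definition pmoment : int := - \sum_(1 <= m < f.+1) c m * m%:Z.

Lemma periodic_bounded : exists2 K : int, 0 <= K & forall m, `|c m| <= K.
Proof.
exists (\sum_(i < f) `|c i|) => [|m]; first exact: sumr_ge0.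
have -> : c m = c (m %% f)%N.
  rewrite {1}(divn_eq m f); elim: (m %/ f)%N => [|q IH]; first by rewrite mul0n.
  by rewrite mulSn -addnA addnC per.
have lt : (m %% f < f)%N by rewrite ltn_pmod.
by rewrite (bigD1 (Ordinal lt)) //= lerDl sumr_ge0.
Qed.

Lemma psumE N d M : (0 < d)%N -> (N <= d * M.+1)%N ->
  psum N d = \sum_(1 <= m < M.+1) c m * trunc_sqr N (d * m).
Proof.
move=> d0 leN; apply: sum_nat_tail => // m lem; rewrite trunc_sqr_eq0 ?mulr0 //.
  by apply: leq_trans (leq_trans _ lem) (leq_pmull _ _).
by apply: leq_trans leN _; rewrite leq_mul2l lem orbT.
Qed.

(** The terms with m > f, moved back by one period, are those of [psum N d], because
    [N + f * d - d * (m + f) = N - d * m]. *)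
Lemma psum_shift N d : (0 < d)%N ->
  psum (N + f * d) d =
  \sum_(1 <= m < f.+1) c m * (N%:Z + d%:Z * (f%:Z - m%:Z)) ^+ 2 + psum N d.
Proof.
move=> d0; rewrite (@psumE _ _ (f + N)) //; last by rewrite mulnC; nia.
rewrite (@big_cat_nat _ _ _ f.+1) //= ?ltnS ?leq_addr //; congr (_ + _).
  apply: eq_big_nat => m /andP[_ le_mf].
  rewrite trunc_sqrE; last by nia.
  by congr (_ * _); rewrite PoszD !PoszM; ring.
rewrite -add1n -addnS [X in \sum_(_ <= _ < X) _]addnC big_addn addnK.
by apply: eq_bigr => m _; rewrite per /trunc_sqr; congr (_ * _ ^+ 2); congr Posz; nia.
Qed.

(* f * psum - pmoment * N^2 - C' * N * d is periodic in N with period f * d. *)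
Lemma psum_asymp : exists C' K : int, 0 <= K /\ forall N d, (0 < d)%N ->
  `|f%:Z * psum N d - pmoment * N%:Z ^+ 2 - C' * N%:Z * d%:Z| <= K * d%:Z ^+ 2.
Proof.
pose A2 : int := \sum_(1 <= m < f.+1) c m * (f%:Z - m%:Z) ^+ 2.
(* Over one period [f * d] of N, [f * psum - pmoment * N^2] grows by [f * d^2 * (A2 - f * pmoment)];
   this dictates the coefficient of the linear term. *)
pose C' := A2 - f%:Z * pmoment.
pose B : int := \sum_(1 <= m < f.+1) `|c m|.
have B0 : 0 <= B by apply: sumr_ge0.
exists C', (f%:Z * (B * f%:Z ^+ 2) + `|pmoment| * f%:Z ^+ 2 + `|C'| * f%:Z).
split; first by nia.
move=> N d d0.
pose G N := f%:Z * psum N d - pmoment * N%:Z ^+ 2 - C' * N%:Z * d%:Z.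
have fd0 : (0 < f * d)%N by rewrite muln_gt0 f_gt0.
have GS M : G (M + f * d)%N = G M.
  rewrite /G psum_shift //.
  have -> : \sum_(1 <= m < f.+1) c m * (M%:Z + d%:Z * (f%:Z - m%:Z)) ^+ 2 =
    2 * M%:Z * d%:Z * pmoment + d%:Z ^+ 2 * A2.
    transitivity (\sum_(1 <= m < f.+1)
      ((M%:Z ^+ 2 + 2 * M%:Z * d%:Z * f%:Z) * c m
       - (2 * M%:Z * d%:Z) * (c m * m%:Z)
       + d%:Z ^+ 2 * (c m * (f%:Z - m%:Z) ^+ 2))).
      by apply: eq_bigr => m _; ring.
    by rewrite big_split /= sumrB -!mulr_sumr zs /pmoment /A2; ring.
  by rewrite PoszD PoszM /C'; ring.
suff: `|G (N %% (f * d))%N| <=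
    (f%:Z * (B * f%:Z ^+ 2) + `|pmoment| * f%:Z ^+ 2 + `|C'| * f%:Z) * d%:Z ^+ 2.
  suff -> : G (N %% (f * d))%N = G N by [].
  rewrite [in RHS](divn_eq N (f * d)); elim: (N %/ _)%N => [|q IH]; first by rewrite mul0n.
  by rewrite mulSn -addnA addnC GS.
have := ltn_pmod N fd0; set r := (N %% _)%N => ltr.
rewrite /G (@psumE _ _ f) //; last by nia.
set P := \sum_(_ <= _ < _) _.
have HP : `|P| <= B * (f%:Z ^+ 2 * d%:Z ^+ 2).
  rewrite /P /B mulr_suml; apply: le_trans (ler_norm_sum _ _ _) _.
  apply: ler_sum => m _; rewrite normrM ler_wpM2l // -exprMn.
  rewrite ger0_norm ?sqr_ge0 // /trunc_sqr lerXn2r ?nnegrE //.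
  by rewrite -PoszM lez_nat (leq_trans (leq_subr _ _)) // ltnW.
have rr : r%:Z <= f%:Z * d%:Z by rewrite -PoszM lez_nat ltnW.
apply: le_trans (ler_normB _ _) _; rewrite [leRHS]mulrDl lerD //.
  apply: le_trans (ler_normB _ _) _; rewrite [leRHS]mulrDl lerD //.
    rewrite normrM ger0_norm // -!mulrA ler_wpM2l //; nia.
  rewrite normrM -mulrA ler_wpM2l // -exprMn ger0_norm ?sqr_ge0 //.
  by rewrite lerXn2r ?nnegrE // mulr_ge0.
rewrite !normrM -!mulrA ler_wpM2l // !ger0_norm // [_ ^+ 2]expr2 mulrA.
by rewrite ler_wpM2r.
Qed.

End PeriodicSums.

(* Split at d = z := f * n^5.  As z is a multiple of the period of x, the part
   d > z is again of the form psum x, with N replaced by N - z * m. *)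
Lemma hyperbola (x c : nat -> int) (f e : nat) :
  (0 < f)%N -> (0 < e)%N ->
  (forall m, x (m + f)%N = x m) -> \sum_(1 <= m < f.+1) x m = 0 ->
  (forall m, c (m + e)%N = c m) -> \sum_(1 <= m < e.+1) c m = 0 ->
  exists K : int, forall n, (0 < n)%N ->
  `|f%:Z * e%:Z * (\sum_(1 <= d < (n ^ 8).+1) \sum_(1 <= m < (n ^ 8).+1)
      x d * c m * trunc_sqr (n ^ 8) (d * m)) - pmoment x f * pmoment c e * n%:Z ^+ 16|
   <= K * n%:Z ^+ 15.
Proof.
move=> f0 e0 perx zsx perc zsc.
have [C1 [K1 [K10 H1]]] := psum_asymp e0 perc zsc.
have [X1 [L1 [L10 G1]]] := psum_asymp f0 perx zsx.
have [Mc Mc0 HMc] := periodic_bounded e0 perc.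
have [Mx Mx0 HMx] := periodic_bounded f0 perx.
pose P := pmoment x f; pose Q := pmoment c e.
exists (f%:Z * (`|C1| * `|P| + f%:Z * (Mx * (K1 * (f%:Z ^+ 2)))) +
   `|P| * (`|C1| * f%:Z + K1 * f%:Z ^+ 2) + e%:Z * (Mc * (`|X1| + L1))).
(* With z of order N^theta, the errors are bounded by z^3 for d <= z and by N (N / z)^2 for d > z.
   Both are o(N^2) when 1/2 < theta < 2/3; theta = 5/8 is chosen, and N is an eighth power to keep z
   an integer. *)
move=> n n0; set N := (n ^ 8)%N; pose z := (f * n ^ 5)%N.
have z0 : (0 < z)%N by rewrite muln_gt0 f0 expn_gt0 n0.
set S := \sum_(_ <= _ < _) _.
pose S1 : int := \sum_(1 <= d < z.+1) x d * psum c N d.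
pose S2 : int := \sum_(1 <= m < N.+1) c m * psum x (N - z * m) m.
have ES : S = S1 + S2.
  have -> : S = \sum_(1 <= d < N.+1) x d * psum c N d.
    apply: eq_bigr => d _; rewrite /psum mulr_sumr; apply: eq_bigr => m _.
    by rewrite mulrA.
  rewrite (@sum_nat_tail _ _ 1 N.+1 (z + N).+1) //; first last.
  - move=> m lem; rewrite /psum big_nat_cond big1 ?mulr0 // => i /andP[/andP[i1 _] _].
    by rewrite trunc_sqr_eq0 ?mulr0 //; nia.
  - move=> m lem; rewrite /psum big_nat_cond big1 ?mulr0 // => i /andP[/andP[i1 _] _].
    by rewrite trunc_sqr_eq0 ?mulr0 //; nia.
  rewrite (@big_cat_nat _ _ _ z.+1) //= ?ltnS ?leq_addr //; congr (_ + _).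
  rewrite -add1n -addnS [X in \sum_(_ <= _ < X) _]addnC big_addn addnK /S2.
  under eq_bigr => d _ do rewrite /psum mulr_sumr.
  rewrite exchange_big /=; apply: eq_big_nat => m /andP[m1 _].
  rewrite (@psumE _ _ _ N) //; last by nia.
  rewrite mulr_sumr; apply: eq_bigr => d _.
  have -> : x (d + z)%N = x d.
    rewrite /z; elim: (n ^ 5)%N => [|q IH]; first by rewrite muln0 addn0.
    by rewrite mulnS addnCA addnC perx.
  by rewrite mulrCA /trunc_sqr; do 2 congr (_ * _); congr (Posz _ ^+ 2); nia.
have nn k l : (k <= l)%N -> n%:Z ^+ k <= n%:Z ^+ l.
  by move=> lekl; apply: ler_weXn2l => //; rewrite lez_nat.
have ENz : N%:Z = n%:Z ^+ 8 by rewrite /N PoszX.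
have Ezz : z%:Z = f%:Z * n%:Z ^+ 5 by rewrite /z PoszM PoszX.
have B1 : `|e%:Z * S1| <= (`|C1| * `|P| + f%:Z * (Mx * (K1 * (f%:Z ^+ 2)))) * n%:Z ^+ 15.
  (* The main term [Q * N^2] of [psum c N d] contributes nothing to [S1]: [x] sums to zero up to z,
     a whole number of periods. *)
  pose T d := e%:Z * psum c N d - Q * N%:Z ^+ 2 - C1 * N%:Z * d%:Z.
  have -> : e%:Z * S1 = C1 * N%:Z * \sum_(1 <= d < z.+1) x d * d%:Z
      + \sum_(1 <= d < z.+1) x d * T d.
    transitivity (\sum_(1 <= d < z.+1) (Q * N%:Z ^+ 2 * x d
        + C1 * N%:Z * (x d * d%:Z) + x d * T d)).
      by rewrite /S1 mulr_sumr; apply: eq_bigr => d _; rewrite /T; ring.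
    rewrite !big_split /= -!mulr_sumr (sum_periodic_zero _ perx zsx).
    by rewrite mulr0 add0r.
  rewrite (sum_periodic_id _ perx zsx) mulrDl.
  apply: le_trans (ler_normD _ _) _; apply: lerD.
    rewrite -[\sum_(_ <= _ < _) _]opprK -/(pmoment x f) -/P !normrM normrN.
    rewrite [ `|N%:Z|]ger0_norm // ENz [ `|(n ^ 5)%N%:Z|]ger0_norm //.
    rewrite PoszX.
    have -> : `|C1| * n%:Z ^+ 8 * (n%:Z ^+ 5 * `|P|) = `|C1| * `|P| * n%:Z ^+ 13 by ring.
    by apply: ler_wpM2l; [apply: mulr_ge0 | apply: nn].
  apply: le_trans (ler_norm_sum _ _ _) _.
  apply: (@le_trans _ _ (\sum_(1 <= d < z.+1) Mx * (K1 * z%:Z ^+ 2))).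
    apply: ler_sum_nat => d /andP[d1 dz]; rewrite normrM ler_pM //.
    apply: le_trans (H1 N d d1) _; rewrite ler_wpM2l //.
    by rewrite lerXn2r ?nnegrE.
  rewrite sumr_const_nat subn1 /= -[_ *+ z]mulr_natr natz Ezz.
  by rewrite le_eqVlt; apply/orP; left; apply/eqP; ring.
pose T m := f%:Z * psum x (N - z * m) m - P * trunc_sqr N (z * m).
have B2 : `|\sum_(1 <= m < N.+1) c m * T m| <= Mc * (`|X1| + L1) * n%:Z ^+ 15.
  rewrite (@sum_nat_tail _ _ 1 N.+1 (n ^ 3).+1) //; first last.
  - move=> m lem; rewrite /T.
    have -> : (N - z * m = 0)%N.
      apply/eqP; rewrite subn_eq0 /N /z -[8%N]/(5 + 3)%N expnD.
      by rewrite -mulnA mulnCA leq_mul2l; apply/orP; right; nia.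
    rewrite /psum big_geq // trunc_sqr_eq0; first by rewrite !mulr0 ?subrr ?mulr0.
    rewrite /N /z -[8%N]/(5 + 3)%N expnD.
    by rewrite -mulnA mulnCA leq_mul2l; apply/orP; right; nia.
  - move=> m lem; rewrite /T.
    have -> : (N - z * m = 0)%N by apply/eqP; rewrite subn_eq0; nia.
    rewrite /psum big_geq // trunc_sqr_eq0; first by rewrite !mulr0 ?subrr ?mulr0.
    by nia.
  apply: le_trans (ler_norm_sum _ _ _) _.
  apply: (@le_trans _ _ (\sum_(1 <= d < (n ^ 3).+1) Mc * ((`|X1| + L1) * n%:Z ^+ 11))).
    apply: ler_sum_nat => m /andP[m1 mz]; rewrite normrM ler_pM //.
    have leT : `|T m| <= `|X1| * (N - z * m)%N%:Z * m%:Z + L1 * m%:Z ^+ 2.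
      have := G1 (N - z * m)%N m m1; rewrite -/P -/(trunc_sqr N (z * m)) -/(T m).
      move=> h; rewrite -[T m](subrK (X1 * (N - z * m)%N%:Z * m%:Z)) addrC.
      apply: le_trans (ler_normD _ _) _; apply: lerD => //.
      by rewrite !normrM.
    apply: le_trans leT _; rewrite mulrDl.
    have m3 : m%:Z <= n%:Z ^+ 3.
      by rewrite -PoszX lez_nat.
    apply: lerD.
      rewrite -mulrA ler_wpM2l // -[11%N]/(8 + 3)%N exprD ler_pM //.
      by rewrite -ENz lez_nat leq_subr.
    rewrite ler_wpM2l //; apply: (@le_trans _ _ (n%:Z ^+ 6)); last exact: nn.
    by rewrite -[6%N]/(3 * 2)%N exprM lerXn2r ?nnegrE // exprn_ge0.
  rewrite sumr_const_nat subn1 /= -[_ *+ _]mulr_natr natrX natz.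
  have -> : Mc * ((`|X1| + L1) * n%:Z ^+ 11) * n%:Z ^+ 3 =
    Mc * (`|X1| + L1) * n%:Z ^+ 14 by ring.
  by apply: ler_wpM2l; [rewrite mulr_ge0 // addr_ge0 | apply: nn].
(* The main terms [P * trunc_sqr N (z * m)] of [S2], summed against [c], give [P * psum c N z]. Its
   own main term supplies [P * Q * N^2], the only contribution of order N^2. *)
pose arc_sum := e%:Z * psum c N z - Q * N%:Z ^+ 2.
have B3 : `|arc_sum| <= (`|C1| * f%:Z + K1 * f%:Z ^+ 2) * n%:Z ^+ 15.
  rewrite -[arc_sum](subrK (C1 * N%:Z * z%:Z)) addrC mulrDl.
  apply: le_trans (ler_normD _ _) _; apply: lerD.
    rewrite !normrM ![ `|Posz _|]ger0_norm // ENz Ezz.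
    have -> : `|C1| * n%:Z ^+ 8 * (f%:Z * n%:Z ^+ 5) = `|C1| * f%:Z * n%:Z ^+ 13 by ring.
    by apply: ler_wpM2l; [rewrite mulr_ge0 | apply: nn].
  apply: le_trans (H1 N z z0) _; rewrite Ezz exprMn -exprM mulrA.
  by apply: ler_wpM2l; [rewrite mulr_ge0 // sqr_ge0 | apply: nn].
have -> : f%:Z * e%:Z * S - pmoment x f * pmoment c e * n%:Z ^+ 16 =
  f%:Z * (e%:Z * S1) + P * arc_sum + e%:Z * \sum_(1 <= m < N.+1) c m * T m.
  have -> : \sum_(1 <= m < N.+1) c m * T m = f%:Z * S2 - P * psum c N z.
    rewrite /S2 /psum !mulr_sumr -sumrB; apply: eq_bigr => m _; rewrite /T /psum.
    by ring.
  by rewrite ES /arc_sum ENz -exprM; ring.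
rewrite 2!mulrDl; apply: le_trans (ler_normD _ _) _; apply: lerD.
  apply: le_trans (ler_normD _ _) _; apply: lerD; rewrite normrM.
    by rewrite ger0_norm // -mulrA ler_wpM2l.
  by rewrite -mulrA ler_wpM2l.
by rewrite normrM ger0_norm // -mulrA ler_wpM2l.
Qed.

(** * Alternating sums over lattices *)

(** Many sums here are cut-offs of infinite ones. It is enough to match the supports of the
    summands, so the cut-offs themselves need not correspond under substitutions such as m -> 4
    m. *)
Lemma big_reindex_supp (V : nmodType) (I J : eqType) (s : seq I) (t : seq J)
    (g : I -> J) (P : pred J) (F : J -> V) :
  uniq s -> uniq t -> {in s &, injective g} ->
  (forall x, x \in s -> F (g x) != 0 -> (g x \in t) && P (g x)) ->
  (forall y, y \in t -> P y -> F y != 0 -> exists2 x, x \in s & g x = y) ->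
  \sum_(x <- s) F (g x) = \sum_(y <- t | P y) F y.
Proof.
move=> us ut inj sub sup; rewrite -(big_map g xpredT F).
have nz (Q : pred J) r : \sum_(y <- r | Q y) F y = \sum_(y <- r | Q y && (F y != 0)) F y.
  rewrite [LHS](bigID (fun y => F y != 0)) /= [X in _ + X]big1 ?addr0 // => y.
  by case/andP => _; rewrite negbK => /eqP.
rewrite [LHS]nz [RHS]nz -big_filter -[RHS]big_filter; apply: perm_big.
apply: uniq_perm; rewrite ?filter_uniq ?map_inj_in_uniq // => y.
rewrite !mem_filter /=; apply/andP/andP.
  case=> Fy /mapP[x xs yE]; move: (Fy); rewrite yE => Fgx.
  by have /andP[-> ->] := sub x xs Fgx; rewrite Fgx.
case=> /andP[Py Fy] yt; split=> //; have [x xs <-] := sup y yt Py Fy.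
exact: map_f.
Qed.

Definition zrange (B : nat) : seq int := [seq i%:Z - B%:Z | i <- iota 0 B.*2].

Lemma mem_zrange B x : (x \in zrange B) = (- B%:Z <= x < B%:Z).
Proof.
apply/mapP/idP => [[i]|H]; first by rewrite mem_iota => Hi ->; lia.
by exists `|(x + B%:Z)%R|%N; rewrite ?mem_iota; lia.
Qed.

Lemma zrange_uniq B : uniq (zrange B).
Proof. by rewrite map_inj_uniq ?iota_uniq // => i j; lia. Qed.

Lemma sum_zrange (V : nmodType) B (F : int -> V) :
  \sum_(x <- zrange B) F x = \sum_(0 <= i < B.*2) F (i%:Z - B%:Z).
Proof. by rewrite big_map /index_iota subn0. Qed.

Definition zsgn (x : int) : int := (-1) ^+ `|x|%N.

Lemma zsgn_shift (i B : nat) : zsgn (i%:Z - B%:Z) = (-1) ^+ i * (-1) ^+ B.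
Proof.
rewrite /zsgn -exprD -signr_odd -[RHS]signr_odd; congr (_ ^+ nat_of_bool _).
by lia.
Qed.

Lemma zsgn_even x : zsgn x = if (2 %| x)%Z then 1 else -1.
Proof.
rewrite /zsgn -signr_odd; have -> : odd `|x|%N = ~~ (2 %| x)%Z by lia.
by case: (_ %| _)%Z.
Qed.

Lemma norm_zsgn x : `|zsgn x| = 1.
Proof. by rewrite zsgn_even; case: ifP. Qed.

Lemma sum_zrange_even (V : nmodType) B (F : int -> V) :
  (forall x, F x != 0 -> x \in zrange B) ->
  \sum_(x <- zrange B) F (2 * x) = \sum_(x <- zrange B | (2 %| x)%Z) F x.
Proof.
move=> supp; apply: (big_reindex_supp (g := fun x : int => 2 * x)).
- exact: zrange_uniq.
- exact: zrange_uniq.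
- by move=> x y _ _; lia.
- by move=> x _ /supp ->; rewrite dvdz_mulr.
- move=> y _ /dvdzP[x ->] /supp h; exists x; last by rewrite mulrC.
  by move: h; rewrite !mem_zrange; lia.
Qed.

Lemma alt_sum_telescope (f g : nat -> int) (i0 i1 : nat) : (i0 <= i1)%N ->
  (forall i, (i0 <= i < i1)%N -> g i + g i.+1 = f i) ->
  \sum_(i0 <= i < i1) (-1) ^+ i * f i = (-1) ^+ i0 * g i0 - (-1) ^+ i1 * g i1.
Proof.
move/subnK <-; elim: (i1 - i0)%N => [|k IH] H; first by rewrite big_geq // subrr.
rewrite addSn big_nat_recr ?leq_addl //= IH; last first.
  by move=> i /andP[h1 h2]; apply: H; rewrite h1 ltnW.
by rewrite -H ?leq_addl ?addSn ?leqnn // exprS; ring.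
Qed.

(** Here e is the integer square root of E, and [t - e], [e + t] stand for the first points of a
    progression of step al that reach -e and pass e. At these points [E - u ^+ 2] is only O(e),
    which controls the boundary terms of the telescoped sum. *)
Lemma near_sqrt_bound (al e E t : int) :
  0 <= e -> 0 < al -> e ^+ 2 <= E -> E < (e + 1) ^+ 2 -> 0 <= t -> t <= al ->
  `|E - (t - e) ^+ 2| <= (2 + 2 * al + al ^+ 2) * (e + 1) /\
  `|E - (e + t) ^+ 2| <= (2 + 2 * al + al ^+ 2) * (e + 1).
Proof.
move=> e0 al0 h1 h2 t0 tal.
have ale : 0 <= al * e by rewrite mulr_ge0 // ltW.
have al2e : 0 <= al ^+ 2 * e by rewrite mulr_ge0 // sqr_ge0.
have te : 0 <= t * e by rewrite mulr_ge0.
have te' : t * e <= al * e by rewrite ler_wpM2r.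
have t2 : 0 <= t ^+ 2 by rewrite sqr_ge0.
have t2' : t ^+ 2 <= al ^+ 2 by rewrite ler_sqr ?nnegrE // ltW.
have -> : (t - e) ^+ 2 = t ^+ 2 - 2 * (t * e) + e ^+ 2 by ring.
have -> : (e + t) ^+ 2 = t ^+ 2 + 2 * (t * e) + e ^+ 2 by ring.
have -> : (2 + 2 * al + al ^+ 2) * (e + 1) =
  2 * e + 2 * (al * e) + al ^+ 2 * e + 2 + 2 * al + al ^+ 2 by ring.
move: h2; have -> : (e + 1) ^+ 2 = e ^+ 2 + 2 * e + 1 by ring.
move: (t ^+ 2) (al ^+ 2 * e) (al ^+ 2) (al * e) (t * e) (e ^+ 2) ale al2e te te' t2 t2' h1.
by move=> *; rewrite !ler_norml; split; lia.
Qed.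

(** Single terms are as large as E^2, but the alternating sum telescopes, and the boundary terms are
    O(E) because the quartic has double zeros at the two square roots of E. *)
Lemma alt_quartic_bound (al : int) : 0 < al ->
  exists2 K : int, 0 <= K & forall (L : nat) (s e E : int),
  0 <= e -> e ^+ 2 <= E < (e + 1) ^+ 2 -> s <= - e -> e < s + al * L%:Z ->
  `|\sum_(0 <= i < L) (-1) ^+ i *
    (if `|s + al * i%:Z| <= e then (E - (s + al * i%:Z) ^+ 2) ^+ 2 else 0)|
   <= K * (e + 1) ^+ 2.
Proof.
move=> al0; pose M := 2 + 2 * al + al ^+ 2.
pose K := M ^+ 2 + 2 * al * (1 + al) * M + al ^+ 3 * (1 + al).
have M0 : 0 <= M by rewrite /M; nia.
have K0 : 0 <= K.
  by rewrite /K !addr_ge0 ?sqr_ge0 ?mulr_ge0 ?exprn_ge0 //; lia.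
exists K => // L s e E e0 /andP[eE Ee] se eL.
pose u i := s + al * i%:Z.
have umono i j : (i <= j)%N -> u i <= u j.
  by move=> leij; rewrite /u lerD2l ler_wpM2l // ltW.
have uS i : u i.+1 = u i + al by rewrite /u -addn1 PoszD; ring.
(* Twice the solution of g(u) + g(u + al) = (E - u^2)^2, from the Euler polynomials. *)
pose g2 i := (E - u i ^+ 2) ^+ 2 + 2 * al * u i * (E - u i ^+ 2) + al ^+ 3 * u i.
have g2P i : g2 i + g2 i.+1 = 2 * (E - u i ^+ 2) ^+ 2.
  by rewrite /g2 uS; ring.
have ex0 : exists i, - e <= u i by exists L; rewrite /u; lia.
have ex1 : exists i, e < u i by exists L.
case: (ex_minnP ex0) => i0 Hi0 min0; case: (ex_minnP ex1) => i1 Hi1 min1.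
have le1L : (i1 <= L)%N by apply: min1.
have le01 : (i0 <= i1)%N by apply: min0; lia.
have u0 : u i0 <= - e + al.
  case: (i0) min0 => [|k] min0; first by rewrite /u mulr0 addr0; lia.
  rewrite uS lerD2r leNgt; apply/negP => h.
  by have := min0 k (ltW h); rewrite ltnn.
have u1 : u i1 <= e + al.
  case: (i1) Hi1 min1 => [|k] Hi1 min1; first by move: Hi1; rewrite /u mulr0 addr0; lia.
  rewrite uS lerD2r leNgt; apply/negP => h.
  by have := min1 k h; rewrite ltnn.
have -> : \sum_(0 <= i < L) (-1) ^+ i *
    (if `|s + al * i%:Z| <= e then (E - (s + al * i%:Z) ^+ 2) ^+ 2 else 0)
   = \sum_(i0 <= i < i1) (-1) ^+ i * (E - u i ^+ 2) ^+ 2.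
  rewrite (@big_cat_nat _ _ _ i0) //=; last exact: leq_trans le1L.
  rewrite [X in X + _]big_nat_cond [X in X + _]big1 ?add0r; last first.
    move=> i /andP[/andP[_ lti] _]; rewrite -/(u i); case: ifP => //; last by rewrite mulr0.
    by rewrite ler_norml => /andP[h _]; have := min0 i h; lia.
  rewrite (@big_cat_nat _ _ _ i1) //= [X in _ + X]big_nat_cond [X in _ + X]big1 ?addr0.
    apply: eq_big_nat => i /andP[h1 h2]; rewrite -/(u i) ler_norml.
    rewrite (le_trans Hi0 (umono _ _ h1)) /= ifT // leNgt; apply/negP => h.
    by have := min1 i h; lia.
  move=> i /andP[/andP[lti _] _]; rewrite -/(u i) ifF ?mulr0 //.
  by have := lt_le_trans Hi1 (umono _ _ lti); lia.
have E2 : 2 * (\sum_(i0 <= i < i1) (-1) ^+ i * (E - u i ^+ 2) ^+ 2) =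
    (-1) ^+ i0 * g2 i0 - (-1) ^+ i1 * g2 i1.
  rewrite -(alt_sum_telescope (f := fun i => 2 * (E - u i ^+ 2) ^+ 2)) //.
  by rewrite mulr_sumr; apply: eq_bigr => i _; ring.
have gb i : `|u i| <= (1 + al) * (e + 1) -> `|E - u i ^+ 2| <= M * (e + 1) ->
    `|g2 i| <= K * (e + 1) ^+ 2.
  move=> b1 b2; rewrite /g2 /K [leRHS]mulrDl [X in _ <= X + _]mulrDl.
  have e1 : 1 <= e + 1 by lia.
  apply: le_trans (ler_normD _ _) _; apply: lerD.
    apply: le_trans (ler_normD _ _) _; apply: lerD.
      by rewrite normrX -exprMn lerXn2r ?nnegrE // mulr_ge0 //; lia.
    rewrite !normrM [ `|al|]gtr0_norm // (ger0_norm (_ : 0 <= 2)) //.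
    have -> : 2 * al * (1 + al) * M * (e + 1) ^+ 2 =
       2 * al * ((1 + al) * (e + 1)) * (M * (e + 1)) by ring.
    apply: ler_pM => //; first by rewrite !mulr_ge0 // ltW.
    by rewrite ler_wpM2l // mulr_ge0 // ltW.
  rewrite normrM normrX [ `|al|]gtr0_norm // -mulrA.
  apply: ler_wpM2l; first by rewrite exprn_ge0 // ltW.
  by apply: le_trans b1 _; apply: ler_wpM2l; [lia|rewrite expr2 ler_peMl //; lia].
have ale : 0 <= al * e by rewrite mulr_ge0 // ltW.
have b0 : `|g2 i0| <= K * (e + 1) ^+ 2.
  apply: gb; first by rewrite ler_norml; clear - Hi0 u0 ale al0 e0; lia.
  have -> : u i0 = (u i0 + e) - e by ring.
  have t0 : 0 <= u i0 + e by clear - Hi0; lia.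
  have t1 : u i0 + e <= al by clear - u0; lia.
  by have [] := near_sqrt_bound e0 al0 eE Ee t0 t1.
have b1 : `|g2 i1| <= K * (e + 1) ^+ 2.
  apply: gb; first by rewrite ler_norml; clear - Hi1 u1 ale al0 e0; lia.
  have -> : u i1 = e + (u i1 - e) by ring.
  have t0 : 0 <= u i1 - e by clear - Hi1; lia.
  have t1 : u i1 - e <= al by clear - u1; lia.
  by have [] := near_sqrt_bound e0 al0 eE Ee t0 t1.
rewrite -(@ler_pM2l _ 2) // -[X in X * `|_|](@ger0_norm _ 2) // -normrM E2.
apply: le_trans (ler_normB _ _) _; rewrite !normrM !normrX !normrN1 !expr1n !mul1r.
by lia.
Qed.

Lemma isqrt_exists (E : int) : 0 <= E ->
  exists2 e : int, 0 <= e & e ^+ 2 <= E < (e + 1) ^+ 2.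
Proof.
case: E => // m _; elim: m => [|m [e e0 /andP[h1 h2]]]; first by exists 0.
have [h|h] := ltP (m.+1%:Z) ((e + 1) ^+ 2); first by exists e => //; lia.
by exists (e + 1); [lia|rewrite h /=; nia].
Qed.

Lemma sqr_le_norm (u v : int) : 0 <= v -> (u ^+ 2 <= v ^+ 2) = (`|u| <= v).
Proof.
by move=> v0; rewrite -[u ^+ 2]real_normK ?num_real // ler_sqr ?nnegrE.
Qed.

(** * Positive definite binary quadratic forms *)

Definition qform (a b c x y : int) : int := a * x ^+ 2 + b * x * y + c * y ^+ 2.

Lemma qform_ge0 (a b c x y : int) : 0 < a -> 0 < 4 * a * c - b ^+ 2 -> 0 <= qform a b c x y.
Proof.
move=> a0 D0; rewrite -(@pmulr_rge0 _ (4 * a)) /qform; last by lia.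
have -> : 4 * a * (a * x ^+ 2 + b * x * y + c * y ^+ 2) =
  (2 * a * x + b * y) ^+ 2 + (4 * a * c - b ^+ 2) * y ^+ 2 by ring.
by rewrite addr_ge0 ?sqr_ge0 // mulr_ge0 ?sqr_ge0 // ltW.
Qed.

Lemma qform_swap a b c x y : qform a b c x y = qform c b a y x.
Proof. by rewrite /qform; ring. Qed.

Lemma qform_bound_snd (a b c x y : int) (n : nat) :
  0 < a -> 0 < 4 * a * c - b ^+ 2 -> qform a b c x y <= n%:Z ^+ 2 ->
  `|y| <= 2 * a * n%:Z.
Proof.
move=> a0 D0 Qn; rewrite -sqr_le_norm; last by rewrite !mulr_ge0 // ltW.
have E4 : 4 * a * qform a b c x y =
  (2 * a * x + b * y) ^+ 2 + (4 * a * c - b ^+ 2) * y ^+ 2 by rewrite /qform; ring.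
have h1 : 4 * a * qform a b c x y <= 4 * a * n%:Z ^+ 2 by rewrite ler_wpM2l //; lia.
have h2 : y ^+ 2 <= (4 * a * c - b ^+ 2) * y ^+ 2.
  by rewrite ler_peMl ?sqr_ge0 //; lia.
have h3 := sqr_ge0 (2 * a * x + b * y).
have h4 : 4 * a * n%:Z ^+ 2 <= (2 * a * n%:Z) ^+ 2.
  have -> : (2 * a * n%:Z) ^+ 2 = 4 * a * (a * n%:Z ^+ 2) by ring.
  by rewrite ler_wpM2l ?ler_peMl ?sqr_ge0 //; lia.
by apply: le_trans h4; apply: le_trans h1; rewrite E4; lia.
Qed.

(** Completing the square gives [4 a (n^2 - Q(x, y)) = E - u^2], where [u = 2 a x + b y] runs
    through a progression of step [2 a] as x varies. So [alt_quartic_bound] applies, with a constant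
    that does not depend on y. *)
Lemma row_bound (a b c : int) : 0 < a -> 0 < 4 * a * c - b ^+ 2 ->
  exists2 K : int, 0 <= K & forall (n B : nat) (y : int),
  (0 < n)%N -> (2 + `|b|) * n%:Z <= B%:Z ->
  `|\sum_(x <- zrange B) zsgn x * trunc_sqr (n ^ 2) `|qform a b c x y|%N| <= K * n%:Z ^+ 2.
Proof.
move=> a0 D0.
have al0 : 0 < 2 * a by lia.
have [K0 K00 HK] := alt_quartic_bound al0.
exists (K0 * (2 * a + 1) ^+ 2); first by rewrite mulr_ge0 ?sqr_ge0.
move=> n B y n0 HB; set row := \sum_(_ <- _) _.
pose E := 4 * a * n%:Z ^+ 2 - (4 * a * c - b ^+ 2) * y ^+ 2.
pose u x := 2 * a * x + b * y.
have EQ x : 4 * a * (n%:Z ^+ 2 - qform a b c x y) = E - u x ^+ 2.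
  by rewrite /E /u /qform; ring.
have Q0 x := qform_ge0 x y a0 D0.
have out x : E < u x ^+ 2 -> trunc_sqr (n ^ 2) `|qform a b c x y|%N = 0.
  move=> h; rewrite trunc_sqr_eq0 // -lez_nat PoszX gez0_abs //.
  rewrite -subr_le0 -(@pmulr_rle0 _ (4 * a)) ?EQ; lia.
have inn x : u x ^+ 2 <= E ->
    (4 * a) ^+ 2 * trunc_sqr (n ^ 2) `|qform a b c x y|%N = (E - u x ^+ 2) ^+ 2.
  move=> h; rewrite trunc_sqrE; first by rewrite PoszX gez0_abs // -exprMn EQ.
  rewrite -lez_nat PoszX gez0_abs // -subr_ge0 -(@pmulr_rge0 _ (4 * a)) ?EQ; lia.
have [Eneg|E0] := ltP E 0.
  have -> : row = 0.
    by apply: big1 => x _; rewrite out ?mulr0 // (lt_le_trans Eneg) ?sqr_ge0.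
  by rewrite normr0 mulr_ge0 ?sqr_ge0 // mulr_ge0 ?sqr_ge0.
have [e e0 eE] := isqrt_exists E0; have /andP[eE1 eE2] := eE.
have Dy : 0 <= (4 * a * c - b ^+ 2) * y ^+ 2 by rewrite mulr_ge0 ?sqr_ge0 // ltW.
have an : 4 * a * n%:Z ^+ 2 <= (2 * a * n%:Z) ^+ 2.
  have -> : (2 * a * n%:Z) ^+ 2 = 4 * a * (a * n%:Z ^+ 2) by ring.
  by rewrite ler_wpM2l ?ler_peMl ?sqr_ge0 //; lia.
have ean : e <= 2 * a * n%:Z.
  rewrite -[e]ger0_norm // -sqr_le_norm; last by rewrite !mulr_ge0 // ltW.
  by apply: le_trans an; rewrite /E in eE1; lia.
have yan : `|y| <= 2 * a * n%:Z.
  rewrite -sqr_le_norm; last by rewrite !mulr_ge0 // ltW.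
  apply: le_trans an; have : y ^+ 2 <= (4 * a * c - b ^+ 2) * y ^+ 2.
    by rewrite ler_peMl ?sqr_ge0 //; lia.
  by rewrite /E in E0; lia.
have bran : `|b * y| <= `|b| * (2 * a * n%:Z) by rewrite normrM ler_wpM2l.
have HB2 : (2 * a * n%:Z) * 2 + `|b| * (2 * a * n%:Z) <= 2 * a * B%:Z.
  have -> : (2 * a * n%:Z) * 2 + `|b| * (2 * a * n%:Z) = 2 * a * ((2 + `|b|) * n%:Z) by ring.
  by rewrite ler_wpM2l // ltW.
have an1 : 2 <= 2 * a * n%:Z.
  by rewrite -mulrA ler_peMr // mulr_ege1 //; lia.
have := HK B.*2 (b * y - 2 * a * B%:Z) e E e0 eE.
have -> : b * y - 2 * a * B%:Z + 2 * a * B.*2%:Z = b * y + 2 * a * B%:Z.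
  by rewrite -addnn PoszD; ring.
have A1 : b * y - 2 * a * B%:Z <= - e by clear - ean bran HB2 e0; lia.
have A2 : e < b * y + 2 * a * B%:Z by clear - ean bran HB2 e0 an1; lia.
move=> /(_ A1 A2).
set S := \sum_(_ <= _ < _) _ => HS.
have ES : (4 * a) ^+ 2 * row = (-1) ^+ B * S.
  rewrite /row /S sum_zrange !mulr_sumr; apply: eq_bigr => i _; rewrite zsgn_shift.
  have -> : b * y - 2 * a * B%:Z + 2 * a * i%:Z = u (i%:Z - B%:Z) by rewrite /u; ring.
  rewrite mulrCA -mulrA; case: ifP => [h|/negbT h].
    rewrite inn; first by ring.
    by apply: le_trans eE1; rewrite sqr_le_norm.
  rewrite out ?mulr0 //; apply: lt_le_trans eE2 _.
  by rewrite -[leRHS]real_normK ?num_real // ler_sqr ?nnegrE //; lia.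
have le1 : `|row| <= `|(4 * a) ^+ 2 * row|.
  rewrite normrM ger0_norm ?sqr_ge0 // ler_peMl // exprn_ege1 //.
  by clear - a0; lia.
apply: le_trans le1 _; rewrite ES normrM normrX normrN1 expr1n mul1r.
apply: le_trans HS _; rewrite -mulrA ler_wpM2l // -exprMn.
have n1 : 1 <= n%:Z by rewrite lez_nat.
rewrite ler_sqr ?nnegrE; clear - n1 e0 ean a0; [lia|lia|nia].
Qed.

(** The cancellation comes from the alternation in x alone, O(n^2) in each of O(n) rows. The bounded
    factor [s] in y is therefore arbitrary; it will be 1 or [zsgn]. *)
Lemma twisted_lattice_bound (a b c : int) (C : nat) :
  0 < a -> 0 < 4 * a * c - b ^+ 2 -> 2 + `|b| <= C%:Z ->
  exists K : int, forall (s : int -> int) (n : nat),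
  (forall y, `|s y| <= 1) -> (0 < n)%N ->
  `|\sum_(y <- zrange (C * n)) \sum_(x <- zrange (C * n))
     s y * zsgn x * trunc_sqr (n ^ 2) `|qform a b c x y|%N| <= K * n%:Z ^+ 3.
Proof.
move=> a0 D0 HC; have [K K0 HK] := row_bound a0 D0.
exists (K * (2 * C%:Z)) => s n s1 n0.
apply: le_trans (ler_norm_sum _ _ _) _.
apply: (@le_trans _ _ (\sum_(y <- zrange (C * n)) K * n%:Z ^+ 2)).
  apply: ler_sum => y _; under eq_bigr => x _ do rewrite -mulrA.
  rewrite -mulr_sumr normrM; apply: le_trans (HK n (C * n)%N y n0 _).
    by rewrite ler_piMl.
  by rewrite PoszM ler_wpM2r.
rewrite sum_zrange sumr_const_nat subn0 -[_ *+ _]mulr_natr natz -mul2n mulnA !PoszM.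
by rewrite le_eqVlt; apply/orP; left; apply/eqP; ring.
Qed.

(* 1 - 4 [x and y even] = - ((-1)^x + (-1)^y + (-1)^(x + y)). *)
Lemma lattice_bound (a b c : int) (C : nat) :
  0 < a -> 0 < c -> 0 < 4 * a * c - b ^+ 2 -> 2 + `|b| + 2 * a + 2 * c <= C%:Z ->
  exists K : int, forall n : nat, (0 < n)%N ->
  `|\sum_(x <- zrange (C * n)) \sum_(y <- zrange (C * n))
     (trunc_sqr (n ^ 2) `|qform a b c x y|%N
      - 4 * trunc_sqr (n ^ 2) (4 * `|qform a b c x y|%N)%N)|
  <= K * n%:Z ^+ 3.
Proof.
move=> a0 c0 D0 HC.
have D0' : 0 < 4 * c * a - b ^+ 2 by lia.
have bC : 2 + `|b| <= C%:Z by lia.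
have [K1 H1] := twisted_lattice_bound a0 D0 bC.
have [K2 H2] := twisted_lattice_bound c0 D0' bC.
exists (K1 + K2 + K1) => n n0.
pose G x y := trunc_sqr (n ^ 2) `|qform a b c x y|%N.
have supp x y : G x y != 0 -> x \in zrange (C * n) /\ y \in zrange (C * n).
  move=> h; have Qn : qform a b c x y <= n%:Z ^+ 2.
    rewrite leNgt; apply/negP => h2; case/eqP: h; apply: trunc_sqr_eq0.
    rewrite -lez_nat PoszX gez0_abs ?qform_ge0 //; exact: ltW.
  have := qform_bound_snd a0 D0 Qn; have := Qn; rewrite qform_swap => Qn'.
  have := qform_bound_snd c0 D0' Qn'; rewrite !mem_zrange PoszM => hx hy.
  have hh : (2 * a + 2 * c + 2) * n%:Z <= C%:Z * n%:Z by rewrite ler_wpM2r //; lia.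
  by split; nia.
have -> : \sum_(x <- zrange (C * n)) \sum_(y <- zrange (C * n))
     (trunc_sqr (n ^ 2) `|qform a b c x y|%N
      - 4 * trunc_sqr (n ^ 2) (4 * `|qform a b c x y|%N)%N)
  = \sum_(x <- zrange (C * n)) \sum_(y <- zrange (C * n))
     (G x y - 4 * (if (2 %| x)%Z && (2 %| y)%Z then G x y else 0)).
  under eq_bigr => x _ do rewrite sumrB -mulr_sumr.
  under [RHS]eq_bigr => x _ do rewrite sumrB -mulr_sumr.
  rewrite !sumrB -!mulr_sumr; congr (_ - _ * _).
  (* As [4 Q(x, y) = Q(2 x, 2 y)], the dilated weight is [G] restricted to the even vectors. *)
  transitivity (\sum_(x <- zrange (C * n)) \sum_(y <- zrange (C * n)) G (2 * x) (2 * y)).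
    apply: eq_bigr => x _; apply: eq_bigr => y _; rewrite /G; congr (trunc_sqr _ _).
    have -> : qform a b c (2 * x) (2 * y) = 4 * qform a b c x y by rewrite /qform; ring.
    by rewrite abszM.
  under eq_bigr => x _.
    rewrite sum_zrange_even; last by move=> y /supp[].
    over.
  rewrite (sum_zrange_even (F := fun x => \sum_(y <- zrange (C * n) | (2 %| y)%Z) G x y)).
    rewrite [LHS]big_mkcond /=; apply: eq_bigr => x _.
    case: ifP => /= _; first by rewrite big_mkcond.
    by rewrite big1.
  move=> x; apply: contraR => xB; apply/eqP; apply: big1 => y _; apply/eqP.
  by apply: contraNT xB => /supp[].
have -> : \sum_(x <- zrange (C * n)) \sum_(y <- zrange (C * n))
     (G x y - 4 * (if (2 %| x)%Z && (2 %| y)%Z then G x y else 0)) =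
  - \sum_(y <- zrange (C * n)) \sum_(x <- zrange (C * n)) 1 * zsgn x * G x y
  - \sum_(x <- zrange (C * n)) \sum_(y <- zrange (C * n)) 1 * zsgn y * G x y
  - \sum_(y <- zrange (C * n)) \sum_(x <- zrange (C * n)) zsgn y * zsgn x * G x y.
  rewrite exchange_big [X in _ = _ - X - _]exchange_big -!sumrN -!big_split.
  apply: eq_bigr => y _ /=; rewrite -!sumrN -!big_split; apply: eq_bigr => x _ /=.
  by rewrite !zsgn_even; case: (2 %| x)%Z; case: (2 %| y)%Z => /=; ring.
rewrite 2!mulrDl; apply: le_trans (ler_normB _ _) _; apply: lerD; last first.
  by apply: H1 => // y; rewrite norm_zsgn.
apply: le_trans (ler_normB _ _) _; rewrite normrN; apply: lerD.
  by apply: (H1 (fun=> 1)) => // y; rewrite normr1.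
rewrite /G; under eq_bigr => x _ do under eq_bigr => y _ do rewrite qform_swap.
by apply: (H2 (fun=> 1)) => // y; rewrite normr1.
Qed.

(** * Multiplicative functions and roots of quadratic congruences *)

Definition arith_mult (F : nat -> int) : Prop :=
  F 1%N = 1 /\
  forall m n, (0 < m)%N -> (0 < n)%N -> coprime m n -> F (m * n)%N = F m * F n.

Definition dconv (F G : nat -> int) (n : nat) : int :=
  \sum_(d <- divisors n) F d * G (n %/ d)%N.

Lemma coprime_split m n d : (0 < m)%N -> coprime m n -> (d %| m * n)%N ->
  exists d1 d2, [/\ (d1 %| m)%N, (d2 %| n)%N & d = (d1 * d2)%N].
Proof.
move=> m0 co dmn; pose g := gcdn d m.
have g0 : (0 < g)%N by rewrite gcdn_gt0 m0 orbT.
exists g, (d %/ g)%N; split; first exact: dvdn_gcdr.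
  have co' : coprime (d %/ g) (m %/ g).
    rewrite /coprime -(eqn_pmul2l g0) muln_gcdr muln1 ![(g * _)%N]mulnC.
    by rewrite !divnK ?dvdn_gcdl ?dvdn_gcdr.
  rewrite -(Gauss_dvdr _ co') -(@dvdn_pmul2l g) // mulnA ![(g * (_ %/ _))%N]mulnC.
  by rewrite !divnK ?dvdn_gcdl ?dvdn_gcdr.
by rewrite mulnC divnK ?dvdn_gcdl.
Qed.

Lemma coprime_factor_gcd m n d1 d2 : coprime m n -> (d1 %| m)%N -> (d2 %| n)%N ->
  gcdn (d1 * d2) m = d1.
Proof.
move=> co d1m d2n; rewrite gcdnC Gauss_gcdl; last exact: coprime_dvdr d2n co.
by apply/eqP; rewrite eqn_dvd dvdn_gcdr dvdn_gcd d1m dvdnn.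
Qed.

Lemma divisors_coprime_perm m n : (0 < m)%N -> (0 < n)%N -> coprime m n ->
  perm_eq (divisors (m * n)) [seq (d1 * d2)%N | d1 <- divisors m, d2 <- divisors n].
Proof.
move=> m0 n0 co; have mn0 : (0 < m * n)%N by rewrite muln_gt0 m0.
apply: uniq_perm; first exact: divisors_uniq.
  apply: allpairs_uniq; rewrite ?divisors_uniq // => -[a b] [c d].
  move=> /allpairsP[[a' b']] /= [aD bD [-> ->]] /allpairsP[[c' d']] /= [cD dD [-> ->]] E.
  move: aD bD cD dD; rewrite -!dvdn_divisors // => am bn cm dn.
  have a0 : (0 < a')%N := dvdn_gt0 m0 am.
  have ac : a' = c'.
    by rewrite -(coprime_factor_gcd co am bn) E (coprime_factor_gcd co cm dn).
  by rewrite -ac in E *; move/eqP: E; rewrite eqn_pmul2l // => /eqP ->.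
move=> d; rewrite -dvdn_divisors //; apply/idP/allpairsP => [dmn|].
  have [d1 [d2 [h1 h2 ->]]] := coprime_split m0 co dmn.
  by exists (d1, d2); rewrite /= -!dvdn_divisors.
by case=> -[d1 d2] /= []; rewrite -!dvdn_divisors // => h1 h2 ->; apply: dvdn_mul.
Qed.

Lemma dconv_mult F G : arith_mult F -> arith_mult G -> arith_mult (dconv F G).
Proof.
move=> [F1 FM] [G1 GM]; split; first by rewrite /dconv big_seq1 divnn F1 G1 mulr1.
move=> m n m0 n0 co; rewrite /dconv (perm_big _ (divisors_coprime_perm m0 n0 co)) /=.
rewrite big_allpairs_dep /= big_distrlr /=.
apply: eq_big_seq => d1; rewrite -dvdn_divisors // => d1m.
apply: eq_big_seq => d2; rewrite -dvdn_divisors // => d2n.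
have d10 := dvdn_gt0 m0 d1m; have d20 := dvdn_gt0 n0 d2n.
rewrite FM //; last exact: coprime_dvdl d1m (coprime_dvdr d2n co).
have -> : (m * n %/ (d1 * d2) = (m %/ d1) * (n %/ d2))%N.
  have [m' mE] := dvdnP d1m; have [n' nE] := dvdnP d2n.
  by rewrite mE nE mulnACA !mulnK // muln_gt0 d10.
have m1 : (0 < m %/ d1)%N by rewrite divn_gt0 // dvdn_leq.
have n1 : (0 < n %/ d2)%N by rewrite divn_gt0 // dvdn_leq.
have co' : coprime (m %/ d1) (n %/ d2).
  by apply: coprime_dvdl (coprime_dvdr _ co); apply: dvdn_div.
by rewrite (GM _ _ m1 n1 co') mulrACA.
Qed.

Lemma arith_mult_ext F G : arith_mult F -> arith_mult G ->
  (forall q e, prime q -> F (q ^ e)%N = G (q ^ e)%N) ->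
  forall n, (0 < n)%N -> F n = G n.
Proof.
move=> [F1 FM] [G1 GM] pp n; elim/ltn_ind: n => n IH n0.
have [n1|n1] := leqP n 1; first by have -> : n = 1%N; [lia | rewrite F1 G1].
have q_pr := pdiv_prime n1; set q := pdiv n in q_pr.
have [m co nE] := pfactor_coprime q_pr n0.
have m0 : (0 < m)%N by move: n0; rewrite nE muln_gt0 => /andP[].
have qe0 : (0 < q ^ logn q n)%N by rewrite expn_gt0 prime_gt0.
have co' : coprime m (q ^ logn q n) by rewrite coprime_sym coprimeXl.
rewrite nE FM // GM // pp // IH // nE ltn_Pmulr //.
by rewrite -(exp1n (logn q n)) ltn_exp2r ?prime_gt1 // logn_gt0 mem_primes q_pr n0 pdiv_dvd.
Qed.

Lemma dconv_pfactor F G q e : prime q ->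
  dconv F G (q ^ e) = \sum_(0 <= i < e.+1) F (q ^ i)%N * G (q ^ (e - i))%N.
Proof.
move=> q_pr; have q0 := prime_gt0 q_pr; have q1 := prime_gt1 q_pr.
have pe : perm_eq (divisors (q ^ e)) [seq (q ^ i)%N | i <- iota 0 e.+1].
  apply: uniq_perm; first exact: divisors_uniq.
    by rewrite map_inj_uniq ?iota_uniq //; apply: expnI.
  move=> d; rewrite -dvdn_divisors ?expn_gt0 ?q0 //.
  apply/(dvdn_pfactor d e q_pr)/mapP => [[i le ->]|[i]].
    by exists i => //; rewrite mem_iota.
  by rewrite mem_iota add0n ltnS => /andP[_ le] ->; exists i.
rewrite /dconv (perm_big _ pe) big_map /index_iota subn0.
apply: eq_big_seq => i; rewrite mem_iota add0n ltnS => /andP[_ le].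
by rewrite -expnB.
Qed.

(** Convolved with [nroots], it counts ideals by norm: the ideal [k (Z a + Z (b + w))] has norm
    [k^2 a], and [issq] accounts for the content k. *)
Definition issq (d : nat) : int := ([exists k : 'I_d.+1, (k ^ 2 == d)%N] : nat)%:Z.

Lemma issqP d : reflect (exists k, (k ^ 2 = d)%N) [exists k : 'I_d.+1, (k ^ 2 == d)%N].
Proof.
apply: (iffP existsP) => [[k /eqP <-]|[k kd]]; first by exists k.
have lt : (k < d.+1)%N 
  by rewrite ltnS -kd; case: (k) => // i; rewrite expnS leq_pmulr // expn_gt0.
by exists (Ordinal lt); rewrite /= kd.
Qed.

(** With [g = gcd(k, m)], the quotient m / g and g divide each other, so m is the square of g. *)
Lemma coprime_square m n k : (0 < m)%N -> coprime m n -> (k ^ 2 = m * n)%N ->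
  exists g, (g ^ 2 = m)%N.
Proof.
move=> m0 co E; pose g := gcdn k m; exists g.
have g0 : (0 < g)%N by rewrite gcdn_gt0 m0 orbT.
have [k' kE] := dvdnP (dvdn_gcdl k m); have [m' mE] := dvdnP (dvdn_gcdr k m).
rewrite -/g in kE mE.
have co' : coprime k' m'.
  by rewrite /coprime -(eqn_pmul2l g0) muln_gcdr ![(g * _)%N]mulnC -kE -mE mul1n.
have E2 : (g * k' ^ 2 = m' * n)%N.
  by apply/eqP; rewrite -(eqn_pmul2l g0); apply/eqP; move: E; rewrite kE mE; nia.
have h1 : (m' %| g)%N.
  have : (m' %| g * k' ^ 2)%N by rewrite E2 dvdn_mulr.
  by rewrite Gauss_dvdl // coprime_sym coprimeXl.
have h2 : (g %| m')%N.
  have : (g %| m' * n)%N by rewrite -E2 dvdn_mulr.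
  by rewrite Gauss_dvdl //; apply: coprime_dvdl co; apply: dvdn_gcdr.
have -> : m = (m' * g)%N by [].
by have /eqP -> : m' == g; [rewrite eqn_dvd h1 h2 | rewrite mulnn].
Qed.

Lemma issq_mult : arith_mult issq.
Proof.
split.
  rewrite /issq; have -> : [exists k : 'I_2, (k ^ 2 == 1)%N] by apply/issqP; exists 1%N.
  by [].
move=> m n m0 n0 co; rewrite /issq -PoszM mulnb; congr (Posz (nat_of_bool _)).
apply/issqP/andP => [[k E]|[/issqP[k <-] /issqP[l <-]]].
  split; apply/issqP; first exact: coprime_square E.
  by apply: (@coprime_square _ m k); rewrite ?[coprime n m]coprime_sym ?[(n * m)%N]mulnC.
by exists (k * l)%N; rewrite expnMn.
Qed.

Lemma issq_pfactor q i : prime q -> issq (q ^ i) = (~~ odd i : nat)%:Z.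
Proof.
move=> q_pr; rewrite /issq; congr (Posz (nat_of_bool _)).
apply/issqP/idP => [[k E]|ev].
  have : logn q (k ^ 2) = i by rewrite E pfactorK.
  by rewrite lognX mul2n => <-; rewrite odd_double.
by exists (q ^ i./2)%N; rewrite -expnM muln2 even_halfK.
Qed.

Lemma sum_issq (H : nat -> int) N : (forall n, (N < n)%N -> H n = 0) ->
  \sum_(1 <= d < N.+1) issq d * H d = \sum_(1 <= k < N.+1) H (k ^ 2)%N.
Proof.
move=> supp; rewrite /index_iota subSS subn0.
rewrite (big_reindex_supp (t := iota 1 N) (g := fun k => (k ^ 2)%N)
   (P := fun d => [exists k : 'I_d.+1, (k ^ 2 == d)%N])) ?iota_uniq //.
- rewrite [RHS]big_mkcond; apply: eq_bigr => d _; rewrite /issq.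
  by case: [exists _, _]; rewrite /= ?mul1r ?mul0r.
- by move=> x y _ _ /eqP; rewrite eqn_exp2r // => /eqP.
- move=> k; rewrite !mem_iota add1n ltnS => /andP[k1 kN] Hk; apply/andP; split; last first.
    by apply/issqP; exists k.
  rewrite expn_gt0 k1 /= ltnS leqNgt; apply/negP => h.
  by rewrite supp ?eqxx in Hk.
- move=> d; rewrite mem_iota add1n ltnS => /andP[d1 dN] /issqP[k kd] _.
  exists k => //; rewrite mem_iota add1n ltnS.
  have k0 : (0 < k)%N by move: d1; rewrite -kd expn_gt0 orbF.
  by rewrite k0 (leq_trans _ dN) // -kd -{1}[k]expn1 leq_pexp2l.
Qed.

Lemma sum_dconv (F G w : nat -> int) N : (forall n, (N < n)%N -> w n = 0) ->
  \sum_(1 <= n < N.+1) dconv F G n * w n =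
  \sum_(1 <= d < N.+1) \sum_(1 <= m < N.+1) F d * G m * w (d * m)%N.
Proof.
move=> supp; transitivity (\sum_(1 <= n < N.+1) \sum_(1 <= d < N.+1 | (d %| n)%N)
   F d * G (n %/ d)%N * w n).
  apply: eq_big_nat => n /andP[n1 nN]; rewrite /dconv mulr_suml -[RHS]big_filter.
  apply: perm_big; apply: uniq_perm; rewrite ?divisors_uniq ?filter_uniq ?iota_uniq //.
  move=> d; rewrite mem_filter -dvdn_divisors // mem_index_iota andbC.
  case dn: (d %| n)%N; rewrite ?andbF // andbT.
  by rewrite (dvdn_gt0 n1 dn) ltnS (leq_trans (dvdn_leq n1 dn)).
under eq_bigr => n _ do rewrite big_mkcond /=.
rewrite exchange_big /=; apply: eq_big_nat => d /andP[d1 dN].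
rewrite -big_mkcond /= /index_iota subSS subn0.
transitivity (\sum_(m <- iota 1 N) F d * G ((d * m) %/ d)%N * w (d * m)%N); last first.
  by apply: eq_bigr => m _; rewrite mulKn.
apply/esym; apply: (big_reindex_supp (F := fun n => F d * G (n %/ d)%N * w n)
  (g := fun m => (d * m)%N)); rewrite ?iota_uniq //.
- by move=> x y _ _ /eqP; rewrite eqn_pmul2l // => /eqP.
- move=> m; rewrite !mem_iota add1n ltnS => /andP[m1 mN] Hk.
  rewrite dvdn_mulr // muln_gt0 d1 m1 /= andbT ltnS leqNgt; apply/negP => h.
  by rewrite supp ?mulr0 ?eqxx in Hk.
- move=> n; rewrite mem_iota add1n ltnS => /andP[n1 nN] /dvdnP[m mE] _.
  exists m; last by rewrite mulnC.
  have m0 : (0 < m)%N by move: n1; rewrite mE muln_gt0 => /andP[].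
  by rewrite mem_iota add1n m0 ltnS (leq_trans _ nN) // mE leq_pmulr.
Qed.

(** The norm of b + w when w has trace [tau] and norm [nu]. *)
Definition qpoly (tau nu b : nat) : nat := (b ^ 2 + tau * b + nu)%N.

Definition nroots (tau nu a : nat) : int :=
  \sum_(0 <= b < a) ((a %| qpoly tau nu b)%N : nat)%:Z.

Lemma qpoly_mod tau nu d b : qpoly tau nu (b %% d) = qpoly tau nu b %[mod d].
Proof.
rewrite /qpoly -modnDml -[in RHS]modnDml; congr ((_ + _) %% d)%N.
by rewrite -modnDm modnXm modnMmr modnDm.
Qed.

Lemma dvdn_qpoly_mod tau nu d b :
  (d %| qpoly tau nu (b %% d))%N = (d %| qpoly tau nu b)%N.
Proof. by rewrite /dvdn qpoly_mod. Qed.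

Lemma nroots_mult tau nu : arith_mult (nroots tau nu).
Proof.
split; first by rewrite /nroots big_nat1 dvd1n.
move=> m n m0 n0 co; rewrite /nroots big_distrlr /=.
pose F (z : nat * nat) : int :=
  ((m %| qpoly tau nu z.1)%N : nat)%:Z * ((n %| qpoly tau nu z.2)%N : nat)%:Z.
transitivity (\sum_(b <- iota 0 (m * n)) F ((b %% m)%N, (b %% n)%N)).
  rewrite /index_iota subn0; apply: eq_bigr => b _.
  by rewrite /F /= !dvdn_qpoly_mod -PoszM mulnb Gauss_dvd.
rewrite (big_reindex_supp (g := fun b => ((b %% m)%N, (b %% n)%N)) (P := xpredT)
  (t := [seq (x, y) | x <- iota 0 m, y <- iota 0 n])) ?iota_uniq //.
- by rewrite big_allpairs_dep /= /index_iota !subn0.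
- by apply: allpairs_uniq; rewrite ?iota_uniq // => -[? ?] [? ?] _ _ [-> ->].
- move=> x y; rewrite !mem_iota !add0n /= => xl yl [h1 h2].
  by rewrite -(modn_small xl) -(modn_small yl) (chinese_mod co x) (chinese_mod co y) h1 h2.
- move=> x _ _; rewrite andbT; apply/allpairsP; exists ((x %% m)%N, (x %% n)%N) => /=.
  by rewrite !mem_iota !add0n /= !ltn_pmod.
- move=> z /allpairsP[[x y] /= []]; rewrite !mem_iota !add0n /= => xm yn -> _ _.
  exists (chinese m n x y %% (m * n))%N.
    by rewrite mem_iota add0n ltn_pmod // muln_gt0 m0.
  congr (_, _).
    by rewrite modn_dvdm ?dvdn_mulr // chinese_modl // modn_small.
  by rewrite modn_dvdm ?dvdn_mull // chinese_modr // modn_small.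
Qed.

Lemma sum_nat_mul (V : nmodType) (F : nat -> V) A k :
  \sum_(0 <= b < A * k) F b = \sum_(0 <= j < k) \sum_(0 <= b < A) F (b + A * j)%N.
Proof.
elim: k => [|k IH]; first by rewrite muln0 !big_geq.
rewrite big_nat_recr //= -IH mulnSr (@big_cat_nat _ _ _ (A * k)) ?leq_addr //=.
by congr (_ + _); rewrite -{1}[(A * k)%N]add0n big_addn addnC addnK.
Qed.

Lemma sum_linear_congr q m s : (0 < q)%N -> coprime q s ->
  \sum_(0 <= j < q) ((q %| m + j * s)%N : nat)%:Z = 1.
Proof.
move=> q0 co; have [a aq] := Bezoutl s q0; rewrite (eqP co) => qa.
pose j0 := ((a * m) %% q)%N.
have j0P : (q %| m + j0 * s)%N.
  rewrite /dvdn /j0 -modnDmr modnMml modnDmr.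
  have -> : (m + a * m * s = m * (1 + a * s))%N by nia.
  by rewrite -[_ == _]/(q %| _)%N dvdn_mull.
rewrite (bigD1_seq j0) /= ?mem_index_iota ?ltn_pmod ?iota_uniq // j0P.
rewrite big_nat_cond big1 ?addr0 // => j /andP[/andP[_ jq] jj0].
case h: (q %| _)%N => //; case/eqP: jj0.
have jq0 : (j0 < q)%N by rewrite ltn_pmod.
have : j * s = j0 * s %[mod q].
  by apply/eqP; rewrite -(eqn_modDl m) (eqP h) (eqP j0P).
wlog le : j j0 {h j0P} jq jq0 / (j0 <= j)%N => [W E|].
  case/orP: (leq_total j0 j) => le; first exact: W.
  by apply/esym; apply: W.
move/eqP; rewrite eqn_mod_dvd ?leq_mul2r ?le ?orbT // -mulnBl Gauss_dvdl // => dv.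
have : (j - j0 = 0)%N.
  by apply/eqP; rewrite -leqn0 leqNgt; apply/negP => h; have := dvdn_leq h dv; lia.
by lia.
Qed.

(** A residue modulo [q ^ e.+1] is [b + q ^ e * j]. Over a root b the congruence becomes linear in
    j, with slope [2 * b + tau] invertible modulo q, so exactly one j works; over any other b none
    does. *)
Lemma nroots_hensel tau nu q e : prime q -> (0 < e)%N ->
  (forall b, (q %| qpoly tau nu b)%N -> ~~ (q %| 2 * b + tau)%N) ->
  nroots tau nu (q ^ e.+1) = nroots tau nu (q ^ e).
Proof.
move=> q_pr e0 sep; rewrite /nroots expnSr sum_nat_mul exchange_big /=.
have A0 : (0 < q ^ e)%N by rewrite expn_gt0 prime_gt0.
set A := (q ^ e)%N in A0 *; have qA : (q %| A)%N by rewrite dvdn_exp.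
apply: eq_bigr => b _.
have E j : qpoly tau nu (b + A * j) =
    (qpoly tau nu b + A * (j * (2 * b + tau)) + A * (A * j ^ 2))%N.
  by rewrite /qpoly; nia.
case h: (A %| qpoly tau nu b)%N; last first.
  apply: big1 => j _; case h2: (_ %| _)%N => //.
  have : (A %| qpoly tau nu (b + A * j))%N by apply: dvdn_trans h2; apply: dvdn_mulr.
  by rewrite E -addnA -mulnDr dvdn_addl ?h // dvdn_mulr.
have [m mE] := dvdnP h.
rewrite -[RHS](@sum_linear_congr q m (2 * b + tau)) ?prime_gt0 //; last first.
  by rewrite prime_coprime // sep // (dvdn_trans qA).
apply: eq_bigr => j _; congr (Posz (nat_of_bool _)).
rewrite E dvdn_addl; last by rewrite dvdn_pmul2l // dvdn_mulr.
by rewrite mE [(m * A)%N]mulnC -mulnDr dvdn_pmul2l.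
Qed.

Lemma nroots_ramified tau nu q e : (1 < e)%N ->
  (forall b, ~~ (q ^ 2 %| qpoly tau nu b)%N) -> nroots tau nu (q ^ e) = 0.
Proof.
move=> e1 ram; rewrite /nroots big1 // => b _; case h: (_ %| _)%N => //.
by case/negP: (ram b); apply: dvdn_trans h; apply: dvdn_exp2l.
Qed.

(** The values 1, -1, 0 of [x] at q stand for q split, inert, ramified. Both sides are
    multiplicative, so prime powers suffice. There all three cases satisfy [nroots (q ^ e.+2) = x q
    ^+ e.+1 + x q ^+ e.+2], and this is what each side gains when the exponent grows from e to e +
    2. *)
Lemma ideal_count tau nu (x : nat -> int) :
  x 1%N = 1 -> (forall m n, x (m * n)%N = x m * x n) ->
  (forall q, prime q -> [|| x q == 0, x q == 1 | x q == -1]) ->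
  (forall q, prime q -> nroots tau nu q = 1 + x q) ->
  (forall q b, prime q -> x q != 0 -> (q %| qpoly tau nu b)%N -> ~~ (q %| 2 * b + tau)%N) ->
  (forall q b, prime q -> x q = 0 -> ~~ (q ^ 2 %| qpoly tau nu b)%N) ->
  forall n, (0 < n)%N -> dconv issq (nroots tau nu) n = dconv x (fun=> 1) n.
Proof.
move=> x1 xM xv xr unr ram; apply: arith_mult_ext.
- exact: dconv_mult issq_mult (nroots_mult _ _).
- by apply: dconv_mult; split=> // m n; rewrite mulr1.
move=> q e q_pr.
have xX i : x (q ^ i)%N = x q ^+ i by elim: i => // i IH; rewrite expnS xM IH exprS.
have nr e' : nroots tau nu (q ^ e'.+2) = x q ^+ e'.+1 + x q ^+ e'.+2.
  have [x0|xn0] := eqVneq (x q) 0.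
    by rewrite nroots_ramified ?x0 ?expr0n //= => b; apply: ram.
  have -> : nroots tau nu (q ^ e'.+2) = nroots tau nu q.
    elim: e' => [|e' IH].
      by rewrite nroots_hensel ?expn1 // => b; apply: unr.
    by rewrite nroots_hensel // => b; apply: unr.
  rewrite xr //; case/or3P: (xv q q_pr) => /eqP E; rewrite E ?eqxx // in xn0 *.
    by rewrite !expr1n.
  by rewrite !exprS; ring.
rewrite !dconv_pfactor //.
under eq_bigr => i _ do rewrite issq_pfactor //.
under [RHS]eq_bigr => i _ do rewrite xX mulr1.
elim/ltn_ind: e => -[|[|e]] IH.
- by rewrite !big_nat1 /= expn0 (proj1 (nroots_mult _ _)) mulr1.
- by rewrite !big_nat_recr //= !big_geq //= add0r expn1 xr //
     mul0r addr0 mul1r expr0 expr1 add0r.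
rewrite [LHS]big_nat_recl // [X in _ + X = _]big_nat_recl //.
rewrite [RHS]big_nat_recr // [X in _ = X + _]big_nat_recr //=.
rewrite mul1r mul0r add0r subn0 nr.
have -> : \sum_(0 <= i < e.+1) (~~ odd i.+2)%N%:Z * nroots tau nu (q ^ (e.+2 - i.+2)) =
   \sum_(0 <= i < e.+1) (x q ^+ i).
  rewrite -IH //; apply: eq_bigr => i _; rewrite !subSS /=.
  by rewrite negbK.
by ring.
Qed.

(** * Legendre symbols *)

(** Euler's criterion is taken as the definition, so that the symbol is multiplicative and can be
    computed in extension fields; the link with squares is [card_sqrt]. *)
Definition leg (p : nat) (x : 'F_p) : int :=
  if x == 0 then 0 else if x ^+ ((p - 1) %/ 2) == 1 then 1 else -1.

(** The Kronecker symbol (2/n), the quadratic character attached to Q(sqrt 2). *)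
Definition chi8 (n : nat) : int :=
  match (n %% 8)%N with 1 | 7 => 1 | 3 | 5 => -1 | _ => 0 end.

Lemma intr_pchar_eq0 (R : nzRingType) (q : nat) (z : int) : q \in [pchar R] ->
  (z%:~R == 0 :> R) = (q %| `|z|)%N.
Proof.
move=> qR; rewrite (dvdn_pcharf qR); case: z => n //=.
by rewrite NegzE mulrNz oppr_eq0.
Qed.

Lemma sum_Fp (V : nmodType) (q : nat) (F : 'F_q -> V) : prime q ->
  \sum_(0 <= b < q) F b%:R = \sum_(x : 'F_q) F x.
Proof.
move=> q_pr; transitivity (\sum_(x : 'F_q) F (x : nat)%:R); last first.
  by apply: eq_bigr => x _; rewrite natr_Zp.
by rewrite -(big_mkord xpredT (fun b => F b%:R)) Fp_cast.
Qed.

Lemma finfield_prim_root (F : finFieldType) (n : nat) : (n %| #|F|.-1)%N ->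
  exists z : F, n.-primitive_root z.
Proof.
move=> nF; have F1 := finNzRing_gt1 F.
have N0 : (0 < #|F|.-1)%N by rewrite -subn1 subn_gt0.
have : has (#|F|.-1).-primitive_root [seq x <- enum F | x != 0].
  apply: has_prim_root => //.
  - apply/allP => x; rewrite mem_filter => /andP[x0 _].
    rewrite unity_rootE; apply/eqP; apply: (mulfI x0).
    by rewrite -exprS prednK ?expf_card ?mulr1 // ltnW.
  - by rewrite filter_uniq ?enum_uniq.
  - rewrite size_filter -sum1_count big_enum_cond /= sum1_card.
    by rewrite -(cardC1 (0 : F)) subset_leq_card.
case/hasP => z _ zP; exists (z ^+ (#|F|.-1 %/ n)%N).
by have := dvdn_prim_root zP nF.
Qed.

Section Legendre.

Variable p : nat.
Hypothesis p_prime : prime p.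
Hypothesis p_odd : odd p.

Let p_gt2 : (2 < p)%N.
Proof. by case: p p_prime p_odd => [|[|[|]]]. Qed.

Let half_pred : ((p - 1) %/ 2 * 2 = p - 1)%N.
Proof. by move: p_odd; lia. Qed.

Let half_gt0 : (0 < (p - 1) %/ 2)%N.
Proof. by move: p_odd p_gt2; lia. Qed.

Lemma Fp_half_sqr (x : 'F_p) : x != 0 -> (x ^+ ((p - 1) %/ 2)) ^+ 2 = 1.
Proof.
move=> x0; rewrite -exprM half_pred; apply: (mulfI x0).
have := expf_card x; rewrite card_Fp // => xp.
by rewrite -exprS subn1 prednK ?prime_gt0 // mulr1.
Qed.

Lemma leg_cases (x : 'F_p) : [|| leg x == 0, leg x == 1 | leg x == -1].
Proof. by rewrite /leg; case: ifP => // _; case: ifP. Qed.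

Lemma intr_leg (x : 'F_p) : (leg x)%:~R = x ^+ ((p - 1) %/ 2).
Proof.
rewrite /leg; case: eqP => [->|/eqP x0]; first by rewrite expr0n eqn0Ngt half_gt0.
case: eqP => [->//|/eqP x1].
have := Fp_half_sqr x0; move/eqP; rewrite sqrf_eq1 (negbTE x1) /= => /eqP ->.
by rewrite mulrNz.
Qed.

Lemma sign_intr_inj (R : nzRingType) (a b : int) : p \in [pchar R] ->
  [|| a == 0, a == 1 | a == -1] -> [|| b == 0, b == 1 | b == -1] ->
  a%:~R = b%:~R :> R -> a = b.
Proof.
move=> pR ha hb /eqP; rewrite -subr_eq0 -mulrzBr (intr_pchar_eq0 _ pR) => dv.
apply/eqP; rewrite -subr_eq0 -absz_eq0 eqn0Ngt; apply/negP => h.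
by have := dvdn_leq h dv; lia.
Qed.

Lemma legM (x y : 'F_p) : leg (x * y) = leg x * leg y.
Proof.
apply: (sign_intr_inj (pchar_Fp p_prime)); rewrite ?leg_cases //.
  by case/or3P: (leg_cases x) => /eqP ->; case/or3P: (leg_cases y) => /eqP ->.
by rewrite intrM !intr_leg exprMn.
Qed.

Lemma leg0 : leg (0 : 'F_p) = 0.
Proof. by rewrite /leg eqxx. Qed.

Lemma leg1 : leg (1 : 'F_p) = 1.
Proof. by rewrite /leg oner_eq0 expr1n eqxx. Qed.

Lemma leg_eq0 (x : 'F_p) : (leg x == 0) = (x == 0).
Proof. by rewrite /leg; case: (x == 0) => //; case: ifP. Qed.

Lemma leg_sqr (x : 'F_p) : x != 0 -> leg x * leg x = 1.
Proof.
by rewrite -leg_eq0; case/or3P: (leg_cases x) => /eqP ->.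
Qed.

Lemma legX (x : 'F_p) n : odd n -> leg x ^+ n = leg x.
Proof.
move=> on; case/or3P: (leg_cases x) => /eqP ->.
- by rewrite expr0n; case: n on.
- by rewrite expr1n.
- by rewrite -signr_odd on.
Qed.

Lemma card_sqrt (d : 'F_p) : \sum_(y : 'F_p) ((y ^+ 2 == d) : nat)%:Z = 1 + leg d.
Proof.
have Fc := card_Fp p_prime.
have two0 : 2%:R != 0 :> 'F_p.
  by rewrite -(dvdn_pcharf (pchar_Fp p_prime)) gtnNdvd.
have [->|d0] := eqVneq d 0.
  rewrite leg0 addr0 (bigD1 (0 : 'F_p)) //= [X in _ + X]big1 => [|y y0].
    by rewrite ?expr0n ?eqxx ?addr0.
  by rewrite expf_eq0 (negbTE y0).
have [d1|d1] := eqVneq (d ^+ ((p - 1) %/ 2)) 1; last first.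
  rewrite /leg (negbTE d0) (negbTE d1) subrr big1 // => y _.
  case: eqP => // yd; case/eqP: d1; rewrite -yd -exprM mulnC exprM Fp_half_sqr //.
  by apply: contraNneq d0 => y0; rewrite -yd y0 expr0n.
have [y yd] : exists y : 'F_p, y ^+ 2 = d.
  have [z zP] := @finfield_prim_root 'F_p #|'F_p|.-1 (dvdnn _).
  rewrite Fc in zP.
  have dN : d ^+ p.-1 = 1 by rewrite -subn1 -half_pred exprM d1 expr1n.
  have [i iE] := prim_rootP zP dN.
  move: d1; rewrite iE -exprM => /eqP; rewrite -(prim_order_dvd zP) => dv.
  exists (z ^+ (i %/ 2)); rewrite -exprM; congr (_ ^+ _).
  move: dv; move: (nat_of_ord i) => k; rewrite -subn1 -[X in (X %| _)%N]half_pred.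
  by rewrite [(k * _)%N]mulnC dvdn_pmul2l //; lia.
have y0 : y != 0 by apply: contraNneq d0 => y0; rewrite -yd y0 expr0n.
have yN : - y != y.
  by rewrite -subr_eq0 -opprD oppr_eq0 -mulr2n -mulr_natr mulf_neq0.
rewrite /leg (negbTE d0) d1 eqxx (bigD1 y) //= (bigD1 (- y)) //=.
rewrite sqrrN yd eqxx big1 ?addr0 // => w /andP[w1 w2].
by rewrite -yd eqf_sqr (negbTE w1) (negbTE w2).
Qed.

Lemma nroots_leg (tau nu : nat) :
  nroots tau nu p = 1 + leg ((tau ^ 2)%:R - (4 * nu)%:R : 'F_p).
Proof.
have two0 : 2%:R != 0 :> 'F_p.
  by rewrite -(dvdn_pcharf (pchar_Fp p_prime)) gtnNdvd.
rewrite -card_sqrt /nroots.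
pose F (x : 'F_p) : int := ((x ^+ 2 + tau%:R * x + nu%:R == 0) : nat)%:Z.
transitivity (\sum_(x : 'F_p) F x).
  rewrite -(sum_Fp _ p_prime); apply: eq_bigr => b _; rewrite /F.
  by rewrite (dvdn_pcharf (pchar_Fp p_prime)) /qpoly !natrD natrX natrM.
rewrite (reindex (fun y : 'F_p => (y - tau%:R) / 2%:R)) /=; last first.
  exists (fun x => 2%:R * x + tau%:R) => x _; first by rewrite mulrC divfK ?subrK.
  by rewrite addrK [2%:R * x]mulrC mulfK.
apply: eq_bigr => y _; rewrite /F; congr (Posz (nat_of_bool _)).
rewrite -[RHS]subr_eq0 -[RHS](inj_eq (mulIf (_ : (4%:R)^-1 != 0))); last first.
  by rewrite invr_eq0 (natrM _ 2 2) mulf_neq0.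
rewrite mul0r; congr (_ == _); rewrite natrX natrM.
have four0 : 4%:R != 0 :> 'F_p by rewrite (natrM _ 2 2) mulf_neq0.
field.
by rewrite two0 four0.
Qed.

(** Euler's criterion for an integer is an identity between images of integers, so it can be tested
    in any field of characteristic p, in particular in one that contains the roots of unity of a
    Gauss sum. *)
Lemma leg_of_pchar (L : fieldType) (u : int) : p \in [pchar L] ->
  forall c : int, [|| c == 0, c == 1 | c == -1] ->
  u%:~R ^+ ((p - 1) %/ 2) = c%:~R :> L -> leg (u%:~R : 'F_p) = c.
Proof.
move=> pL c hc E; apply: (sign_intr_inj (pchar_Fp p_prime)); rewrite ?leg_cases //.
rewrite intr_leg; apply/eqP; rewrite -subr_eq0 -rmorphXn -rmorphB /=.
rewrite (intr_pchar_eq0 _ (pchar_Fp p_prime)) -(intr_pchar_eq0 _ pL).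
by rewrite rmorphB rmorphXn subr_eq0 /= E.
Qed.

(* In a field with a primitive 8th root of unity z, the element z + 1/z
   squares to 2, and the p-th power map sends it to chi8(p) times itself. *)
Lemma leg2 : leg (2%:R : 'F_p) = chi8 p.
Proof.
(* Odd squares are 1 modulo 8, so the field with p^2 elements has a primitive 8th root of unity. *)
have [L pL cL] := pPrimePowerField p_prime (isT : 0 < 2)%N.
have [z zP] : exists z : L, 8.-primitive_root z.
  apply: finfield_prim_root; rewrite cL.
  have -> : p = ((p %/ 2).*2.+1)%N by move: p_odd; lia.
  set k := (p %/ 2)%N.
  have -> : ((k.*2.+1 ^ 2).-1 = 4 * (k * k.+1))%N by rewrite -mul2n; nia.
  rewrite (@dvdn_pmul2l 4 2) //; case/boolP: (2 %| k)%N => h; first exact: dvdn_mulr.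
  by rewrite dvdn_mull //; lia.
have z8 : z ^+ 8 = 1 := prim_expr_order zP.
have z4 : z ^+ 4 = -1.
  have /eqP := z8; rewrite (exprM _ 4 2) sqrf_eq1 => /orP[|/eqP //].
  by rewrite -(prim_order_dvd zP).
pose g := z + z ^+ 7.
have g2 : g ^+ 2 = 2%:R.
  have -> : g ^+ 2 = z ^+ 2 + 2%:R * z ^+ 8 + z ^+ 2 * z ^+ 8 * z ^+ 4 by rewrite /g; ring.
  by rewrite z8 z4; ring.
have two0 : 2%:R != 0 :> L by rewrite -(dvdn_pcharf pL) gtnNdvd.
have g0 : g != 0 by apply: contraNneq two0 => g0; rewrite -g2 g0 expr0n.
have gp : g ^+ p = (chi8 p)%:~R * g.
  have -> : g ^+ p = z ^+ p + (z ^+ p) ^+ 7.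
    by rewrite -(pFrobenius_autE pL) rmorphD rmorphXn /= pFrobenius_autE.
  rewrite -(prim_expr_mod zP) /chi8 /g.
  have : odd (p %% 8) by move: p_odd; lia.
  have : (p %% 8 < 8)%N by rewrite ltn_pmod.
  have z5 : z ^+ 5 = - z by rewrite exprS z4 mulrN1.
  have z7 : z ^+ 7 = - z ^+ 3 by rewrite (exprD _ 4 3) z4 mulN1r.
  case: (p %% 8)%N => [|[|[|[|[|[|[|[|]]]]]]]] //= _ _.
  - by rewrite mul1r.
  - by rewrite -exprM -[z ^+ (3 * 7)](prim_expr_mod zP) /= z5 z7; ring.
  - by rewrite -exprM -[z ^+ (5 * 7)](prim_expr_mod zP) /= z5 z7; ring.
  - by rewrite -exprM -[z ^+ (7 * 7)](prim_expr_mod zP) /= mul1r addrC.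
have : leg (2%:~R : 'F_p) = chi8 p; last by [].
apply: (leg_of_pchar pL).
  by rewrite /chi8; case: (p %% 8)%N => [|[|[|[|[|[|[|[|]]]]]]]].
apply: (mulIf g0); rewrite -gp -[2%:~R]/(2%:R : L) -g2 -exprM -exprSr mulnC half_pred.
by congr (_ ^+ _); move: (prime_gt0 p_prime); lia.
Qed.

End Legendre.

Section QuadraticReciprocity.

Variable p : nat.
Hypotheses (p_prime : prime p) (p_mod4 : (p %% 4 = 3)%N).

Let p_odd : odd p. Proof. by move: p_mod4; lia. Qed.

Lemma legN1 : leg (-1 : 'F_p) = -1.
Proof.
apply: (sign_intr_inj p_prime p_odd (pchar_Fp p_prime)); rewrite ?leg_cases //.
rewrite intr_leg // -signr_odd; have -> : odd ((p - 1) %/ 2) by move: p_mod4; lia.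
by rewrite expr1 mulrNz.
Qed.

Lemma legN (x : 'F_p) : leg (- x) = - leg x.
Proof. by rewrite -mulN1r legM // legN1 mulN1r. Qed.

Lemma sum_leg : \sum_(x : 'F_p) leg x = 0.
Proof.
have : \sum_(x : 'F_p) leg x = - \sum_(x : 'F_p) leg x; last by lia.
rewrite {1}(reindex_inj (@oppr_inj _)) /= -sumrN; apply: eq_bigr => x _.
exact: legN.
Qed.

(* The quadratic Gauss sum g in a field of characteristic q satisfies
   g^2 = -p and g^q = (q/p) g. *)
Lemma leg_reciprocity q : prime q -> odd q -> q != p ->
  leg ((- p%:Z)%:~R : 'F_q) = leg (q%:R : 'F_p).
Proof.
move=> q_prime q_odd qp.
have cop : coprime q p by rewrite prime_coprime // dvdn_prime2.
(* By Fermat p divides q^(p - 1) - 1, so this field contains the p-th roots of unity. *)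
have [L qL cL] := @pPrimePowerField q p.-1 q_prime ltac:(by move: (prime_gt1 p_prime); lia).
have [z zP] : exists z : L, p.-primitive_root z.
  apply: finfield_prim_root; rewrite cL -subn1.
  have := Euler_exp_totient cop; rewrite totient_prime // => /eqP.
  by rewrite eqn_mod_dvd // expn_gt0 prime_gt0.
have pc := Fp_cast p_prime.
pose e (x : 'F_p) : L := z ^+ x.
have eD x y : e (x + y) = e x * e y.
  by rewrite /e -exprD -[RHS](prim_expr_mod zP) /= -{6}pc.
have e0 : e 0 = 1 by [].
have eMn x n : e (x *+ n) = e x ^+ n.
  by elim: n => [|n IH]; rewrite ?mulr0n ?mulrS ?eD ?IH ?exprS.
have p0 : p%:R != 0 :> L.
  by rewrite -(dvdn_pcharf qL) dvdn_prime2.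
have sume (s : 'F_p) : \sum_(x : 'F_p) e (x * s) = if s == 0 then p%:R else 0.
  have [->|s0] := eqVneq s 0.
    under eq_bigr => x _ do rewrite mulr0 e0.
    by rewrite sumr_const card_Fp.
  pose T := \sum_(x : 'F_p) e (x * s); rewrite -/T.
  have : e s * T = T.
    rewrite /T mulr_sumr [RHS](reindex_inj (addrI 1)) /=.
    by apply: eq_bigr => x _; rewrite mulrDl mul1r eD.
  move/eqP; rewrite -subr_eq0 -[X in _ - X]mul1r -mulrBl mulf_eq0 => /orP[|/eqP //].
  rewrite subr_eq0 /e -(prim_order_dvd zP) => ps; case/eqP: s0; apply: val_inj => /=.
  have := ltn_ord s; rewrite [X in (_ < X)%N]pc => lts.
  apply/eqP; rewrite eqn0Ngt; apply/negP => h.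
  by have := dvdn_leq h ps; rewrite leqNgt lts.
pose g : L := \sum_(x : 'F_p) (leg x)%:~R * e x.
have g2 : g ^+ 2 = - p%:R.
  (* The second index of the squared sum is written [x * t], and [leg x * leg x = 1]. The sum over x
     is then p - 1 if t = -1 and -1 otherwise; as the symbols add up to zero, [p * leg (-1)] is what
     remains. *)
  transitivity (\sum_(x : 'F_p | x != 0) \sum_(t : 'F_p) (leg t)%:~R * e (x * (1 + t))).
    rewrite expr2 /g mulr_suml (bigD1 0) //= leg0 !mul0r add0r.
    apply: eq_bigr => x x0; rewrite mulr_sumr.
    rewrite (reindex_inj (mulfI x0)) /=; apply: eq_bigr => t _.
    rewrite legM // mulrDr mulr1 eD.
    have xx : (leg x)%:~R * (leg x)%:~R = 1 :> L by rewrite -intrM leg_sqr.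
    transitivity ((leg x)%:~R * (leg x)%:~R * ((leg t)%:~R * (e x * e (x * t)))).
      by rewrite intrM; ring.
    by rewrite xx mul1r.
  rewrite exchange_big /=.
  transitivity (\sum_(t : 'F_p) ((leg t)%:~R * (if t == -1 then p%:R else 0)
    - (leg t)%:~R) : L).
    apply: eq_bigr => t _; rewrite -mulr_sumr.
    have E := sume (1 + t); rewrite (bigD1 0) //= mul0r e0 in E.
    have -> : \sum_(i | i != 0) e (i * (1 + t)) = (if t == -1 then p%:R else 0) - 1.
      have -> : (t == -1) = (1 + t == 0) by rewrite [1 + t]addrC addr_eq0.
      by rewrite -E addrAC subrr add0r.
    by rewrite mulrBr mulr1.
  rewrite sumrB -[X in _ - X]rmorph_sum /= sum_leg subr0 (bigD1 (-1)) //= eqxx legN1.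
  rewrite big1 ?addr0 ?mulrNz ?mulN1r // => t tN; by rewrite (negbTE tN) mulr0.
have g0 : g != 0.
  apply: contraNneq p0 => g0; have := g2; rewrite g0 expr0n /= => /eqP.
  by rewrite eq_sym oppr_eq0.
have q0 : q%:R != 0 :> 'F_p by rewrite -(dvdn_pcharf (pchar_Fp p_prime)) dvdn_prime2 // eq_sym.
have gq : g ^+ q = (leg (q%:R : 'F_p))%:~R * g.
  rewrite -(pFrobenius_autE qL) /g rmorph_sum mulr_sumr /=.
  rewrite [RHS](reindex_inj (mulfI q0)) /=; apply: eq_bigr => x _.
  rewrite rmorphM /= !pFrobenius_autE -eMn -[x *+ q]mulr_natl -rmorphXn /= legX //.
  rewrite (legM p_prime p_odd q%:R x).
  by rewrite intrM !mulrA -intrM (leg_sqr q0) mul1r.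
apply: (leg_of_pchar q_prime q_odd qL); first exact: leg_cases.
apply: (mulIf g0); rewrite -gq mulrNz -pmulrn -g2 -exprM -exprSr.
by congr (_ ^+ _); move: q_odd; lia.
Qed.

End QuadraticReciprocity.

(** * Ideals of imaginary quadratic orders *)

Definition scale_set (a : algC) (I : set algC) : set algC := ([set a * x | x in I])%classic.

Lemma scale_setM a b I : scale_set a (scale_set b I) = scale_set (a * b) I.
Proof.
apply/seteqP; split => [z [y [x Ix <-] <-]|z [x Ix <-]].
  by exists x => //; rewrite mulrA.
by exists (b * x); [exists x | rewrite mulrA].
Qed.

Lemma scale_set1 I : scale_set 1 I = I.
Proof.
apply/seteqP; split => [z [x Ix <-]|z Iz]; first by rewrite mul1r.
by exists z => //; rewrite mul1r.
Qed.

Lemma scale_set_inj a I J : a != 0 -> scale_set a I = scale_set a J -> I = J.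
Proof.
move=> a0 /(congr1 (scale_set a^-1)); rewrite !scale_setM mulVf // !scale_set1.
by [].
Qed.

Section ImaginaryQuadratic.

Variables (tau nu : nat) (w : algC) (O : set algC).
Hypothesis tau_le1 : (tau <= 1)%N.
(** The discriminant is below -4, so 1 and -1 are the only units of O; this is why each ideal
    corresponds to exactly two lattice vectors. *)
Hypothesis disc_big : (tau ^ 2 + 4 < 4 * nu)%N.
Hypothesis w_sqr : w ^+ 2 = tau%:Z%:~R * w - nu%:Z%:~R.
Hypothesis w_conj : w^* = tau%:Z%:~R - w.

Definition qelt (x y : int) : algC := x%:~R + y%:~R * w.

Hypothesis OE : forall z, O z <-> exists x y, z = qelt x y.
(** Maximality of O: an algebraic integer of its fraction field belongs to O. *)
Hypothesis O_int : forall (d x y : int) (u : algC),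
  d != 0 -> d%:~R * u = qelt x y -> u \in Aint -> O u.

Lemma qelt_conj x y : (qelt x y)^* = qelt (x + tau%:Z * y) (- y).
Proof. by rewrite /qelt rmorphD rmorphM /= !rmorph_int w_conj; ring. Qed.

Lemma qelt_mul x y x' y' :
  qelt x y * qelt x' y' = qelt (x * x' - nu%:Z * y * y') (x * y' + x' * y + tau%:Z * y * y').
Proof.
have -> : qelt x y * qelt x' y' =
  x%:~R * x'%:~R + (x%:~R * y'%:~R + x'%:~R * y%:~R) * w + y%:~R * y'%:~R * w ^+ 2.
  by rewrite /qelt; ring.
by rewrite w_sqr /qelt; ring.
Qed.

Lemma qelt_norm x y : qelt x y * (qelt x y)^* = (qform 1 tau%:Z nu%:Z x y)%:~R.
Proof.
rewrite qelt_conj qelt_mul /qelt /qform.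
have -> : x * - y + (x + tau%:Z * y) * y + tau%:Z * y * - y = 0 by ring.
by rewrite mul0r addr0; congr _%:~R; ring.
Qed.

Let disc_gt0 : 0 < 4 * 1 * nu%:Z - tau%:Z ^+ 2.
Proof. by rewrite -PoszX; lia. Qed.

Lemma qform_eq0 (a b c x y : int) : 0 < a -> 0 < 4 * a * c - b ^+ 2 ->
  qform a b c x y = 0 -> x = 0 /\ y = 0.
Proof.
move=> a0 D0 Q0.
have E4 : 4 * a * qform a b c x y =
  (2 * a * x + b * y) ^+ 2 + (4 * a * c - b ^+ 2) * y ^+ 2 by rewrite /qform; ring.
have y0 : y = 0.
  apply/eqP; rewrite -sqrf_eq0 eq_le sqr_ge0 andbT.
  rewrite -(pmulr_rle0 _ D0); have := sqr_ge0 (2 * a * x + b * y).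
  by move: E4; rewrite Q0; lia.
split=> //; move: Q0; rewrite /qform y0 mulr0 addr0 expr0n mulr0 addr0 => /eqP.
by rewrite mulf_eq0 sqrf_eq0 (gt_eqF a0) => /eqP.
Qed.

Lemma qelt_eq0 x y : qelt x y = 0 -> x = 0 /\ y = 0.
Proof.
move=> e0; apply: (@qform_eq0 1 tau%:Z nu%:Z x y) => //.
by apply/eqP; rewrite -(intr_eq0 algC) -qelt_norm e0 mul0r.
Qed.

Lemma qelt_inj x y x' y' : qelt x y = qelt x' y' -> x = x' /\ y = y'.
Proof.
move=> e; have : qelt (x - x') (y - y') = 0.
  by transitivity (qelt x y - qelt x' y'); [rewrite /qelt; ring | rewrite e subrr].
by case/qelt_eq0; lia.
Qed.

Lemma qeltB x y x' y' : qelt x y - qelt x' y' = qelt (x - x') (y - y').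
Proof. by rewrite /qelt; ring. Qed.

Lemma qelt_int x : x%:~R = qelt x 0.
Proof. by rewrite /qelt mul0r addr0. Qed.

Lemma O_qelt x y : O (qelt x y).
Proof. by apply/OE; exists x, y. Qed.

Lemma O_intr (x : int) : O x%:~R.
Proof. by rewrite qelt_int; apply: O_qelt. Qed.

Lemma O_add x y : O x -> O y -> O (x + y).
Proof.
move=> /OE[a [b ->]] /OE[c [d ->]]; apply/OE; exists (a + c), (b + d).
by rewrite /qelt; ring.
Qed.

Lemma O_mul x y : O x -> O y -> O (x * y).
Proof.
by move=> /OE[a [b ->]] /OE[c [d ->]]; rewrite qelt_mul; apply: O_qelt.
Qed.

Lemma O_conj x : O x -> O x^*.
Proof. by move=> /OE[a [b ->]]; rewrite qelt_conj; apply: O_qelt. Qed.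

(** * Ideal classes and normal forms of ideals *)

Lemma ideal_equiv_refl I : ideal_equiv O I I.
Proof.
by exists 1, 1; rewrite oner_eq0; split=> //; apply: (O_intr 1).
Qed.

Lemma ideal_equiv_sym I J : ideal_equiv O I J -> ideal_equiv O J I.
Proof. by case=> a [b [Oa Ob a0 b0 E]]; exists b, a; split. Qed.

Lemma ideal_equiv_trans I J L :
  ideal_equiv O I J -> ideal_equiv O J L -> ideal_equiv O I L.
Proof.
case=> a [b [Oa Ob a0 b0 E]] [c [d [Oc Od c0 d0 F]]].
exists (c * a), (b * d); split; rewrite ?mulf_neq0 //; try exact: O_mul.
rewrite -[LHS]/(scale_set (c * a) I) -[RHS]/(scale_set (b * d) L) -!scale_setM.
rewrite -[scale_set a I]/([set a * x | x in I]%classic) E -/(scale_set b J).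
by rewrite -[scale_set d L]/([set d * x | x in L]%classic) -F -/(scale_set c J) !scale_setM mulrC.
Qed.

Lemma ideal_class_eq I J : nonzero_ideals O J ->
  (ideal_class O I = ideal_class O J) <-> ideal_equiv O I J.
Proof.
move=> nJ; split=> [E|IJ].
  have : ideal_class O J J by split=> //; apply: ideal_equiv_refl.
  by rewrite -E => -[].
apply/seteqP; split=> L [nL h]; split=> //; last exact: ideal_equiv_trans h.
by apply: ideal_equiv_trans h; apply: ideal_equiv_sym.
Qed.

(* The nonzero ideals of O = Z[w] are the k (Z a + Z (b + w)) with 0 <= b < a and a
   dividing (b + w) (b + w^* ), each for exactly one (k, a, b); the norm is k^2 a. *)
Definition ideal_of (k a b : nat) : set algC :=
  ([set z | exists x y : int,
     z = k%:Z%:~R * (a%:Z%:~R * x%:~R + (b%:Z%:~R + w) * y%:~R)])%classic.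

Definition valid_ideal (k a b : nat) : bool :=
  [&& (0 < k)%N, (b < a)%N & (a %| qpoly tau nu b)%N].

Definition cofactor_of (a b : nat) : nat := (qpoly tau nu b %/ a)%N.

Lemma cofactor_ofE a b : (a %| qpoly tau nu b)%N ->
  a%:Z * (cofactor_of a b)%:Z = b%:Z ^+ 2 + tau%:Z * b%:Z + nu%:Z.
Proof.
by move=> dv; rewrite -PoszM mulnC divnK // /qpoly !PoszD PoszM PoszX.
Qed.

Lemma disc_form a b : (a %| qpoly tau nu b)%N ->
  4 * a%:Z * (cofactor_of a b)%:Z - (2 * b%:Z + tau%:Z) ^+ 2 = 4 * nu%:Z - tau%:Z ^+ 2.
Proof. by move=> /cofactor_ofE E; rewrite -mulrA E; ring. Qed.

Lemma scale_ideal c I : c != 0 -> nonzero_ideals O I ->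
  (scale_set c I `<=` O)%classic -> nonzero_ideals O (scale_set c I).
Proof.
move=> c0 [[IO I0 ID IM] [x Ix x0]] sub; split; last first.
  by exists (c * x); [exists x | rewrite mulf_neq0].
split=> //; first by exists 0; rewrite ?mulr0.
  by move=> _ _ [y Iy <-] [z Iz <-]; exists (y + z); [apply: ID | rewrite mulrDr].
by move=> d _ Od [y Iy <-]; exists (d * y); [apply: IM | rewrite mulrCA].
Qed.

Lemma ideal_of_nonzero k a b : valid_ideal k a b -> nonzero_ideals O (ideal_of k a b).
Proof.
case/and3P => k0 ba /cofactor_ofE; set c := (cofactor_of a b)%:Z => Ec.
have a0 : (0 < a)%N by apply: leq_ltn_trans ba.
split; last first.
  exists (k%:Z%:~R * a%:Z%:~R).
    by exists 1, 0; rewrite mulr0 addr0 mulr1.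
  by rewrite mulf_neq0 // intr_eq0; lia.
split.
- move=> z [x [y ->]]; apply/OE; exists (k%:Z * (a%:Z * x + b%:Z * y)), (k%:Z * y).
  by rewrite /qelt; ring.
- by exists 0, 0; rewrite !mulr0 addr0 mulr0.
- move=> _ _ [x [y ->]] [x' [y' ->]]; exists (x + x'), (y + y').
  by ring.
- move=> _ _ /OE[u [v ->]] [x [y ->]].
  (* The coordinates come from [w * a = a * (b + w) - b * a] and [w * (b + w) = (b + tau) * (b + w)
     - c * a]. *)
  exists (u * x - v * b%:Z * x - v * y * c), (u * y + v * a%:Z * x + v * y * (b%:Z + tau%:Z)).
  have -> : qelt u v * (k%:Z%:~R * (a%:Z%:~R * x%:~R + (b%:Z%:~R + w) * y%:~R)) =
    k%:Z%:~R * (u%:~R * a%:Z%:~R * x%:~R + u%:~R * (b%:Z%:~R + w) * y%:~R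
     + v%:~R * a%:Z%:~R * x%:~R * w + v%:~R * y%:~R * b%:Z%:~R * w + v%:~R * y%:~R * w ^+ 2).
    by rewrite /qelt; ring.
  have nuE : nu%:Z%:~R = a%:Z%:~R * c%:~R - b%:Z%:~R ^+ 2 - tau%:Z%:~R * b%:Z%:~R :> algC.
    have -> : nu%:Z = a%:Z * c - b%:Z ^+ 2 - tau%:Z * b%:Z by rewrite Ec; ring.
    by ring.
  by rewrite w_sqr nuE; ring.
Qed.

Lemma ideal_ofP k a b x y : ideal_of k a b (qelt x y) <->
  exists x' y', x = k%:Z * (a%:Z * x' + b%:Z * y') /\ y = k%:Z * y'.
Proof.
split=> [[x' [y' E]]|[x' [y' [-> ->]]]]; exists x', y'; last by rewrite /qelt; ring.
by apply: qelt_inj; rewrite E /qelt; ring.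
Qed.

(** The ideal determines the triple: k generates the group of w-coordinates of its elements, k a
    generates the integers that it contains, and b is then fixed modulo a. *)
Lemma ideal_of_inj k a b k' a' b' : valid_ideal k a b -> valid_ideal k' a' b' ->
  ideal_of k a b = ideal_of k' a' b' -> (k, a, b) = (k', a', b').
Proof.
wlog suff W : k a b k' a' b' / valid_ideal k a b -> valid_ideal k' a' b' ->
    ideal_of k a b = ideal_of k' a' b' -> [/\ (k %| k')%N, (k = k' -> a %| a')%N &
      (k = k' -> a = a' -> (b <= b')%N)].
  move=> v v' E; have [h1 h2 h3] := W _ _ _ _ _ _ v v' E.
  have [h1' h2' h3'] := W _ _ _ _ _ _ v' v (esym E).
  have kk : k = k' by apply/eqP; rewrite eqn_dvd h1 h1'.
  have aa : a = a' by apply/eqP; rewrite eqn_dvd h2 ?h2'.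
  have bb : b = b' by apply/eqP; rewrite eqn_leq h3 ?h3'.
  by rewrite kk aa bb.
case/and3P => k0 ba _ /and3P[k0' ba' _] E.
have : ideal_of k' a' b' (qelt (k'%:Z * b'%:Z) k'%:Z).
  by apply/ideal_ofP; exists 0, 1; split; ring.
rewrite -E => /ideal_ofP[x [y [h1 h2]]].
have : ideal_of k' a' b' (qelt (k'%:Z * a'%:Z) 0).
  by apply/ideal_ofP; exists 1, 0; split; ring.
rewrite -E => /ideal_ofP[x2 [y2 [h3 h4]]]; split.
- by apply/dvdnP; exists `|y|%N; lia.
- move=> kk; have y20 : y2 = 0.
    by apply/eqP; move/eqP: h4; rewrite eq_sym mulf_eq0 => /orP[|//]; lia.
  apply/dvdnP; exists `|x2|%N.
  have : a'%:Z = a%:Z * x2.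
    apply: (@mulfI _ k%:Z); first by lia.
    by rewrite {1}kk h3 y20 mulr0 addr0.
  by move=> E2; rewrite -[LHS]/(`|a'%:Z|%N) E2 abszM mulnC.
- move=> kk aa; have y1 : y = 1.
    apply: (@mulfI _ k%:Z); first by lia.
    by rewrite -h2 kk mulr1.
  have E2 : b'%:Z = a%:Z * x + b%:Z.
    apply: (@mulfI _ k%:Z); first by lia.
    by rewrite {1}kk h1 y1 mulr1.
  rewrite leqNgt; apply/negP => lt.
  have xlt0 : x < 0.
    rewrite ltNge; apply/negP => x0; have ax : 0 <= a%:Z * x by rewrite mulr_ge0.
    by move: E2 ax lt; clear; lia.
  have ax : a%:Z * x <= a%:Z * -1 by rewrite ler_wpM2l //; lia.
  by move: E2 ax ba; clear; lia.
Qed.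

(** Hermite normal form: m is the least positive integer in J, and k the least positive
    w-coordinate, reached at [c + k w]. Stability under multiplication by w makes k divide both m
    and c. *)
Lemma ideal_of_surj J : nonzero_ideals O J ->
  exists k a b, valid_ideal k a b /\ J = ideal_of k a b.
Proof.
case=> -[JO J0 JD JM] [z Jz z0].
have JB x y : J x -> J y -> J (x - y).
  by move=> Jx Jy; rewrite -mulN1r; apply: JD => //; apply: JM => //; apply: (O_intr (-1)).
have exm : exists m : nat, (0 < m)%N && `[< J (qelt m%:Z 0) >].
  have /OE[x [y zE]] := JO z Jz.
  exists `|qform 1 tau%:Z nu%:Z x y|%N; apply/andP; split.
    rewrite lt0n absz_eq0; apply/eqP => q0; case/eqP: z0.
    have [x0 y0] := qform_eq0 ltr01 disc_gt0 q0.
    by rewrite zE x0 y0 /qelt mul0r addr0.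
  apply/asboolP; rewrite gez0_abs ?qform_ge0 // -qelt_int -qelt_norm mulrC -zE.
  by apply: JM => //; apply: O_conj; apply: JO.
case: (ex_minnP exm) => m /andP[m0 /asboolP Jm] minm.
have exk : exists k : nat, (0 < k)%N && `[< exists c, J (qelt c k%:Z) >].
  exists m; rewrite m0; apply/asboolP; exists 0.
  have -> : qelt 0 m%:Z = qelt 0 1 * qelt m%:Z 0 by rewrite qelt_mul; congr qelt; ring.
  by apply: JM => //; apply: O_qelt.
case: (ex_minnP exk) => k /andP[k0 /asboolP[c Jc]] mink.
have Jscale (q x y : int) : J (qelt x y) -> J (qelt (q * x) (q * y)).
  move=> h; have -> : qelt (q * x) (q * y) = q%:~R * qelt x y by rewrite /qelt; ring.
  by apply: JM => //; apply: O_intr.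
have kdiv x y : J (qelt x y) -> exists q, y = q * k%:Z.
  move=> h; exists (y %/ k%:Z)%Z; have kz : k%:Z != 0 by lia.
  have := JB _ _ h (Jscale (y %/ k%:Z)%Z _ _ Jc); rewrite qeltB.
  have -> : y - (y %/ k%:Z)%Z * k%:Z = (y %% k%:Z)%Z by rewrite /modz.
  have r0 := modz_ge0 y kz; have r1 := ltz_pmod y (_ : 0 < k%:Z).
  case E: (y %% k%:Z)%Z r0 r1 => [r|//] _ /(_ _) rk Jr.
  have {}rk : (r < k)%N by have := rk; lia.
  case: (posnP r) => [r0|r0]; first by rewrite {1}(divz_eq y k%:Z) E r0 addr0.
  have : (k <= r)%N by apply: mink; rewrite r0; apply/asboolP; eexists; exact: Jr.
  by rewrite leqNgt rk.
have mdiv x : J (qelt x 0) -> exists q, x = q * m%:Z.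
  move=> h; exists (x %/ m%:Z)%Z; have mz : m%:Z != 0 by lia.
  have := JB _ _ h (Jscale (x %/ m%:Z)%Z _ _ Jm); rewrite qeltB mulr0 subr0.
  have -> : x - (x %/ m%:Z)%Z * m%:Z = (x %% m%:Z)%Z by rewrite /modz.
  have r0 := modz_ge0 x mz; have r1 := ltz_pmod x (_ : 0 < m%:Z).
  case E: (x %% m%:Z)%Z r0 r1 => [r|//] _ /(_ _) rk Jr.
  have {}rk : (r < m)%N by have := rk; lia.
  case: (posnP r) => [r0|r0]; first by rewrite {1}(divz_eq x m%:Z) E r0 addr0.
  have : (m <= r)%N by apply: minm; rewrite r0; apply/asboolP.
  by rewrite leqNgt rk.
have [a aE] : exists a : nat, m = (a * k)%N.
  have [q qE] : exists q, m%:Z = q * k%:Z.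
    apply: (@kdiv 0).
    have -> : qelt 0 m%:Z = qelt 0 1 * qelt m%:Z 0 by rewrite qelt_mul; congr qelt; ring.
    by apply: JM => //; apply: O_qelt.
  by exists `|q|%N; rewrite -[LHS]/(`|m%:Z|%N) qE abszM.
have a0 : (0 < a)%N by move: m0; rewrite aE muln_gt0 => /andP[].
have [b0 b0E] : exists b0, c = b0 * k%:Z.
  have : J (qelt 0 1 * qelt c k%:Z) by apply: JM => //; apply: O_qelt.
  rewrite qelt_mul => /kdiv[q qE]; exists (q - tau%:Z); rewrite mulrBl -qE; ring.
have az : a%:Z != 0 by lia.
pose b := `|(b0 %% a%:Z)%Z|%N.
have bE : b%:Z = (b0 %% a%:Z)%Z by rewrite gez0_abs ?modz_ge0.
have ba : (b < a)%N by rewrite -ltz_nat bE ltz_pmod //; lia.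
have Jb : J (qelt (k%:Z * b%:Z) k%:Z).
  have := JB _ _ Jc (Jscale (b0 %/ a%:Z)%Z _ _ Jm); rewrite qeltB mulr0 subr0.
  congr (J (qelt _ _)); rewrite bE b0E {1}(divz_eq b0 a%:Z) aE PoszM; ring.
exists k, a, b; split.
  apply/and3P; split=> //.
  (* The first factor is the conjugate of b + w, so the product is k times the norm of b + w. It is
     an integer in J, hence a multiple of m = a k. *)
  have : J (qelt (b%:Z + tau%:Z) (-1) * qelt (k%:Z * b%:Z) k%:Z).
    by apply: JM => //; apply: O_qelt.
  rewrite qelt_mul.
  have -> : (b%:Z + tau%:Z) * k%:Z + k%:Z * b%:Z * -1 + tau%:Z * -1 * k%:Z = 0 by ring.
  move=> /mdiv[q]; rewrite aE PoszM => E.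
  apply/dvdnP; exists `|q|%N.
  have : (qpoly tau nu b)%:Z = q * a%:Z.
    apply: (@mulfI _ k%:Z); first by lia.
    rewrite /qpoly !PoszD PoszM PoszX.
    by transitivity (q * (a%:Z * k%:Z)); [rewrite -E|]; ring.
  by move=> E2; rewrite -[LHS]/(`|(qpoly tau nu b)%:Z|%N) E2 abszM.
apply/seteqP; split=> [u Ju|_ [x [y ->]]].
  have /OE[x [y uE]] := JO u Ju; rewrite uE in Ju *.
  have [q qE] := kdiv _ _ Ju.
  have := JB _ _ Ju (Jscale q _ _ Jb); rewrite qeltB qE subrr => /mdiv[s sE].
  apply/ideal_ofP; exists s, q; split; last by ring.
  by rewrite -[x](subrK (q * (k%:Z * b%:Z))) sE aE PoszM; ring.
have -> : k%:Z%:~R * (a%:Z%:~R * x%:~R + (b%:Z%:~R + w) * y%:~R) =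
   qelt (x * m%:Z) (x * 0) + qelt (y * (k%:Z * b%:Z)) (y * k%:Z).
  by rewrite aE PoszM /qelt; ring.
by apply: JD; apply: Jscale.
Qed.

(** This is 2i times the signed area of the parallelogram spanned by u and v. *)
Definition cov (u v : algC) : algC := u^* * v - u * v^*.

Lemma w_nonreal : w - w^* != 0.
Proof.
have -> : w - w^* = qelt (- tau%:Z) 2 by rewrite w_conj /qelt; ring.
by apply/eqP => /qelt_eq0[_].
Qed.

(* cov is multiplied by a determinant under integral changes of basis, so bases of
   the same lattice have the same cov up to sign. *)
Lemma ideal_of_scale_norm k a b k0 a0 b0 (l : algC) :
  (0 < k)%N -> (0 < a)%N -> (0 < k0)%N -> (0 < a0)%N -> l != 0 ->
  ideal_of k a b = scale_set l (ideal_of k0 a0 b0) ->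
  (k ^ 2 * a)%N%:Z%:~R = l * l^* * (k0 ^ 2 * a0)%N%:Z%:~R.
Proof.
move=> kp ap k0p a0p l0 E.
pose e1 := k%:Z%:~R * a%:Z%:~R : algC; pose e2 := k%:Z%:~R * (b%:Z%:~R + w).
pose f1 := l * (k0%:Z%:~R * a0%:Z%:~R); pose f2 := l * (k0%:Z%:~R * (b0%:Z%:~R + w)).
have toF z : ideal_of k a b z -> exists x y : int, z = x%:~R * f1 + y%:~R * f2.
  by rewrite E => -[_ [x [y ->]] <-]; exists x, y; rewrite /f1 /f2; ring.
have toE z : ideal_of k0 a0 b0 z -> exists x y : int, l * z = x%:~R * e1 + y%:~R * e2.
  move=> h; have : scale_set l (ideal_of k0 a0 b0) (l * z) by exists z.
  by rewrite -E => -[x [y ->]]; exists x, y; rewrite /e1 /e2; ring.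
have [x1 [y1 E1]] : exists x y : int, e1 = x%:~R * f1 + y%:~R * f2.
  by apply: toF; exists 1, 0; rewrite /e1; ring.
have [x2 [y2 E2]] : exists x y : int, e2 = x%:~R * f1 + y%:~R * f2.
  by apply: toF; exists 0, 1; rewrite /e2; ring.
have [x3 [y3 E3]] : exists x y : int, f1 = x%:~R * e1 + y%:~R * e2.
  by apply: toE; exists 1, 0; ring.
have [x4 [y4 E4]] : exists x y : int, f2 = x%:~R * e1 + y%:~R * e2.
  by apply: toE; exists 0, 1; ring.
have covL (x y x' y' : int) u v : cov (x%:~R * u + y%:~R * v) (x'%:~R * u + y'%:~R * v) =
    (x * y' - x' * y)%:~R * cov u v.
  by rewrite /cov !rmorphD !rmorphM /= !rmorph_int; ring.
have NE (i j : nat) : (i ^ 2 * j)%N%:Z%:~R = i%:Z%:~R ^+ 2 * j%:Z%:~R :> algC.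
  by rewrite PoszM PoszX intrM rmorphXn.
have cE : cov e1 e2 = (k ^ 2 * a)%N%:Z%:~R * (w - w^*).
  by rewrite NE /cov /e1 /e2 !rmorphM !rmorphD /= !rmorph_int; ring.
have cF : cov f1 f2 = l * l^* * (k0 ^ 2 * a0)%N%:Z%:~R * (w - w^*).
  by rewrite NE /cov /f1 /f2 !rmorphM !rmorphD /= !rmorph_int; ring.
set A : algC := (k ^ 2 * a)%N%:Z%:~R in cE *.
set B : algC := l * l^* * (k0 ^ 2 * a0)%N%:Z%:~R in cF *.
have A0 : 0 < A by rewrite ltr0z ltz_nat muln_gt0 expn_gt0 kp.
have B0 : 0 < B by rewrite mulr_gt0 ?mul_conjC_gt0 // ltr0z ltz_nat muln_gt0 expn_gt0 k0p.
have AB : A = (x1 * y2 - x2 * y1)%:~R * B.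
  apply: (mulIf w_nonreal); rewrite -cE -mulrA -cF.
  by rewrite {1}E1 {1}E2 covL.
have BA : B = (x3 * y4 - x4 * y3)%:~R * A.
  apply: (mulIf w_nonreal); rewrite -cF -mulrA -cE.
  by rewrite {1}E3 {1}E4 covL.
move: AB BA; move: (x1 * y2 - x2 * y1) (x3 * y4 - x4 * y3) => d d' AB BA.
have d0 : 0 < d.
  by move: A0; rewrite AB pmulr_lgt0 // ltr0z.
have dd : d * d' = 1.
  apply/eqP; rewrite -(eqr_int algC) intrM; apply/eqP; apply: (mulIf (lt0r_neq0 A0)).
  by rewrite -mulrA -BA -AB mul1r.
have -> : A = B; last by [].
have d0' : 0 < d' by move: B0; rewrite BA pmulr_lgt0 // ltr0z.
rewrite AB; have -> : d = 1 by clear - d0 d0' dd; nia.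
by rewrite mul1r.
Qed.

(** u is an eigenvalue of an integral 2 by 2 matrix, hence a root of its characteristic polynomial,
    which is monic with integral coefficients. *)
Lemma stable_Aint (u e1 e2 : algC) (x1 y1 x2 y2 : int) : e1 != 0 ->
  u * e1 = x1%:~R * e1 + y1%:~R * e2 -> u * e2 = x2%:~R * e1 + y2%:~R * e2 ->
  u \in Aint.
Proof.
move=> e0 E1 E2.
pose P : {poly algC} := 'X^2 - (x1 + y2)%:~R *: 'X + (x1 * y2 - x2 * y1)%:~R%:P.
have cf : P = Poly [:: (x1 * y2 - x2 * y1)%:~R; - (x1 + y2)%:~R; 1].
  apply/polyP => i; rewrite coef_Poly !coefE.
  by case: i => [|[|[|i]]] /=; rewrite ?mulr0 ?mulr1 ?subr0 ?addr0 ?add0r ?sub0r ?nth_nil.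
have sP : P = [:: (x1 * y2 - x2 * y1)%:~R; - (x1 + y2)%:~R; 1] :> seq algC.
  by rewrite cf (PolyK (c := 0)) //= oner_eq0.
apply: (@root_monic_Aint P).
- rewrite rootE !hornerE; apply/eqP; apply: (mulIf e0); rewrite mul0r.
  have -> : (u ^+ 2 - (x1 + y2)%:~R * u + (x1 * y2 - x2 * y1)%:~R) * e1 =
    u * (u * e1) - (x1 + y2)%:~R * (u * e1) + (x1 * y2 - x2 * y1)%:~R * e1 by ring.
  rewrite E1 mulrDr mulrCA E1 [u * (y1%:~R * e2)]mulrCA E2; ring.
- by rewrite monicE lead_coefE sP.
- apply/polyOverP => i; rewrite sP.
  by case: i => [|[|[|i]]] /=; rewrite ?rpredN ?intr_int ?rpred1 ?nth_nil ?rpred0.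
Qed.

Lemma unit_norm1 u : O u -> u * u^* = 1 -> u = 1 \/ u = -1.
Proof.
move=> /OE[x [y ->]]; rewrite qelt_norm => /eqP; rewrite -[1]/(1%:~R) eqr_int => /eqP Q1.
have E4 : (2 * x + tau%:Z * y) ^+ 2 + (4 * nu%:Z - tau%:Z ^+ 2) * y ^+ 2 = 4.
  by transitivity (4 * qform 1 tau%:Z nu%:Z x y); [rewrite /qform; ring | rewrite Q1].
have D4 : 4 < 4 * nu%:Z - tau%:Z ^+ 2 by rewrite -PoszX; move: disc_big; lia.
have y0 : y = 0.
  apply/eqP; apply: contraT => yn0; have y2 : 1 <= y ^+ 2 by rewrite -gtz0_ge1 exprn_even_gt0.
  have := sqr_ge0 (2 * x + tau%:Z * y); nia.
move: Q1; rewrite /qform y0 mulr0 addr0 expr0n mulr0 addr0 mul1r => /eqP.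
rewrite sqrf_eq1 => /orP[/eqP ->|/eqP ->]; [left|right]; by rewrite /qelt mul0r addr0.
Qed.

(** * The quadratic form of one ideal class *)

Section OneClass.

Variables a b : nat.
Hypothesis vab : valid_ideal 1 a b.

Let ba : (b < a)%N. Proof. by case/and3P: vab. Qed.
Let a_dvd : (a %| qpoly tau nu b)%N. Proof. by case/and3P: vab. Qed.
Let a_gt0 : (0 < a)%N. Proof. exact: leq_ltn_trans ba. Qed.
Let c := cofactor_of a b.
Let Ec : a%:Z * c%:Z = b%:Z ^+ 2 + tau%:Z * b%:Z + nu%:Z. Proof. exact: cofactor_ofE. Qed.
Let aC : a%:Z%:~R != 0 :> algC. Proof. by rewrite intr_eq0; lia. Qed.

(** A form of discriminant [tau^2 - 4 nu]. Its value at (x, y) is the norm of the ideal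
    [ideal_of 1 a b] multiplied by [lam x y]. *)
Definition norm_form (x y : int) : int := qform a%:Z (2 * b%:Z + tau%:Z) c%:Z x y.

Lemma norm_form_disc : 0 < 4 * a%:Z * c%:Z - (2 * b%:Z + tau%:Z) ^+ 2.
Proof. by rewrite disc_form // -PoszX; move: disc_big; lia. Qed.

Lemma norm_form_ge0 x y : 0 <= norm_form x y.
Proof. by apply: qform_ge0 norm_form_disc; lia. Qed.

(** This is [a x + (b + w') y] with w' the conjugate of w, the general element of the conjugate
    ideal. Dividing by the norm a yields the inverse of [ideal_of 1 a b]. *)
Definition lamN (x y : int) : algC := qelt (a%:Z * x + (b%:Z + tau%:Z) * y) (- y).

(* The fractional ideal (O : ideal_of 1 a b) consists of the lam x y. *)
Definition lam (x y : int) : algC := lamN x y / a%:Z%:~R.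

Lemma lamN_norm x y : lamN x y * (lamN x y)^* = (a%:Z * norm_form x y)%:~R.
Proof.
rewrite /lamN qelt_norm; congr _%:~R; rewrite /norm_form /qform.
have nuE : nu%:Z = a%:Z * c%:Z - b%:Z ^+ 2 - tau%:Z * b%:Z by rewrite Ec; ring.
by rewrite nuE; ring.
Qed.

Lemma lam_norm x y : lam x y * (lam x y)^* * a%:Z%:~R = (norm_form x y)%:~R.
Proof.
rewrite /lam rmorphM /= fmorphV rmorph_int.
have -> : lamN x y / a%:Z%:~R * ((lamN x y)^* / a%:Z%:~R) * a%:Z%:~R =
  (lamN x y * (lamN x y)^*) / a%:Z%:~R by field.
by rewrite lamN_norm intrM mulrC mulKf.
Qed.

Lemma lam_eq0 x y : lam x y = 0 -> (x, y) = (0, 0).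
Proof.
move=> l0; have : (norm_form x y)%:~R = 0 :> algC by rewrite -lam_norm l0 !mul0r.
have az : 0 < a%:Z by lia.
by move/eqP; rewrite intr_eq0 => /eqP /(qform_eq0 az norm_form_disc)[-> ->].
Qed.

Lemma lam_opp x y : lam (- x) (- y) = - lam x y.
Proof. by rewrite /lam /lamN /qelt; field. Qed.

Lemma lam_inj x y x' y' : lam x y = lam x' y' -> (x, y) = (x', y').
Proof.
move=> E; have : lam (x - x') (y - y') = 0.
  transitivity (lam x y - lam x' y'); last by rewrite E subrr.
  by rewrite /lam /lamN /qelt; field.
by case/lam_eq0 => h1 h2; congr (_, _); lia.
Qed.

Lemma scale_set_opp l k1 a1 b1 :
  scale_set (- l) (ideal_of k1 a1 b1) = scale_set l (ideal_of k1 a1 b1).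
Proof.
have sub l' : (scale_set (- l') (ideal_of k1 a1 b1) `<=`
    scale_set l' (ideal_of k1 a1 b1))%classic.
  move=> _ [_ [x [y ->]] <-]; eexists; first by exists (- x), (- y); reflexivity.
  by ring.
apply/seteqP; split; first exact: sub.
by rewrite -{1}[l]opprK; apply: sub.
Qed.

Lemma lam_sub x y : (scale_set (lam x y) (ideal_of 1 a b) `<=` O)%classic.
Proof.
move=> _ [_ [u [v ->]] <-].
have nuE : nu%:Z%:~R = a%:Z%:~R * c%:Z%:~R - b%:Z%:~R ^+ 2 - tau%:Z%:~R * b%:Z%:~R :> algC.
  have -> : nu%:Z = a%:Z * c%:Z - b%:Z ^+ 2 - tau%:Z * b%:Z by rewrite Ec; ring.
  by ring.
suff -> : lam x y * (1%:Z%:~R * (a%:Z%:~R * u%:~R + (b%:Z%:~R + w) * v%:~R)) =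
   lamN x y * u%:~R + qelt (b%:Z * x + c%:Z * y) x * v%:~R.
  by apply: O_add; apply: O_mul; rewrite /lamN; try exact: O_qelt; exact: O_intr.
have E : lamN x y * (b%:Z%:~R + w) = qelt (b%:Z * x + c%:Z * y) x * a%:Z%:~R.
  have -> : lamN x y * (b%:Z%:~R + w) =
    (a%:Z * x + (b%:Z + tau%:Z) * y)%:~R * (b%:Z%:~R + w) - y%:~R * b%:Z%:~R * w
      - y%:~R * w ^+ 2 by rewrite /lamN /qelt; ring.
  by rewrite w_sqr nuE /qelt; ring.
have -> : lam x y * (1%:Z%:~R * (a%:Z%:~R * u%:~R + (b%:Z%:~R + w) * v%:~R)) =
   lamN x y * u%:~R + (lamN x y * (b%:Z%:~R + w)) / a%:Z%:~R * v%:~R.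
  by rewrite /lam; field.
by rewrite E mulfK.
Qed.

Lemma lam_surj l : (scale_set l (ideal_of 1 a b) `<=` O)%classic -> exists x y, l = lam x y.
Proof.
move=> sub.
have /OE[X [Y E1]] : O (l * a%:Z%:~R).
  by apply: sub; exists a%:Z%:~R => //; exists 1, 0; ring.
have /OE[X' [Y' E2]] : O (l * (b%:Z%:~R + w)).
  by apply: sub; exists (b%:Z%:~R + w) => //; exists 0, 1; ring.
have : qelt (X * b%:Z - nu%:Z * Y) (X + Y * (b%:Z + tau%:Z)) = qelt (a%:Z * X') (a%:Z * Y').
  transitivity (l * a%:Z%:~R * (b%:Z%:~R + w)).
    rewrite E1; transitivity (qelt X Y * qelt b%:Z 1); last by rewrite /qelt mul1r.
    by rewrite qelt_mul; congr qelt; ring.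
  by rewrite mulrAC E2 /qelt; ring.
case/qelt_inj => _ E3; exists Y', (- Y).
apply: (mulIf aC); rewrite E1 /lam divfK // /lamN opprK; congr qelt.
by rewrite -E3; ring.
Qed.

(** The incidence relation behind the count of ideals by vectors: a nonzero v meets exactly one
    valid t, and a valid t in the class of [ideal_of 1 a b] meets exactly two nonzero vectors,
    opposite to each other. *)
Definition multiple_of (v : int * int) (t : nat * nat * nat) : Prop :=
  ideal_of t.1.1 t.1.2 t.2 = scale_set (lam v.1 v.2) (ideal_of 1 a b).

Definition triple_norm (t : nat * nat * nat) : nat := (t.1.1 ^ 2 * t.1.2)%N.

Definition valid_triple (t : nat * nat * nat) : bool := valid_ideal t.1.1 t.1.2 t.2.

Lemma multiple_of_norm v t : v != (0, 0) -> valid_triple t -> multiple_of v t ->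
  triple_norm t = `|norm_form v.1 v.2|%N.
Proof.
case: v t => x y [[k1 a1] b1] v0 /and3P[/= k0 b0 _] E.
have l0 : lam x y != 0 by apply: contra_neq v0 => /lam_eq0.
have a10 : (0 < a1)%N by apply: leq_ltn_trans b0.
have := ideal_of_scale_norm k0 a10 (ltn0Sn 0) a_gt0 l0 E.
rewrite /= mul1n lam_norm => /eqP; rewrite eqr_int => /eqP <-.
by [].
Qed.

Lemma multiple_of_exists v : v != (0, 0) -> exists2 t, valid_triple t & multiple_of v t.
Proof.
case: v => x y v0; have l0 : lam x y != 0 by apply: contra_neq v0 => /lam_eq0.
have [k1 [a1 [b1 [h1 h2]]]] :=
  ideal_of_surj (scale_ideal l0 (ideal_of_nonzero vab) (@lam_sub x y)).
by exists (k1, a1, b1).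
Qed.

Lemma multiple_of_fun v t t' : valid_triple t -> valid_triple t' ->
  multiple_of v t -> multiple_of v t' -> t = t'.
Proof.
case: t t' => [[k1 a1] b1] [[k2 a2] b2] h1 h2; rewrite /multiple_of /= => <- E.
by apply/esym; apply: ideal_of_inj.
Qed.

Lemma multiple_of_opp x y t : multiple_of (x, y) t -> multiple_of (- x, - y) t.
Proof. by rewrite /multiple_of /= lam_opp scale_set_opp. Qed.

(** The quotient u of the two multipliers maps [ideal_of 1 a b] onto itself, so it is an algebraic
    integer and lies in O by maximality. Comparing norms gives it norm 1, so it is 1 or -1. *)
Lemma multiple_of_pm x y x' y' t : (x, y) != (0, 0) -> (x', y') != (0, 0) -> valid_triple t ->
  multiple_of (x, y) t -> multiple_of (x', y') t -> (x', y') = (x, y) \/ (x', y') = (- x, - y).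
Proof.
move=> v0 v0' tv r r'.
have l0 : lam x y != 0 by apply: contra_neq v0 => /lam_eq0.
have l0' : lam x' y' != 0 by apply: contra_neq v0' => /lam_eq0.
have n1 := multiple_of_norm v0 tv r; have n2 := multiple_of_norm v0' tv r'; rewrite /= in n1 n2.
have nE : norm_form x y = norm_form x' y'.
  by rewrite -(gez0_abs (norm_form_ge0 x y)) -n1 n2 (gez0_abs (norm_form_ge0 x' y')).
pose u := lam x' y' / lam x y.
have ul : u * lam x y = lam x' y' by rewrite /u divfK.
have ust : scale_set u (ideal_of 1 a b) = ideal_of 1 a b.
  apply: (scale_set_inj l0); rewrite scale_setM mulrC ul; by rewrite -r'.
have st z : ideal_of 1 a b z -> exists x1 y1 : int,
    u * z = x1%:~R * a%:Z%:~R + y1%:~R * (b%:Z%:~R + w).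
  move=> h; have : scale_set u (ideal_of 1 a b) (u * z) by exists z.
  by rewrite ust => -[x1 [y1 ->]]; exists x1, y1; ring.
have [x1 [y1 E1]] : exists x1 y1 : int,
    u * a%:Z%:~R = x1%:~R * a%:Z%:~R + y1%:~R * (b%:Z%:~R + w).
  by apply: st; exists 1, 0; ring.
have [x2 [y2 E2]] : exists x1 y1 : int,
    u * (b%:Z%:~R + w) = x1%:~R * a%:Z%:~R + y1%:~R * (b%:Z%:~R + w).
  by apply: st; exists 0, 1; ring.
have uA := stable_Aint aC E1 E2.
have Ou : O u.
  apply: (@O_int a%:Z (x1 * a%:Z + y1 * b%:Z) y1) => //; first by lia.
  by rewrite mulrC E1 /qelt; ring.
have uu : u * u^* = 1.
  have T0 : (norm_form x y)%:~R != 0 :> algC.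
    by rewrite -lam_norm; apply: mulf_neq0 => //; apply: mulf_neq0; rewrite ?conjC_eq0.
  apply: (mulIf T0); rewrite mul1r {2}nE -!lam_norm -ul [(u * lam x y)^*]rmorphM /=.
  by ring.
case: (unit_norm1 Ou uu) => u1; [left|right]; apply: lam_inj; rewrite -ul u1.
  by rewrite mul1r.
by rewrite mulN1r lam_opp.
Qed.

Lemma multiple_of_equiv v t : v != (0, 0) -> multiple_of v t ->
  ideal_equiv O (ideal_of 1 a b) (ideal_of t.1.1 t.1.2 t.2).
Proof.
case: v => x y v0 E; have l0 : lam x y != 0 by apply: contra_neq v0 => /lam_eq0.
exists (lamN x y), a%:Z%:~R; split=> //; first exact: O_qelt.
- exact: O_intr.
- by apply: contra_neq l0; rewrite /lam => ->; rewrite mul0r.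
rewrite -[LHS]/(scale_set _ _) -[RHS]/(scale_set _ _) E scale_setM; congr scale_set.
by rewrite /lam mulrC divfK.
Qed.

Lemma equiv_multiple_of t : valid_triple t ->
  ideal_equiv O (ideal_of 1 a b) (ideal_of t.1.1 t.1.2 t.2) ->
  exists2 v, v != (0, 0) & multiple_of v t.
Proof.
move=> tv [d [e [Od Oe d0 e0 E]]].
have E' : ideal_of t.1.1 t.1.2 t.2 = scale_set (d / e) (ideal_of 1 a b).
  apply: (scale_set_inj e0); rewrite scale_setM mulrC divfK //; exact: esym E.
have [x [y lE]] : exists x y, d / e = lam x y.
  by apply: lam_surj; rewrite -E'; case: (ideal_of_nonzero tv) => -[].
exists (x, y); last by rewrite /multiple_of /= -lE.
apply: contraTneq (mulf_neq0 d0 (invr_neq0 e0)) => -[x0 y0].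
by rewrite lE x0 y0 negbK /lam /lamN /qelt !mulr0 addr0 oppr0 mul0r addr0 mul0r.
Qed.

End OneClass.

(** * The class number formula *)

(** A finite list that includes every ideal of norm at most N; it also has some of larger norm,
    where the weights vanish. *)
Definition triples (N : nat) : seq (nat * nat * nat) :=
  [seq t <- [seq (ka, b) | ka <- [seq (k, a) | k <- iota 1 N, a <- iota 1 N],
                           b <- iota 0 N] | valid_triple t].

Lemma triples_uniq N : uniq (triples N).
Proof.
rewrite filter_uniq // allpairs_uniq ?iota_uniq //.
- by rewrite allpairs_uniq ?iota_uniq // => -[? ?] [? ?] _ _ [-> ->].
- by move=> [? ?] [? ?] _ _ [-> ->].
Qed.

Lemma mem_triples N t : valid_triple t -> (triple_norm t <= N)%N -> t \in triples N.
Proof.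
case: t => [[k a] b] tv; rewrite /triple_norm /= => tN; rewrite mem_filter tv /=.
have /and3P[/= k0 ba _] := tv; have a0 : (0 < a)%N by apply: leq_ltn_trans ba.
have kN : (k <= N)%N by apply: leq_trans tN; nia.
have aN : (a <= N)%N by apply: leq_trans tN; nia.
apply/allpairsP; exists ((k, a), b) => /=; rewrite mem_iota add0n; split=> //; last first.
  exact: leq_trans aN.
by apply/allpairsP; exists (k, a); rewrite /= !mem_iota !add1n !ltnS k0 a0 kN aN.
Qed.

Definition zbox (B : nat) : seq (int * int) :=
  [seq (x, y) | x <- zrange B, y <- zrange B].

Lemma zbox_uniq B : uniq (zbox B).
Proof. by rewrite allpairs_uniq ?zrange_uniq // => -[? ?] [? ?] _ _ [-> ->]. Qed.

Lemma mem_zbox B x y : ((x, y) \in zbox B) = (x \in zrange B) && (y \in zrange B).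
Proof.
apply/allpairsP/andP => [[[x' y'] /= [h1 h2 [-> ->]]] //|[h1 h2]].
by exists (x, y).
Qed.

(** Incident pairs of a vector and an ideal are counted in both orders; the factor 2 is the pair v,
    -v. *)
Lemma class_sum a b (N B : nat) (W : nat -> int) : valid_ideal 1 a b ->
  (forall n, (N < n)%N -> W n = 0) ->
  (forall x y, (`|norm_form a b x y| <= N)%N -> (x, y) \in zbox B) ->
  \sum_(v <- zbox B | v != (0, 0)) W `|norm_form a b v.1 v.2|%N =
  2 * \sum_(t <- triples N | `[< ideal_equiv O (ideal_of 1 a b) (ideal_of t.1.1 t.1.2 t.2) >])
    W (triple_norm t).
Proof.
move=> vab W0 box.
transitivity (\sum_(v <- zbox B | v != (0, 0)) \sum_(t <- triples N)
   (if `[< multiple_of a b v t >] then W (triple_norm t) else 0)).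
  apply: eq_bigr => v v0; have [Wv|Wv] := eqVneq (W `|norm_form a b v.1 v.2|%N) 0.
    rewrite Wv big_seq big1 // => t; rewrite mem_filter => /andP[tv _].
    by case: asboolP => // r; rewrite (multiple_of_norm vab v0 tv r).
  have [t tv r] := multiple_of_exists vab v0; have tn := multiple_of_norm vab v0 tv r.
  have tN : (triple_norm t <= N)%N.
    by rewrite leqNgt; apply/negP => /W0; rewrite tn => W1; rewrite W1 eqxx in Wv.
  rewrite (bigD1_seq t) ?triples_uniq ?mem_triples //= asboolT // tn.
  rewrite big_seq_cond big1 ?addr0 // => t'; rewrite mem_filter => /andP[/andP[tv' _] tt].
  by case: asboolP => // r'; rewrite (multiple_of_fun tv tv' r r') eqxx in tt.
rewrite exchange_big /= [X in 2 * X]big_mkcond mulr_sumr /=.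
apply: eq_big_seq => t; rewrite mem_filter => /andP[tv _].
have [->|Wt] := eqVneq (W (triple_norm t)) 0.
  by rewrite big1 => [|v _]; rewrite ?if_same ?mulr0.
have tN : (triple_norm t <= N)%N.
  by rewrite leqNgt; apply/negP => /W0 W1; rewrite W1 eqxx in Wt.
case: asboolP => [eq|neq]; last first.
  rewrite mulr0 big1 // => v v0; case: asboolP => // r; case: neq.
  exact: multiple_of_equiv r.
have [[x y] v0 r] := equiv_multiple_of vab tv eq.
have inbox u : u != (0, 0) -> multiple_of a b u t -> u \in zbox B.
  case: u => x' y' u0 r'; apply: box.
  by have := multiple_of_norm vab u0 tv r'; rewrite /= => <-.
have v0' : (- x, - y) != (0, 0).
  apply: contra_neq v0 => -[/eqP h1 /eqP h2].
  by rewrite oppr_eq0 in h1; rewrite oppr_eq0 in h2; rewrite (eqP h1) (eqP h2).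
rewrite -big_mkcondr -big_filter (perm_big [:: (x, y); (- x, - y)]) /=.
  by rewrite big_cons big_seq1; ring.
apply: uniq_perm; first by rewrite filter_uniq // zbox_uniq.
  rewrite /= andbT inE; apply: contra_neq v0 => -[h1 h2].
  by congr (_, _); move: h1 h2; clear; lia.
move=> u; rewrite mem_filter !inE; apply/idP/idP.
  case/andP => /andP[u0 /asboolP r'] _.
  case: u u0 r' => x' y' u0 r'.
  by case: (multiple_of_pm vab v0 u0 tv r r') => ->; rewrite eqxx ?orbT.
case/orP => /eqP ->.
  by rewrite v0 inbox // andbT /=; apply/asboolP.
have r' := multiple_of_opp vab r.
by rewrite v0' inbox // andbT /=; apply/asboolP.
Qed.

Lemma sum_triples N (W : nat -> int) :
  \sum_(t <- triples N) W (triple_norm t) =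
  \sum_(1 <= k < N.+1) \sum_(1 <= a < N.+1) nroots tau nu a * W (k ^ 2 * a)%N.
Proof.
rewrite big_filter big_mkcond big_allpairs_dep /= big_allpairs_dep /=.
rewrite /index_iota subSS subn0.
apply: eq_big_seq => k; rewrite mem_iota add1n ltnS => /andP[k1 _].
apply: eq_big_seq => a; rewrite mem_iota add1n ltnS => /andP[a1 aN].
rewrite /nroots mulr_suml.
transitivity (\sum_(0 <= b < N) if valid_ideal k a b then W (k ^ 2 * a)%N else 0).
  by rewrite /index_iota subn0.
rewrite (@sum_nat_tail _ _ 0 N a) //; first last.
- by move=> b ab; rewrite /valid_ideal k1 ltnNge ab.
- by move=> b Nb; rewrite /valid_ideal k1 ltnNge (leq_trans aN).
apply: eq_big_nat => b /andP[_ ba]; rewrite /valid_ideal k1 ba /=.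
by case: (_ %| _)%N; rewrite ?mul1r ?mul0r.
Qed.

(* An ideal of least norm in its class has 3 a^2 <= 4 nu - tau^2. *)
Lemma reduced_rep I : nonzero_ideals O I ->
  exists a b, [/\ valid_ideal 1 a b, (a <= 4 * nu)%N & ideal_equiv O I (ideal_of 1 a b)].
Proof.
move=> nI.
pose S (n : nat) := `[< exists t,
  [/\ valid_triple t, triple_norm t = n & ideal_equiv O I (ideal_of t.1.1 t.1.2 t.2)] >].
have exS : exists n, S n.
  have [k [a [b [v IE]]]] := ideal_of_surj nI.
  exists (triple_norm (k, a, b)); apply/asboolP; exists (k, a, b); split=> //.
  by rewrite /= -IE; apply: ideal_equiv_refl.
case: (ex_minnP exS) => n /asboolP[[[k a] b] [tv tn eq]] minS.
have /and3P[/= k0 ba dv] := tv.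
have a0 : (0 < a)%N by apply: leq_ltn_trans ba.
have v1 : valid_ideal 1 a b by apply/and3P.
have eq1 : ideal_equiv O (ideal_of k a b) (ideal_of 1 a b).
  exists 1, k%:Z%:~R; split; rewrite ?oner_eq0 ?intr_eq0 //; first exact: (O_intr 1).
  - exact: O_intr.
  - by move: k0; clear; lia.
  rewrite -[LHS]/(scale_set _ _) -[RHS]/(scale_set _ _) scale_set1; apply/seteqP; split.
    move=> _ [x [y ->]]; eexists; first by exists x, y; reflexivity.
    by ring.
  by move=> _ [_ [x [y ->]] <-]; exists x, y; ring.
have eqI : ideal_equiv O I (ideal_of 1 a b) by apply: ideal_equiv_trans eq _.
have na : (n <= a)%N.
  apply: minS; apply/asboolP; exists (1%N, a, b); split=> //.
  by rewrite /triple_norm /= mul1n.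
have an : (a <= n)%N by rewrite -tn /triple_norm /= leq_pmull // expn_gt0 k0.
exists a, b; split=> //.
(* This x0 brings [2 * a * x0 + 2 * b + tau] between -a and a, so that
   [4 a Q(x0, 1) <= a^2 + 4 nu - tau^2], while minimality of the norm gives [Q(x0, 1) >= a]. *)
pose x0 : int := if (2 * b + tau <= a)%N then 0 else -1.
have v0 : (x0, 1 : int) != (0, 0) by apply/eqP => -[_].
have [t tv' r] := multiple_of_exists v1 v0.
have an' : (a <= triple_norm t)%N.
  apply: leq_trans an _; apply: minS; apply/asboolP; exists t; split=> //.
  exact: ideal_equiv_trans eqI (multiple_of_equiv v1 v0 r).
have : a%:Z <= norm_form a b x0 1.
  by rewrite -(gez0_abs (norm_form_ge0 v1 x0 1)) -(multiple_of_norm v1 v0 tv' r) lez_nat.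
have E4 : 4 * a%:Z * norm_form a b x0 1 =
  (2 * a%:Z * x0 + (2 * b%:Z + tau%:Z)) ^+ 2 + (4 * nu%:Z - tau%:Z ^+ 2).
  by rewrite -(disc_form dv) /norm_form /qform; ring.
move=> le1.
have le2 : 4 * a%:Z * a%:Z <= 4 * a%:Z * norm_form a b x0 1 by rewrite ler_wpM2l.
have le3 : (2 * a%:Z * x0 + (2 * b%:Z + tau%:Z)) ^+ 2 <= a%:Z ^+ 2.
  rewrite sqr_le_norm // /x0; move: ba tau_le1; clear; case: ifP; lia.
rewrite -lez_nat PoszM.
have t0 : 0 <= tau%:Z ^+ 2 by rewrite sqr_ge0.
have le4 : a%:Z <= a%:Z * a%:Z by rewrite ler_peMl //; lia.
move: le2 le3 t0 le4; rewrite E4 expr2; clear; lia.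
Qed.

Definition mod4_weight (m : nat) : int := 1 - 4 * ((4 %| m)%N : nat)%:Z.

Definition lattice_weight (N n : nat) : int := trunc_sqr N n - 4 * trunc_sqr N (4 * n).

Lemma lattice_weight_eq0 N n : (N < n)%N -> lattice_weight N n = 0.
Proof. by move=> h; rewrite /lattice_weight !trunc_sqr_eq0 ?mulr0 ?subrr //; lia. Qed.

(** The substitution m -> 4 m moves the dilation from the weight to the coefficient of m, which
    thereby becomes periodic of mean zero. *)
Lemma sum_lattice_weight (x : nat -> int) N :
  \sum_(1 <= d < N.+1) \sum_(1 <= m < N.+1) x d * 1 * lattice_weight N (d * m) =
  \sum_(1 <= d < N.+1) \sum_(1 <= m < N.+1) x d * mod4_weight m * trunc_sqr N (d * m).
Proof.
apply: eq_big_nat => d /andP[d1 _].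
under eq_bigr => m _ do rewrite mulr1.
under [RHS]eq_bigr => m _ do rewrite -mulrA.
rewrite -!mulr_sumr; congr (_ * _).
under [RHS]eq_bigr => m _ do rewrite /mod4_weight mulrBl mul1r -mulrA.
rewrite /lattice_weight !sumrB -!mulr_sumr; congr (_ - _ * _).
rewrite /index_iota subSS subn0.
transitivity (\sum_(m <- iota 1 N) trunc_sqr N (d * (4 * m))).
  by apply: eq_bigr => m _; rewrite mulnCA.
rewrite (big_reindex_supp (t := iota 1 N) (P := fun m => (4 %| m)%N)
  (F := fun m => trunc_sqr N (d * m)) (g := fun m => (4 * m)%N)) ?iota_uniq //.
- rewrite big_mkcond; apply: eq_bigr => m _.
  by case: (4 %| m)%N; rewrite ?mul1r ?mul0r.
- by move=> m m' _ _; lia.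
- move=> m; rewrite !mem_iota add1n !ltnS => /andP[m1 mN] h; rewrite dvdn_mulr // andbT.
  apply/andP; split; first by lia.
  rewrite leqNgt; apply/negP => h2; case/eqP: h; apply: trunc_sqr_eq0; apply: leq_trans (ltnW h2) _.
  by rewrite leq_pmull.
- move=> m; rewrite !mem_iota add1n !ltnS => /andP[m1 mN] /dvdnP[m' mE] _.
  by exists m'; rewrite ?mem_iota; lia.
Qed.

Lemma sum_bound (T : eqType) (s : seq T) (G : T -> nat -> int) (c : int) (i j : nat) :
  (forall C, C \in s -> exists K : int, forall n, (0 < n)%N ->
     `|G C n - c * n%:Z ^+ i| <= K * n%:Z ^+ j) ->
  exists K : int, forall n, (0 < n)%N ->
     `|\sum_(C <- s) G C n - (size s)%:Z * c * n%:Z ^+ i| <= K * n%:Z ^+ j.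
Proof.
elim: s => [|C s IH] H.
  by exists 0 => n n0; rewrite big_nil /= !mul0r subrr normr0.
have [|K1 H1] := IH; first by move=> D Ds; apply: H; rewrite inE Ds orbT.
have [|K2 H2] := H C; first by rewrite inE eqxx.
exists (K2 + K1) => n n0; rewrite big_cons /= intS mulrDl.
have -> : G C n + \sum_(D <- s) G D n - (1 * c + (size s)%:Z * c) * n%:Z ^+ i =
  (G C n - c * n%:Z ^+ i) + (\sum_(D <- s) G D n - (size s)%:Z * c * n%:Z ^+ i) by ring.
apply: le_trans (ler_normD _ _) _; rewrite mulrDl; apply: lerD; [exact: H2 | exact: H1].
Qed.

Lemma class_asymp a b : valid_ideal 1 a b -> exists K : int, forall n, (0 < n)%N ->
  `|2 * \sum_(t <- triples (n ^ 8) |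
       `[< ideal_equiv O (ideal_of 1 a b) (ideal_of t.1.1 t.1.2 t.2) >])
         lattice_weight (n ^ 8) (triple_norm t)
    - 3 * n%:Z ^+ 16| <= K * n%:Z ^+ 15.
Proof.
move=> vab; have /and3P[_ ba dv] := vab.
have a0 : 0 < a%:Z by rewrite ltz_nat; apply: leq_ltn_trans ba.
have D0 := norm_form_disc vab.
have c0 : 0 < (cofactor_of a b)%:Z.
  rewrite -(pmulr_rgt0 _ a0) cofactor_ofE //.
  by have := sqr_ge0 b%:Z; have : 0 <= tau%:Z * b%:Z by []; move: disc_big; clear; lia.
(* As [n ^ 4] is the square root of the cut-off [n ^ 8], the box of half-side [C * n ^ 4] contains
   every vector at which the form is at most [n ^ 8]. *)
pose C := `|(2 + `|2 * b%:Z + tau%:Z| + 2 * a%:Z + 2 * (cofactor_of a b)%:Z)%R|%N.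
have CE : 2 + `|2 * b%:Z + tau%:Z| + 2 * a%:Z + 2 * (cofactor_of a b)%:Z <= C%:Z.
  by rewrite /C; lia.
have [K HK] := lattice_bound a0 c0 D0 CE.
exists `|K| => n n0.
have n40 : (0 < n ^ 4)%N by rewrite expn_gt0 n0.
have EN : ((n ^ 4) ^ 2 = n ^ 8)%N by rewrite -expnM.
rewrite -(class_sum (B := C * n ^ 4)) //; first last.
- move=> x y Qn; rewrite mem_zbox !mem_zrange.
  have Qn' : qform a%:Z (2 * b%:Z + tau%:Z) (cofactor_of a b)%:Z x y <= (n ^ 4)%N%:Z ^+ 2.
    by rewrite -PoszX EN -[leLHS]/(norm_form a b x y) -(gez0_abs (norm_form_ge0 vab x y)) lez_nat.
  have hy := qform_bound_snd a0 D0 Qn'.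
  have D0' : 0 < 4 * (cofactor_of a b)%:Z * a%:Z - (2 * b%:Z + tau%:Z) ^+ 2.
    by move: D0; rewrite mulrAC.
  rewrite qform_swap in Qn'; have hx := qform_bound_snd c0 D0' Qn'.
  have hC : (2 * a%:Z + 2 * (cofactor_of a b)%:Z + 2) * (n ^ 4)%N%:Z <= C%:Z * (n ^ 4)%N%:Z.
    by rewrite ler_wpM2r //; move: CE; clear; lia.
  have n4 : 1 <= (n ^ 4)%N%:Z by rewrite lez_nat.
  have p1 : 0 <= 2 * a%:Z * (n ^ 4)%N%:Z by [].
  have p2 : 0 <= 2 * (cofactor_of a b)%:Z * (n ^ 4)%N%:Z by [].
  rewrite PoszM; move: hx hy hC n4 p1 p2; clear.
  by move: (n ^ 4)%N%:Z (cofactor_of a b)%:Z a%:Z C%:Z => m e f g; lia.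
- by move=> m; apply: lattice_weight_eq0.
have := HK _ n40; rewrite EN.
have -> : \sum_(x <- zrange (C * n ^ 4)) \sum_(y <- zrange (C * n ^ 4))
   (trunc_sqr (n ^ 8) `|qform a (2 * b%:Z + tau%:Z) (cofactor_of a b) x y|
    - 4 * trunc_sqr (n ^ 8) (4 * `|qform a (2 * b%:Z + tau%:Z) (cofactor_of a b) x y|)) =
  \sum_(v <- zbox (C * n ^ 4)) lattice_weight (n ^ 8) `|norm_form a b v.1 v.2|%N.
  by rewrite big_allpairs_dep.
rewrite (bigD1_seq (0, 0)) ?zbox_uniq //=; last first.
  have Cn : (0 < C * n ^ 4)%N by rewrite muln_gt0 n40 andbT; move: CE; clear; lia.
  by rewrite mem_zbox !mem_zrange; move: Cn; clear; lia.
have -> : lattice_weight (n ^ 8) `|norm_form a b 0 0|%N = - 3 * n%:Z ^+ 16.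
  have -> : norm_form a b 0 0 = 0 by rewrite /norm_form /qform; ring.
  by rewrite /lattice_weight /trunc_sqr absz0 muln0 subn0 PoszX; ring.
move=> h; rewrite addrC -mulNr; apply: le_trans h _.
rewrite PoszX -exprM; apply: le_trans (_ : `|K| * n%:Z ^+ 12 <= _).
  by rewrite ler_wpM2r ?exprn_ge0 // ler_norm.
by rewrite ler_wpM2l // ler_weXn2l // lez_nat.
Qed.

Theorem class_number_formula (x : nat -> int) (f : nat) :
  (0 < f)%N -> (forall m, x (m + f)%N = x m) -> \sum_(1 <= m < f.+1) x m = 0 ->
  (forall n, (0 < n)%N -> dconv issq (nroots tau nu) n = dconv x (fun=> 1) n) ->
  f%:Z * #|` fset_set (ideal_classes O)|%fset%:Z = pmoment x f.
Proof.
move=> f0 per zs cnt.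
(* The reduced representatives give an explicit list [s] of all classes; this proves finiteness,
   without which [fset_set] would be the empty default. *)
pose CL := [seq ab <- [seq (a, b) | a <- iota 1 (4 * nu), b <- iota 0 (4 * nu)]
             | valid_ideal 1 ab.1 ab.2].
pose s := undup [seq ideal_class O (ideal_of 1 ab.1 ab.2) | ab <- CL].
have sP C : C \in s -> exists a b, valid_ideal 1 a b /\ C = ideal_class O (ideal_of 1 a b).
  rewrite mem_undup => /mapP[[a b]]; rewrite mem_filter => /andP[v _] ->.
  by exists a, b.
have sI I : nonzero_ideals O I -> ideal_class O I \in s.
  move=> nI; have [a [b [v aN eq]]] := reduced_rep nI.
  have -> : ideal_class O I = ideal_class O (ideal_of 1 a b).
    by apply/ideal_class_eq => //; apply: ideal_of_nonzero.
  rewrite mem_undup; apply/mapP; exists (a, b) => //; rewrite mem_filter v /=.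
  apply/allpairsP; exists (a, b); have /and3P[_ /= ba _] := v.
  rewrite /= !mem_iota; split=> //; move: ba aN; clear; lia.
have -> : #|` fset_set (ideal_classes O)|%fset = size s.
  have -> : ideal_classes O = [set` [fset C in s]%fset]%classic.
    apply/seteqP; split=> [_ [I nI <-]|C]; rewrite /= !inE ?sI //.
    move=> /sP[a [b [v ->]]]; exists (ideal_of 1 a b) => //; exact: ideal_of_nonzero.
  by rewrite set_fsetK card_fseq undup_id // undup_uniq.
pose G C n := 2 * \sum_(t <- triples (n ^ 8) | `[< C (ideal_of t.1.1 t.1.2 t.2) >])
         lattice_weight (n ^ 8) (triple_norm t).
have [C Cs|K1 H1] := @sum_bound _ s G 3 16 15.
  have [a [b [v CE]]] := sP C Cs; have [K HK] := class_asymp v.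
  exists K => n n0; have := HK n n0; rewrite /G.
  have -> : \sum_(t <- triples (n ^ 8) | `[< C (ideal_of t.1.1 t.1.2 t.2) >])
         lattice_weight (n ^ 8) (triple_norm t) =
    \sum_(t <- triples (n ^ 8) |
       `[< ideal_equiv O (ideal_of 1 a b) (ideal_of t.1.1 t.1.2 t.2) >])
      lattice_weight (n ^ 8) (triple_norm t).
    rewrite big_seq_cond [RHS]big_seq_cond; apply: eq_bigl => t.
    rewrite mem_filter; case tv: (valid_triple t) => //=; congr (_ && _).
    apply/asboolP/asboolP; rewrite CE; first by case.
    by move=> h; split=> //; apply: ideal_of_nonzero.
  by [].
have mod4_per m : mod4_weight (m + 4)%N = mod4_weight m by rewrite /mod4_weight dvdn_addl.
have mod4_zs : \sum_(1 <= m < 5) mod4_weight m = 0 by rewrite /index_iota /= !big_cons big_nil.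
have mod4_moment : pmoment mod4_weight 4 = 6 by rewrite /pmoment /index_iota /= !big_cons big_nil.
have [K2 H2] := hyperbola f0 (isT : 0 < 4)%N per zs mod4_per mod4_zs.
rewrite mod4_moment in H2.
have E n : (0 < n)%N -> \sum_(C <- s) G C n =
   2 * \sum_(1 <= d < (n ^ 8).+1) \sum_(1 <= m < (n ^ 8).+1)
      x d * mod4_weight m * trunc_sqr (n ^ 8) (d * m).
  move=> n0; rewrite /G -mulr_sumr; congr (_ * _).
  transitivity (\sum_(t <- triples (n ^ 8)) lattice_weight (n ^ 8) (triple_norm t)).
    under eq_bigr => C _ do rewrite big_mkcond.
    rewrite exchange_big /=; apply: eq_big_seq => t; rewrite mem_filter => /andP[tv _].
    have nt := ideal_of_nonzero tv.
    rewrite (bigD1_seq (ideal_class O (ideal_of t.1.1 t.1.2 t.2))) ?sI ?undup_uniq //=.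
    rewrite asboolT; last by split=> //; apply: ideal_equiv_refl.
    rewrite big_seq_cond big1 ?addr0 // => C /andP[/sP[a [b [v ->]]] ne].
    case: asboolP => // -[_ eq]; case/eqP: ne.
    by apply/ideal_class_eq.
  rewrite sum_triples -sum_lattice_weight.
  set N := (n ^ 8)%N.
  have -> : \sum_(1 <= k < N.+1) \sum_(1 <= a < N.+1)
      nroots tau nu a * lattice_weight N (k ^ 2 * a) =
     \sum_(1 <= d < N.+1) \sum_(1 <= a < N.+1)
      issq d * nroots tau nu a * lattice_weight N (d * a).
    rewrite exchange_big [RHS]exchange_big /=; apply: eq_big_nat => a /andP[a1 _].
    under [RHS]eq_bigr => d _ do rewrite -mulrA.
    rewrite (sum_issq (H := fun d => nroots tau nu a * lattice_weight N (d * a))) // => d dN.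
    by rewrite lattice_weight_eq0 ?mulr0 // (leq_trans dN) // leq_pmulr.
  rewrite -!(sum_dconv _ _ (w := lattice_weight N)); try by move=> m; apply: lattice_weight_eq0.
  by apply: eq_big_nat => m /andP[m1 _]; rewrite cnt.
(* Let A be the double sum over d and m, and h the size of [s]. One estimate gives [2 A ~ 3 h n^16],
   the other [4 f A ~ 6 (pmoment x f) n^16]. Eliminating A shows [Y n^16 = O(n^15)], so the integer
   Y is 0. *)
pose Y := 12 * (f%:Z * (size s)%:Z - pmoment x f).
have HY n : (0 < n)%N -> `|Y| * n%:Z ^+ 16 <= (2 * K2 + 4 * f%:Z * K1) * n%:Z ^+ 15.
  move=> n0; have := H1 n n0; rewrite E //; have := H2 n n0.
  set A := \sum_(_ <= _ < _) _ => h2 h1.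
  rewrite -[n%:Z ^+ 16]ger0_norm ?exprn_ge0 // -normrM.
  have -> : Y * n%:Z ^+ 16 = 2 * (f%:Z * 4%:Z * A - pmoment x f * 6 * n%:Z ^+ 16)
      - (4 * f%:Z) * (2 * A - (size s)%:Z * 3 * n%:Z ^+ 16) by rewrite /Y; ring.
  apply: le_trans (ler_normB _ _) _; rewrite [leRHS]mulrDl; apply: lerD; rewrite normrM.
    by rewrite [ `|2|]ger0_norm // -[leRHS]mulrA ler_wpM2l.
  by rewrite [ `|4 * _|]ger0_norm // -[leRHS]mulrA ler_wpM2l.
have Y0 : Y = 0.
  apply/eqP; apply: contraT => Yn0; have Y1 : 1 <= `|Y| by rewrite -gtz0_ge1 normr_gt0.
  pose K := 2 * K2 + 4 * f%:Z * K1.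
  have n0 : (0 < `|K|.+1)%N by [].
  have := HY _ n0; rewrite exprSr mulrA -/K.
  have nn : 0 < (`|K|.+1)%:Z ^+ 15 :> int by rewrite exprn_gt0.
  rewrite [X in X <= _](_ : _ = (`|Y| * (`|K|.+1)%:Z) * (`|K|.+1)%:Z ^+ 15); last by ring.
  rewrite ler_pM2r // => h.
  have : (`|K|.+1)%:Z <= `|Y| * (`|K|.+1)%:Z :> int by rewrite ler_peMl.
  by move: h; clear; lia.
by move: Y0; rewrite /Y; clear; lia.
Qed.

End ImaginaryQuadratic.

(** * The fields generated by the square roots of -p and -2p *)

Lemma sqrtC_neg_conj (d : int) : d < 0 ->
  (sqrtC d%:~R : algC)^* = - sqrtC d%:~R.
Proof.
move=> d0; set s := sqrtC _; have s2 : s ^+ 2 = d%:~R by rewrite sqrtCK.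
have : s^* ^+ 2 = s ^+ 2 by rewrite -rmorphXn /= s2 rmorph_int.
move/eqP; rewrite eqf_sqr => /orP[|/eqP //] /eqP sr.
have : s \is Num.real by apply/CrealP.
move=> /real_exprn_even_ge0 => /(_ 2%N isT); rewrite s2 ler0z.
by rewrite leNgt d0.
Qed.

(** The denominator of y is coprime to its numerator, so the square of the denominator divides e. *)
Lemma sqrfree_rat (e : nat) (y : rat) (k : int) :
  (0 < e)%N -> (forall g : nat, (g ^ 2 %| e)%N -> g = 1%N) ->
  e%:R * y ^+ 2 = k%:~R -> exists n : int, y = n%:~R.
Proof.
move=> e0 sf E; exists (numq y).
have dn : (denq y)%:~R != 0 :> rat by rewrite intr_eq0 denq_neq0.
have nE : (numq y)%:~R = y * (denq y)%:~R :> rat by rewrite -{2}(divq_num_den y) divfK.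
have E2 : e%:Z * numq y ^+ 2 = k * denq y ^+ 2.
  apply/eqP; rewrite -(eqr_int rat); apply/eqP.
  have -> : (k * denq y ^+ 2)%:~R = k%:~R * (denq y)%:~R ^+ 2 :> rat by ring.
  have -> : (e%:Z * numq y ^+ 2)%:~R = e%:R * (numq y)%:~R ^+ 2 :> rat by ring.
  by rewrite nE -E; ring.
have dv : (`|denq y|%N ^ 2 %| e)%N.
  have : (`|denq y|%N ^ 2 %| e * `|numq y|%N ^ 2)%N.
    have := congr1 absz E2; rewrite abszM [X in _ = X]abszM !abszX absz_nat => ->.
    exact: dvdn_mull.
  rewrite Gauss_dvdl // coprimeXl // coprimeXr // coprime_sym.
  exact: coprime_num_den.
have d1 : denq y = 1 by rewrite -[LHS]gez0_abs ?denq_ge0 // (sf _ dv).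
by rewrite -[LHS]divq_num_den d1 divr1.
Qed.

Lemma quadratic_trace_norm (d : int) (x y : rat) (z : algC) : d < 0 ->
  z = ratr x + ratr y * sqrtC d%:~R -> z \in Aint ->
  (exists m : int, 2 * x = m%:~R) /\
  (exists k : int, x ^+ 2 - d%:~R * y ^+ 2 = k%:~R).
Proof.
move=> d0 zE zA; have zA' : z^* \in Aint by rewrite (Aint_aut Num.conj_op).
have zcE : z^* = ratr x - ratr y * sqrtC d%:~R.
  rewrite zE rmorphD [X in _ + X]rmorphM /= sqrtC_neg_conj // mulrN.
  by rewrite !(conj_Crat (Crat_rat _)).
have toQ (q : rat) : (ratr q : algC) \in Aint -> exists m : int, q = m%:~R.
  move=> qA; have /intrP[m mE] := Cint_rat_Aint (Crat_rat q) qA.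
  exists m; apply: (fmorph_inj (ratr : {rmorphism rat -> algC})).
  by apply: etrans mE _; rewrite [RHS]ratr_int.
split; apply: toQ.
  have -> : ratr (2 * x) = z + z^*.
    by rewrite zcE zE rmorphM /= rmorph_nat; ring.
  exact: rpredD.
have -> : ratr (x ^+ 2 - d%:~R * y ^+ 2) = z * z^*.
  rewrite zcE zE rmorphB rmorphM !rmorphXn /= rmorph_int.
  have -> : (ratr x + ratr y * sqrtC d%:~R) * (ratr x - ratr y * sqrtC d%:~R) =
    ratr x ^+ 2 - ratr y ^+ 2 * (sqrtC d%:~R) ^+ 2 :> algC by ring.
  by rewrite sqrtCK mulrC.
exact: rpredM.
Qed.

Lemma quadratic_int (e : nat) (x y : rat) (z : algC) : (0 < e)%N ->
  (forall g : nat, (g ^ 2 %| e)%N -> g = 1%N) ->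
  z = ratr x + ratr y * sqrtC (- e%:Z)%:~R -> z \in Aint ->
  exists m n k : int, [/\ 2 * x = m%:~R, 2 * y = n%:~R & m ^+ 2 + e%:Z * n ^+ 2 = 4 * k].
Proof.
move=> e0 sf zE zA; have d0 : - e%:Z < 0 by lia.
have [[m mE] [k kE]] := quadratic_trace_norm d0 zE zA.
have E : e%:R * (2 * y) ^+ 2 = (4 * k - m ^+ 2)%:~R :> rat.
  rewrite rmorphB rmorphM rmorphXn /= -kE -mE mulrNz -pmulrn; ring.
have [n nE] := sqrfree_rat e0 sf E; exists m, n, k; split=> //.
move: E; rewrite nE => /eqP.
have -> : e%:R * n%:~R ^+ 2 = (e%:Z * n ^+ 2)%:~R :> rat by rewrite rmorphM rmorphXn.
by rewrite eqr_int => /eqP ->; ring.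
Qed.

Lemma even_sqr (x : int) : (2 %| x ^+ 2)%Z = (2 %| x)%Z.
Proof. by rewrite !dvdzE abszX Euclid_dvdX // andbT. Qed.

Lemma Aint_quadratic_gen (tau nu : nat) (w : algC) (x y : int) :
  w ^+ 2 = tau%:Z%:~R * w - nu%:Z%:~R -> qelt w x y \in Aint.
Proof.
move=> w2; have wA : w \in Aint.
  apply: (@stable_Aint w 1 w 0 1 (- nu%:Z) tau%:Z); first exact: oner_neq0.
    by ring.
  by rewrite -expr2 w2; ring.
by rewrite /qelt rpredD // ?rpredM // Aint_int // intr_int.
Qed.

Section Fields.

Variable p : nat.
Hypotheses (p_prime : prime p) (p_mod8 : (p %% 8 = 7)%N).

Let p_gt0 : (0 < p)%N. Proof. exact: prime_gt0. Qed.
Let p_odd : odd p. Proof. by move: p_mod8; lia. Qed.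
Let p_mod4 : (p %% 4 = 3)%N. Proof. by move: p_mod8; lia. Qed.

Lemma prime_sqrfree g : (g ^ 2 %| p)%N -> g = 1%N.
Proof.
move=> dv; have gp : (g %| p)%N by apply: dvdn_trans dv; rewrite expnS dvdn_mulr.
case/primeP: p_prime => _ /(_ g gp) /orP[/eqP //|/eqP gE].
move: dv; rewrite gE expnS expn1 -{3}[p]muln1 dvdn_pmul2l // dvdn1 => /eqP p1.
by move: p_prime; rewrite p1.
Qed.

Lemma double_prime_sqrfree g : (g ^ 2 %| 2 * p)%N -> g = 1%N.
Proof.
move=> dv; have godd : odd g.
  apply: contraT => ge; have [h hE] : exists h, g = (h * 2)%N by apply/dvdnP; lia.
  move: dv; rewrite hE expnMn => /dvdnP[j jE]; move: p_odd jE; clear; lia.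
apply: prime_sqrfree; move: dv; rewrite Gauss_dvdr // coprimeXl //.
by rewrite coprime_sym coprime2n.
Qed.

Let s1 : algC := sqrtC (- p%:Z)%:~R.
Let w1 : algC := (1 + s1) / 2.
Let s2 : algC := sqrtC (- (2 * p)%N%:Z)%:~R.
Let nu1 : nat := ((p + 1) %/ 4)%N.
Let nu1E : (4 * nu1 = p + 1)%N. Proof. by rewrite /nu1; move: p_mod8; lia. Qed.

Lemma w1_sqr : w1 ^+ 2 = 1%N%:Z%:~R * w1 - nu1%:Z%:~R.
Proof.
have s12 : s1 ^+ 2 = (- p%:Z)%:~R by rewrite sqrtCK.
have -> : nu1%:Z%:~R = (1 - s1 ^+ 2) / 4 :> algC.
  have n4 : 4 * nu1%:Z%:~R = 1 - s1 ^+ 2 :> algC.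
    rewrite s12 mulrNz opprK -[4]/(4%:Z%:~R) -[1]/(1%:Z%:~R) -intrM -intrD; congr _%:~R.
    by move: nu1E; lia.
  by rewrite -n4; field.
by rewrite /w1; field.
Qed.

Lemma w1_conj : w1^* = 1%N%:Z%:~R - w1.
Proof.
rewrite /w1 rmorphM rmorphD /= rmorph1 fmorphV rmorph_nat sqrtC_neg_conj; last by lia.
by rewrite -/s1; field.
Qed.

(** Since -p = 1 mod 4, the condition that 4 divides [m^2 + p n^2] only forces m and n to have equal
    parity, whence the generator [w1]. For -2p the analogous condition forces both to be even. *)
Lemma ring_of_integers_p z : ring_of_integers (quadratic_field (- p%:Z)) z <->
  exists x y, z = qelt w1 x y.
Proof.
split=> [[[x [y zE]] zA]|[x [y ->]]]; last first.
  split; last exact: Aint_quadratic_gen w1_sqr.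
  exists (x%:~R + y%:~R / 2), (y%:~R / 2).
  by rewrite /qelt /w1 -/s1 !rmorphD !rmorphM /= !rmorph_int fmorphV rmorph_nat; field.
have [m [n [k [mE nE mn]]]] := quadratic_int p_gt0 prime_sqrfree zE zA.
have [q qE] : exists q, m = n + 2 * q.
  have h : (2 %| m - n)%Z.
    rewrite -even_sqr.
    have -> : (m - n) ^+ 2 = 2 * (2 * k - 2 * (nu1%:Z * n ^+ 2) + n ^+ 2 - m * n).
      have pE : p%:Z = 4 * nu1%:Z - 1 by move: nu1E; clear; lia.
      by move: mn; rewrite pE; clear; lia.
    exact: dvdz_mulr.
  by case/dvdzP: h => q qE; exists q; move: qE; clear; lia.
exists q, n; rewrite zE.
have -> : x = (n + 2 * q)%:~R / 2 by rewrite -qE -mE; field.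
have -> : y = n%:~R / 2 by rewrite -nE; field.
rewrite /qelt /w1 -/s1 !rmorphM /= fmorphV rmorph_nat !rmorph_int.
by field.
Qed.

Lemma ring_of_integers_2p z : ring_of_integers (quadratic_field (- (2 * p)%N%:Z)) z <->
  exists x y, z = qelt s2 x y.
Proof.
have s22 : s2 ^+ 2 = 0%N%:Z%:~R * s2 - (2 * p)%N%:Z%:~R.
  by rewrite sqrtCK mulrNz mul0r sub0r.
split=> [[[x [y zE]] zA]|[x [y ->]]]; last first.
  split; last exact: Aint_quadratic_gen s22.
  by exists x%:~R, y%:~R; rewrite !rmorph_int.
have e0 : (0 < 2 * p)%N by rewrite muln_gt0.
have [m [n [k [mE nE mn]]]] := quadratic_int e0 double_prime_sqrfree zE zA.
have [q qE] : exists q, m = 2 * q.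
  have h : (2 %| m)%Z.
    rewrite -even_sqr.
    have -> : m ^+ 2 = 2 * (2 * k - p%:Z * n ^+ 2) by move: mn; rewrite PoszM; clear; lia.
    exact: dvdz_mulr.
  by case/dvdzP: h => q qE; exists q; rewrite mulrC.
have [r rE] : exists r, n = 2 * r.
  have h : (2 %| n)%Z.
    have E : p%:Z * n ^+ 2 = 2 * (k - q ^+ 2) by move: mn; rewrite PoszM qE; lia.
    have [t tE] : exists t, p%:Z = 2 * t + 1 by exists (p %/ 2)%N%:Z; move: p_odd; lia.
    rewrite -even_sqr.
    have -> : n ^+ 2 = 2 * (k - q ^+ 2 - t * n ^+ 2) by move: E; rewrite tE; clear; lia.
    exact: dvdz_mulr.
  by case/dvdzP: h => r rE; exists r; rewrite mulrC.
exists q, r; rewrite zE.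
have -> : x = q%:~R by apply: (@mulfI _ 2) => //; rewrite mE qE intrM.
have -> : y = r%:~R by apply: (@mulfI _ 2) => //; rewrite nE rE intrM.
by rewrite !rmorph_int.
Qed.

(** By reciprocity the residue symbol modulo p is also the character of Q(sqrt(-p)), describing how
    primes split there. *)
Definition psi (n : nat) : int := leg (n%:R : 'F_p).

Lemma psiM m n : psi (m * n) = psi m * psi n.
Proof. by rewrite /psi natrM legM. Qed.

Lemma psi_add m : psi (m + p) = psi m.
Proof. by rewrite /psi natrD pchar_Fp_0 // addr0. Qed.

Lemma psi2 : psi 2 = 1.
Proof. by rewrite /psi leg2 // /chi8 p_mod8. Qed.

Lemma psi_eq0 n : (psi n == 0) = (p %| n)%N.
Proof. by rewrite leg_eq0 -(dvdn_pcharf (pchar_Fp p_prime)). Qed.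

Lemma psi_cases n : [|| psi n == 0, psi n == 1 | psi n == -1].
Proof. exact: leg_cases. Qed.

Lemma psi0 : psi 0 = 0. Proof. by rewrite /psi leg0. Qed.

Lemma sum_psi : \sum_(0 <= t < p) psi t = 0.
Proof. by rewrite /psi (sum_Fp (fun x : 'F_p => leg x)) // sum_leg. Qed.

Lemma sum_range1 (F : nat -> int) (n : nat) : F 0%N = 0 -> F n = 0 ->
  \sum_(1 <= m < n.+1) F m = \sum_(0 <= m < n) F m.
Proof.
move=> F0 Fn; case: n Fn => [|n] Fn; first by rewrite !big_geq.
by rewrite big_nat_recr //= Fn addr0 [RHS]big_nat_recl // F0 add0r big_add1.
Qed.

Lemma chi8M m n : chi8 (m * n) = chi8 m * chi8 n.
Proof.
rewrite /chi8 -modnMm; have := ltn_pmod m (isT : 0 < 8)%N; have := ltn_pmod n (isT : 0 < 8)%N.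
by case: (m %% 8)%N => [|[|[|[|[|[|[|[|]]]]]]]] //;
  case: (n %% 8)%N => [|[|[|[|[|[|[|[|]]]]]]]].
Qed.

Lemma chi8_mod n : chi8 (n %% 8) = chi8 n.
Proof. by rewrite /chi8 modn_mod. Qed.

Lemma chi8_cases n : [|| chi8 n == 0, chi8 n == 1 | chi8 n == -1].
Proof. by rewrite /chi8; case: (n %% 8)%N => [|[|[|[|[|[|[|[|]]]]]]]]. Qed.

Lemma chi8_eq0_prime q : prime q -> (chi8 q == 0) = (q == 2).
Proof.
move=> q_pr; case: (even_prime q_pr) => [-> //|q_odd].
have -> : (q == 2) = false by apply/eqP => q2; rewrite q2 in q_odd.
have : odd (q %% 8) by move: q_odd; lia.
rewrite /chi8; have := ltn_pmod q (isT : 0 < 8)%N.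
by case: (q %% 8)%N => [|[|[|[|[|[|[|[|]]]]]]]].
Qed.

(** The character of Q(sqrt(-2p)): its discriminant -8p is the product of the discriminants 8 and
    -p. *)
Definition chi2 (n : nat) : int := chi8 n * psi n.

Lemma ideal_count_p n : (0 < n)%N ->
  dconv issq (nroots 1 nu1) n = dconv psi (fun=> 1) n.
Proof.
apply: ideal_count.
- by rewrite /psi leg1.
- exact: psiM.
- by move=> q _; apply: psi_cases.
- move=> q q_pr; case: (even_prime q_pr) => [->|q_odd].
    (* As p = 7 mod 8, [nu1] is even and both residues modulo 2 are roots: the prime 2 splits. *)
    rewrite psi2 /nroots /index_iota /= !big_cons big_nil /qpoly.
    have [h hE] : exists h, nu1 = (h * 2)%N.
      by exists ((p + 1) %/ 8)%N; rewrite /nu1; move: p_mod8; lia.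
    by rewrite hE; do 2 (rewrite (_ : (2 %| _)%N = true); last by lia).
  rewrite nroots_leg //; congr (_ + _).
  have -> : (1 ^ 2)%:R - (4 * nu1)%:R = (- p%:Z)%:~R :> 'F_q.
    by rewrite nu1E natrD mulrNz -pmulrn exp1n; ring.
  have [qp|qp] := eqVneq q p; last exact: leg_reciprocity.
  by rewrite qp mulrNz -pmulrn pchar_Fp_0 // oppr0 /psi pchar_Fp_0.
- move=> q b q_pr xq dv; apply/negP => dv2.
  have : (q %| p)%N.
    have E : (4 * qpoly 1 nu1 b = (2 * b + 1) * (2 * b + 1) + p)%N.
      by rewrite /qpoly; move: nu1E; nia.
    have : (q %| (2 * b + 1) * (2 * b + 1) + p)%N by rewrite -E dvdn_mull.
    by rewrite dvdn_addr // dvdn_mulr.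
  rewrite dvdn_prime2 // => /eqP qp; case/negP: xq.
  by rewrite psi_eq0 qp.
- move=> q b q_pr /eqP; rewrite psi_eq0 dvdn_prime2 // => /eqP <-.
  apply/negP => dv.
  have E : (4 * qpoly 1 nu1 b = (2 * b + 1) ^ 2 + p)%N.
    by rewrite /qpoly; move: nu1E; nia.
  have dv' : (p ^ 2 %| (2 * b + 1) ^ 2 + p)%N by rewrite -E dvdn_mull.
  have pb : (p %| 2 * b + 1)%N.
    have : (p %| (2 * b + 1) ^ 2 + p)%N by apply: dvdn_trans dv'; rewrite expnS dvdn_mulr.
    by rewrite dvdn_addl // Euclid_dvdX // andbT.
  have : (p ^ 2 %| p)%N by rewrite -(@dvdn_addr ((2 * b + 1) ^ 2)) // dvdn_exp2r.
  by move/prime_sqrfree => p1; move: p_prime; rewrite p1.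
Qed.

Lemma ideal_count_2p n : (0 < n)%N ->
  dconv issq (nroots 0 (2 * p)) n = dconv chi2 (fun=> 1) n.
Proof.
have chi2_eq0 q : prime q -> (chi2 q == 0) = (q == 2) || (q == p).
  by move=> q_pr; rewrite mulf_eq0 chi8_eq0_prime // psi_eq0 dvdn_prime2 // [p == q]eq_sym.
apply: ideal_count.
- by rewrite /chi2 /psi leg1.
- by move=> m k; rewrite /chi2 chi8M psiM; ring.
- move=> q _; rewrite /chi2.
  by case/or3P: (chi8_cases q) => /eqP ->; case/or3P: (psi_cases q) => /eqP ->.
- move=> q q_pr; case: (even_prime q_pr) => [->|q_odd].
    rewrite /chi2 mul0r /nroots /index_iota /= !big_cons big_nil /qpoly.
    have -> : (2 %| 0 ^ 2 + 0 * 0 + 2 * p)%N = true by rewrite /= dvdn_mulr.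
    by have -> : (2 %| 1 ^ 2 + 0 * 1 + 2 * p)%N = false by rewrite dvdn_addl ?dvdn_mulr.
  rewrite nroots_leg //; congr (_ + _).
  have -> : (0 ^ 2)%:R - (4 * (2 * p))%:R = 2%:R * 2%:R * (2%:R * (- p%:Z)%:~R) :> 'F_q.
    by rewrite !natrM mulrNz -pmulrn; ring.
  have two0 : 2%:R != 0 :> 'F_q.
    by rewrite -(dvdn_pcharf (pchar_Fp q_pr)) gtnNdvd //; case: (q) q_odd q_pr => [|[|[|]]].
  rewrite !legM // leg_sqr // mul1r leg2 // /chi2; congr (_ * _).
  have [qp|qp] := eqVneq q p; last exact: leg_reciprocity.
  by rewrite qp mulrNz -pmulrn pchar_Fp_0 // oppr0 /psi pchar_Fp_0.
- move=> q b q_pr xq dv; apply/negP => dv2; case/negP: xq; rewrite chi2_eq0 //.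
  have : (q %| 8 * p)%N.
    have E : (4 * qpoly 0 (2 * p) b = (2 * b + 0) * (2 * b + 0) + 8 * p)%N.
      by rewrite /qpoly; nia.
    have : (q %| (2 * b + 0) * (2 * b + 0) + 8 * p)%N by rewrite -E dvdn_mull.
    by rewrite dvdn_addr // dvdn_mulr.
  by rewrite Euclid_dvdM // (Euclid_dvdX 2 3) // andbT !dvdn_prime2.
- move=> q b q_pr /eqP; rewrite chi2_eq0 // => /orP[] /eqP ->; apply/negP => dv.
    (* For odd p, [b^2 + 2 p] is 2 or 3 modulo 4 according to the parity of b. *)
    have [h hE] : exists h, p = (h * 2 + 1)%N by exists (p %/ 2)%N; move: p_odd; lia.
    case/dvdnP: dv => j; rewrite /qpoly hE; case/boolP: (2 %| b)%N.
      by case/dvdnP => c ->; nia.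
    move=> ob; have [c ->] : exists c, b = (c * 2 + 1)%N by exists (b %/ 2)%N; lia.
    by nia.
  move: dv; rewrite /qpoly mul0n addn0 => dv.
  have pb : (p %| b)%N.
    have : (p %| b ^ 2 + 2 * p)%N by apply: dvdn_trans dv; rewrite expnS dvdn_mulr.
    rewrite dvdn_addl; last exact: dvdn_mull.
    by rewrite Euclid_dvdX // andbT.
  have : (p ^ 2 %| 2 * p)%N by rewrite -(@dvdn_addr (b ^ 2)) // dvdn_exp2r.
  by move/double_prime_sqrfree => p1; move: p_prime; rewrite p1.
Qed.

(** * Character sums over octants *)

Lemma class_number_p :
  p%:Z * (class_number (quadratic_field (- p%:Z)))%:Z = - \sum_(0 <= t < p) psi t * t%:Z.
Proof.
have E := class_number_formula (tau := 1) (nu := nu1) (w := w1)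
  (O := ring_of_integers (quadratic_field (- p%:Z))) isT _ w1_sqr w1_conj
  ring_of_integers_p _ p_gt0 psi_add _ ideal_count_p.
rewrite /class_number E.
- have pp : psi p = 0 by apply/eqP; rewrite psi_eq0.
  by rewrite /pmoment sum_range1 ?psi0 ?pp ?mul0r.
- by move: nu1E p_mod8; clear; lia.
- move=> d x y u d0 uE uA; split=> //.
  exists (x%:~R / d%:~R + y%:~R / 2 / d%:~R), (y%:~R / 2 / d%:~R).
  have dC : d%:~R != 0 :> algC by rewrite intr_eq0.
  apply: (mulfI dC); rewrite uE /qelt /w1 -/s1 !rmorphD !rmorphM /=.
  rewrite !fmorphV !rmorph_int rmorph_nat.
  by field.
- rewrite sum_range1 ?sum_psi ?psi0 //.
  by apply/eqP; rewrite psi_eq0.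
Qed.

Lemma sum_coprime_mul (F : nat -> int) (M : nat) : coprime p M ->
  \sum_(0 <= t < p) F ((M * t) %% p)%N = \sum_(0 <= s < p) F s.
Proof.
move=> co; have M0 : M%:R != 0 :> 'F_p.
  by rewrite -(dvdn_pcharf (pchar_Fp p_prime)) -prime_coprime.
transitivity (\sum_(x : 'F_p) F (M%:R * x : 'F_p)).
  rewrite -(sum_Fp (fun x : 'F_p => F (M%:R * x : 'F_p))) //.
  by apply: eq_bigr => t _; rewrite -natrM val_Fp_nat.
transitivity (\sum_(x : 'F_p) F x).
  by rewrite [RHS](reindex_inj (mulfI M0)).
rewrite -(sum_Fp (fun x : 'F_p => F x)) //; apply: eq_big_nat => t /andP[_ tp].
by rewrite val_Fp_nat // modn_small.
Qed.

Lemma psi_mod n : psi (n %% p) = psi n.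
Proof.
rewrite {2}(divn_eq n p); elim: (n %/ p)%N => [|q IH]; first by rewrite mul0n.
by rewrite mulSn -addnA addnC psi_add.
Qed.

Lemma psiN t : (t <= p)%N -> psi (p - t) = - psi t.
Proof. by move=> tp; rewrite /psi natrB // pchar_Fp_0 // sub0r legN. Qed.

Definition arc_sum (M j : nat) : int := \sum_(0 <= t < p | ((M * t) %/ p == j)%N) psi t.

(** Modulo M, p is -1, so [M t = q p + r] gives r = q. *)
Lemma mod_mod_div M t : (M %| p + 1)%N -> (t < p)%N ->
  (((M * t) %% p) %% M = (M * t) %/ p)%N.
Proof.
move=> Mp tp; have M0 : (0 < M)%N by apply: dvdn_gt0 Mp; rewrite addn1.
have q_lt : ((M * t) %/ p < M)%N by rewrite ltn_divLR // ltn_pmul2l.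
rewrite -[RHS](modn_small q_lt); apply/eqP.
rewrite -(eqn_modDr ((M * t) %/ p * p)) [X in X == _ %[mod _]]addnC -divn_eq.
rewrite modnMr addnC -{2}[(_ %/ _)%N]muln1 -mulnDr addnC -[_ == _]/(0 == _) eq_sym.
by apply: dvdn_mull; rewrite ?[(1 + p)%N]addnC.
Qed.

(* Multiplication by M permutes the residues mod p and preserves psi; it maps
   the t with floor (M t / p) = j onto the residues congruent to j mod M. *)
Lemma arc_sum_mod M j : (M %| p + 1)%N -> psi M = 1 ->
  arc_sum M j = \sum_(0 <= s < p | (s %% M == j)%N) psi s.
Proof.
move=> Mp pM; have co : coprime p M.
  by rewrite prime_coprime // -psi_eq0 pM.
rewrite /arc_sum [RHS]big_mkcond -(sum_coprime_mul _ co) /= [LHS]big_mkcond /=.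
apply: eq_big_nat => t /andP[_ tp]; rewrite mod_mod_div //.
by rewrite psi_mod psiM pM mul1r.
Qed.

Let psi8 : psi 8 = 1. Proof. by rewrite -[8%N]/(2 * (2 * 2))%N !psiM psi2. Qed.
Let psi4 : psi 4 = 1. Proof. by rewrite -[4%N]/(2 * 2)%N !psiM psi2. Qed.
Let d8 : (8 %| p + 1)%N. Proof. by move: p_mod8; clear; lia. Qed.
Let d4 : (4 %| p + 1)%N. Proof. by move: p_mod8; clear; lia. Qed.

Lemma octant_reflect t j : (0 < t < p)%N -> (j <= 7)%N ->
  ((8 * (p - t)) %/ p == 7 - j)%N = ((8 * t) %/ p == j)%N.
Proof.
move=> /andP[t0 tp] j7.
have q_lt : ((8 * t) %/ p < 8)%N by rewrite ltn_divLR // ltn_pmul2l.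
have r0 : (0 < (8 * t) %% p)%N.
  rewrite lt0n; apply/negP => dv; have : (p %| 8 * t)%N by [].
  rewrite Gauss_dvdr; first by move/(dvdn_leq t0); rewrite leqNgt tp.
  by rewrite prime_coprime // -psi_eq0 psi8.
have rp : ((8 * t) %% p < p)%N by rewrite ltn_pmod.
have -> : ((8 * (p - t)) %/ p = 7 - (8 * t) %/ p)%N.
  have E : (8 * (p - t) = (7 - (8 * t) %/ p) * p + (p - (8 * t) %% p))%N.
    rewrite mulnBr {1}(divn_eq (8 * t) p) mulnBl.
    have : ((8 * t) %/ p * p <= 7 * p)%N by rewrite leq_mul2r -ltnS q_lt orbT.
    by move: rp; clear; lia.
  rewrite E divnMDl // [((p - _) %/ p)%N]divn_small ?addn0 //.
  by move: r0 rp; move: ((8 * t) %% p)%N => r; clear; lia.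
by move: q_lt j7; clear; lia.
Qed.

Lemma octant_sum_reflect (H : nat -> int) j : H 0%N = 0 -> H p = 0 -> (j <= 7)%N ->
  \sum_(0 <= t < p | ((8 * t) %/ p == 7 - j)%N) H t =
  \sum_(0 <= t < p | ((8 * t) %/ p == j)%N) H (p - t)%N.
Proof.
move=> H0 Hp j7; rewrite [LHS]big_mkcond [RHS]big_mkcond /=.
pose F t := if ((8 * t) %/ p == 7 - j)%N then H t else 0.
transitivity (\sum_(0 <= t < p) F t); first by [].
have Fp0 : F p = 0 by rewrite /F Hp if_same.
rewrite big_nat_rev /= add0n.
transitivity (\sum_(0 <= t < p) F (p - t)%N).
  rewrite -[in RHS](prednK p_gt0) [RHS]big_nat_recl // subn0 prednK // Fp0 add0r.
  rewrite -{1}(prednK p_gt0) big_nat_recr //= prednK // subnn.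
  by have -> : F 0%N = 0; rewrite ?addr0 // /F H0 if_same.
apply: eq_big_nat => t /andP[_ tp]; case: (posnP t) => [->|t0].
  by rewrite subn0 Fp0 Hp if_same.
by rewrite /F octant_reflect ?t0.
Qed.

Lemma arc_sum_reflect j : (j <= 7)%N -> arc_sum 8 (7 - j) = - arc_sum 8 j.
Proof.
move=> j7; rewrite /arc_sum octant_sum_reflect ?psi0 //; last by apply/eqP; rewrite psi_eq0.
rewrite -sumrN [LHS]big_mkcond [RHS]big_mkcond /=.
apply: eq_big_nat => t /andP[_ tp]; case: ifP => // _.
by rewrite psiN // ltnW.
Qed.

Lemma sum_fibers (g : nat -> nat) (k : nat) (G : nat -> int) :
  (forall t, (t < p)%N -> (g t < k)%N) ->
  \sum_(0 <= t < p) G t = \sum_(0 <= j < k) \sum_(0 <= t < p | (g t == j)%N) G t.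
Proof.
move=> gk; under [RHS]eq_bigr => j _ do rewrite big_mkcond.
rewrite exchange_big /=; apply: eq_big_nat => t /andP[_ tp].
rewrite -big_mkcond /= -big_filter.
rewrite (perm_big [:: g t]) ?big_seq1 //; apply: uniq_perm => //.
  by rewrite filter_uniq // iota_uniq.
move=> j; rewrite mem_filter mem_index_iota inE eq_sym.
by case: eqP => // ->; rewrite gk.
Qed.

Lemma arc_sum_quarter j : (j < 4)%N ->
  arc_sum 4 j = arc_sum 8 (2 * j) + arc_sum 8 (2 * j).+1.
Proof.
move=> j4; rewrite /arc_sum [LHS]big_mkcond.
rewrite [X in _ = X + _]big_mkcond [X in _ = _ + X]big_mkcond.
rewrite -big_split; apply: eq_big_nat => t /andP[_ tp] /=.
have -> : ((4 * t) %/ p = ((8 * t) %/ p) %/ 2)%N.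
  by rewrite -divnMA [(p * 2)%N]mulnC -[(8 * t)%N]/(2 * 4 * t)%N -mulnA divnMl.
move: ((8 * t) %/ p)%N => q.
have [->|h1] := eqVneq q (2 * j)%N.
  have -> : ((2 * j) %/ 2 == j)%N by rewrite mulKn.
  have -> : ((2 * j)%N == (2 * j).+1) = false by clear; lia.
  by rewrite addr0.
have [->|h2] := eqVneq q (2 * j).+1.
  have -> : ((2 * j).+1 %/ 2 == j)%N by clear; lia.
  by rewrite add0r.
by have -> : (q %/ 2 == j)%N = false by move: h1 h2; clear; lia.
Qed.

(** By [arc_sum_mod] a quarter corresponds to a residue class modulo 4, which splits into two
    classes modulo 8. These come from the octants j and j + 4, not from the two adjacent octants
    that make up the quarter. *)
Lemma arc_sum_mod_quarter j : (j < 4)%N ->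
  arc_sum 4 j = arc_sum 8 j + arc_sum 8 (j + 4).
Proof.
move=> j4; rewrite !arc_sum_mod //.
rewrite [LHS]big_mkcond [X in _ = X + _]big_mkcond [X in _ = _ + X]big_mkcond.
rewrite -big_split; apply: eq_bigr => s _ /=.
have [h1|h1] := eqVneq (s %% 8)%N j.
  have -> : (s %% 4 == j)%N by move: h1 j4; clear; lia.
  have -> : (s %% 8 == j + 4)%N = false by move: h1 j4; clear; lia.
  by rewrite addr0.
have [h2|h2] := eqVneq (s %% 8)%N (j + 4)%N.
  have -> : (s %% 4 == j)%N by move: h2 j4; clear; lia.
  by rewrite add0r.
by have -> : (s %% 4 == j)%N = false by move: h1 h2 j4; clear; lia.
Qed.

(* Compare arc_sum_quarter with arc_sum_mod_quarter for j = 0, 1. *)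
Lemma arc_sum_relations : arc_sum 8 2 = arc_sum 8 1 /\ arc_sum 8 3 = - arc_sum 8 1.
Proof.
have A0 : arc_sum 8 0 + arc_sum 8 1 = arc_sum 8 0 + arc_sum 8 4.
  exact: etrans (esym (arc_sum_quarter (j := 0) isT)) (arc_sum_mod_quarter (j := 0) isT).
have A1 : arc_sum 8 2 + arc_sum 8 3 = arc_sum 8 1 + arc_sum 8 5.
  exact: etrans (esym (arc_sum_quarter (j := 1) isT)) (arc_sum_mod_quarter (j := 1) isT).
have U4 : arc_sum 8 4 = - arc_sum 8 3 := arc_sum_reflect (isT : 3 <= 7)%N.
have U5 : arc_sum 8 5 = - arc_sum 8 2 := arc_sum_reflect (isT : 2 <= 7)%N.
move: A0 A1; rewrite U4 U5; move: (arc_sum 8 0) (arc_sum 8 1) (arc_sum 8 2) (arc_sum 8 3).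
by clear; lia.
Qed.

(** Replacing t by the residue of 8 t in [S = \sum psi t * t] gives
    [7 S = p * \sum_j j * arc_sum 8 j]. Reflection and [arc_sum_relations] reduce the octants to the
    first two, each with coefficient -7. *)
Lemma class_number_p_octants : (class_number (quadratic_field (- p%:Z)))%:Z =
  arc_sum 8 0 + arc_sum 8 1.
Proof.
have E := class_number_p; set h := (class_number _)%:Z in E *.
have co : coprime p 8 by rewrite prime_coprime // -psi_eq0 psi8.
pose S := \sum_(0 <= t < p) psi t * t%:Z.
have ES : S = 8 * S - p%:Z * \sum_(0 <= t < p) psi t * ((8 * t) %/ p)%N%:Z.
  rewrite /S -{1}(sum_coprime_mul (fun t => psi t * t%:Z) co) !mulr_sumr -sumrB.
  apply: eq_bigr => t _; rewrite psi_mod psiM psi8 mul1r.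
  have : (8 * t)%N%:Z = ((8 * t) %/ p)%N%:Z * p%:Z + ((8 * t) %% p)%N%:Z.
    by rewrite -PoszM -PoszD -divn_eq.
  rewrite PoszM => Et.
  by rewrite -[(_ %% p)%N%:Z](addKr (((8 * t) %/ p)%N%:Z * p%:Z)) -Et; ring.
have ET : \sum_(0 <= t < p) psi t * ((8 * t) %/ p)%N%:Z =
   \sum_(0 <= j < 8) j%:Z * arc_sum 8 j.
  rewrite (@sum_fibers (fun t => ((8 * t) %/ p)%N) 8); last first.
    by move=> t tp; rewrite ltn_divLR // ltn_pmul2l.
  apply: eq_bigr => j _; rewrite /arc_sum mulr_sumr; apply: eq_bigr => t /eqP ->.
  exact: mulrC.
rewrite -/S in E.
have E7 : 7 * h = - \sum_(0 <= j < 8) j%:Z * arc_sum 8 j.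
  apply: (@mulfI _ p%:Z); first by move: p_gt0; clear; lia.
  by move: ES E; rewrite ET; move: (\sum_(0 <= j < 8) _) => T; clear; lia.
have [U2 U3] := arc_sum_relations.
have U4 : arc_sum 8 4 = - arc_sum 8 3 := arc_sum_reflect (isT : 3 <= 7)%N.
have U5 : arc_sum 8 5 = - arc_sum 8 2 := arc_sum_reflect (isT : 2 <= 7)%N.
have U6 : arc_sum 8 6 = - arc_sum 8 1 := arc_sum_reflect (isT : 1 <= 7)%N.
have U7 : arc_sum 8 7 = - arc_sum 8 0 := arc_sum_reflect (isT : 0 <= 7)%N.
move: E7; rewrite /index_iota /= !big_cons big_nil U4 U5 U6 U7 U2 U3.
by move: (arc_sum 8 0) (arc_sum 8 1); clear; lia.
Qed.

(** * The moment of the character modulo 8p *)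

Lemma chi2_period m : chi2 (m + 8 * p) = chi2 m.
Proof.
rewrite /chi2 -chi8_mod -modnDmr modnMr addn0 chi8_mod; congr (_ * _).
by rewrite -psi_mod -modnDmr modnMl addn0 psi_mod.
Qed.

Lemma chi2_octave b j : chi2 (b + p * j) = chi8 (b %% 8 + 7 * j) * psi b.
Proof.
rewrite /chi2 -chi8_mod -modnDm -modnMm p_mod8.
rewrite -[in RHS]chi8_mod -[in RHS]modnDm -[in RHS]modnMm modn_mod /=; congr (_ * _).
by rewrite -psi_mod -modnDmr modnMr addn0 psi_mod.
Qed.

Lemma sum_chi8 i : (i < 8)%N -> \sum_(0 <= j < 8) chi8 (i + 7 * j) = 0.
Proof.
by case: i => [|[|[|[|[|[|[|[|]]]]]]]] // _; rewrite /index_iota /= !big_cons big_nil.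
Qed.

Definition octave_moment (i : nat) : int := \sum_(0 <= j < 8) chi8 (i + 7 * j) * j%:Z.

Lemma sum_chi2 : \sum_(1 <= m < (8 * p).+1) chi2 m = 0.
Proof.
rewrite sum_range1; first last.
- by rewrite -[(8 * p)%N]add0n chi2_period /chi2 mul0r.
- by rewrite /chi2 mul0r.
rewrite mulnC sum_nat_mul exchange_big big1_seq //= => b _.
under eq_bigr => j _ do rewrite chi2_octave.
by rewrite -mulr_suml sum_chi8 ?mul0r // ltn_pmod.
Qed.

(** Write the argument as b + p j with b < p and j < 8: [psi] sees only b, and [chi8] only b + 7 j
    modulo 8. The part of the moment carried by b dies because [chi8] sums to zero over j. The part
    carried by p j depends on b mod 8, and those classes are octants by [arc_sum_mod]. *)
Lemma pmoment_chi2 :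
  pmoment chi2 (8 * p) = - (p%:Z * \sum_(0 <= i < 8) octave_moment i * arc_sum 8 i).
Proof.
have c0 : chi2 0 = 0 by rewrite /chi2 mul0r.
rewrite /pmoment sum_range1; first last.
- by rewrite -[(8 * p)%N]add0n chi2_period c0 mul0r.
- by rewrite c0 mul0r.
congr (- _); rewrite mulnC sum_nat_mul exchange_big /=.
transitivity (\sum_(0 <= b < p) p%:Z * (octave_moment (b %% 8) * psi b)).
  apply: eq_bigr => b _; under eq_bigr => j _ do rewrite chi2_octave PoszD PoszM.
  transitivity (psi b * b%:Z * \sum_(0 <= j < 8) chi8 (b %% 8 + 7 * j)
     + p%:Z * psi b * octave_moment (b %% 8)); last by rewrite sum_chi8 ?ltn_pmod //; ring.
  by rewrite /octave_moment !mulr_sumr -big_split /=; apply: eq_bigr => j _; ring.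
rewrite -mulr_sumr; congr (_ * _).
rewrite (@sum_fibers (fun b => (b %% 8)%N) 8); last by move=> t _; rewrite ltn_pmod.
apply: eq_bigr => i _; rewrite arc_sum_mod // mulr_sumr.
by apply: eq_bigr => s /eqP ->.
Qed.

Lemma class_number_2p_octants :
  (class_number (quadratic_field (- (2 * p)%N%:Z)))%:Z = 4 * arc_sum 8 1.
Proof.
have s22 : s2 ^+ 2 = 0%N%:Z%:~R * s2 - (2 * p)%N%:Z%:~R.
  by rewrite sqrtCK mulrNz mul0r sub0r.
have s2c : s2^* = 0%N%:Z%:~R - s2.
  by rewrite sqrtC_neg_conj ?sub0r //; move: p_gt0; clear; lia.
have f0 : (0 < 8 * p)%N by rewrite muln_gt0.
have E := class_number_formula (tau := 0) (nu := (2 * p)%N) (w := s2)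
  (O := ring_of_integers (quadratic_field (- (2 * p)%N%:Z))) isT _ s22 s2c
  ring_of_integers_2p _ f0 chi2_period sum_chi2 ideal_count_2p.
have {}E : (8 * p)%N%:Z * (class_number (quadratic_field (- (2 * p)%N%:Z)))%:Z =
    pmoment chi2 (8 * p).
  rewrite /class_number E //; first by move: p_gt0; clear; lia.
  move=> d x y u d0 uE uA; split=> //; exists (x%:~R / d%:~R), (y%:~R / d%:~R).
  have dC : d%:~R != 0 :> algC by rewrite intr_eq0.
  by apply: (mulfI dC); rewrite uE /qelt -/s2 !rmorphM /= !fmorphV !rmorph_int; field.
move: E; rewrite pmoment_chi2; set h := (class_number _)%:Z; rewrite PoszM.
have [U2 U3] := arc_sum_relations.
have U5 : arc_sum 8 5 = - arc_sum 8 2 := arc_sum_reflect (isT : 2 <= 7)%N.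
have U6 : arc_sum 8 6 = - arc_sum 8 1 := arc_sum_reflect (isT : 1 <= 7)%N.
(* The values of [octave_moment] are -8 at 1 and 2, 8 at 5 and 6, and 0 elsewhere. *)
have -> : \sum_(0 <= i < 8) octave_moment i * arc_sum 8 i = - 32 * arc_sum 8 1.
  rewrite /octave_moment /index_iota /= !big_cons !big_nil /chi8 /= U5 U6 U2.
  by ring.
move=> E; have p0 : p%:Z != 0 by move: p_gt0; clear; lia.
apply: (mulfI p0); move: E; move: (arc_sum 8 1) => u; clear; lia.
Qed.

(** The residue 0 satisfies the condition for k = 0 but has symbol 0. Leaving it out makes the
    octants symmetric under t -> p - t. *)
Definition octant_size (k : nat) : int :=
  \sum_(0 <= t < p | ((8 * t) %/ p == k)%N) ((t != 0)%N : nat)%:Z.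

Lemma octant_size_reflect k : (k <= 7)%N -> octant_size (7 - k) = octant_size k.
Proof.
move=> k7; rewrite /octant_size.
pose H (t : nat) : int := ((t != 0)%N && (t != p) : nat)%:Z.
transitivity (\sum_(0 <= t < p | ((8 * t) %/ p == 7 - k)%N) H t).
  rewrite big_nat_cond [RHS]big_nat_cond; apply: eq_bigr => t /andP[/andP[_ tp] _].
  by rewrite /H (ltn_eqF tp) andbT.
rewrite octant_sum_reflect /H ?eqxx ?andbF //.
rewrite big_nat_cond [RHS]big_nat_cond; apply: eq_bigr => t /andP[/andP[_ tp] _].
by congr (Posz (nat_of_bool _)); move: tp; clear; lia.
Qed.

Lemma not_dvd_8 t : (0 < t < p)%N -> ~~ (p %| 8 * t)%N.
Proof.
case/andP => t0 tp; rewrite Gauss_dvdr; last by rewrite prime_coprime // -psi_eq0 psi8.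
by rewrite gtnNdvd.
Qed.

Lemma sum_leq_indicator B : (B < p)%N ->
  \sum_(0 <= t < p) ((t <= B)%N : nat)%:Z = B.+1%:Z.
Proof.
move=> Bp; rewrite (@big_cat_nat _ _ _ B.+1) //=.
have -> : \sum_(0 <= t < B.+1) ((t <= B)%N : nat)%:Z = \sum_(0 <= t < B.+1) 1.
  by apply: eq_big_nat => t /andP[_ tB]; rewrite -ltnS tB.
rewrite sumr_const_nat subn0 natz big_nat_cond big1 ?addr0 //.
by move=> t /andP[/andP[Bt _] _]; rewrite leqNgt Bt.
Qed.

Lemma octant_sizeE k : (k <= 3)%N ->
  octant_size k = ((k.+1 * p) %/ 8)%N%:Z - ((k * p) %/ 8)%N%:Z.
Proof.
move=> k3; set B := ((k.+1 * p) %/ 8)%N; set A := ((k * p) %/ 8)%N.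
have Bp : (B < p)%N.
  by rewrite ltn_divLR // mulnC ltn_pmul2l //; move: k3; clear; lia.
have AB : (A <= B)%N by rewrite leq_div2r // leq_mul2r leqnSn orbT.
transitivity (B.+1%:Z - A.+1%:Z); last by clear; lia.
rewrite -(sum_leq_indicator Bp) -(sum_leq_indicator (leq_ltn_trans AB Bp)) -sumrB.
rewrite /octant_size big_mkcond; apply: eq_big_nat => t /andP[_ tp].
rewrite !leq_divRL // ![(t * 8)%N]mulnC.
have -> : ((8 * t) %/ p == k)%N = (k * p <= 8 * t)%N && (8 * t < k.+1 * p)%N.
  by rewrite -leq_divRL // -ltn_divLR // ltnS eqn_leq andbC.
case: (posnP t) => [->|t0]; first by rewrite muln0 !leq0n /= if_same.
(* The octant is given by k p <= 8 t < (k + 1) p and the difference of floors by k p < 8 t <= (k +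
   1) p; they agree because 8 t is never a multiple of p. *)
have nd (i : nat) : (8 * t)%N != (i * p)%N.
  by apply: contraTneq (not_dvd_8 (t := t) _) => [->|]; rewrite ?negbK ?dvdn_mull ?t0.
have n1 := nd k; have n2 := nd k.+1; move: n1 n2.
have kk : (k * p <= k.+1 * p)%N by rewrite leq_mul2r leqnSn orbT.
move: (8 * t)%N (k * p)%N (k.+1 * p)%N kk t0 => u v v' kk t0; clear - kk t0.
move=> n1 n2; have -> : (u <= v')%N = (u < v')%N by rewrite leq_eqVlt (negbTE n2).
have -> : (u <= v)%N = ~~ (v <= u)%N by rewrite -ltnNge ltn_neqAle n1.
by case: (leqP v u); case: (ltnP u v') => //=; clear - kk; lia.
Qed.

(** Pointwise, twice the indicator of [psi t = 1] is the indicator of [t != 0] plus [psi t]. *)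
Lemma twice_residue_count k :
  2 * \sum_(0 <= t < p | ((8 * t) %/ p == k)%N) ((psi t == 1) : nat)%:Z =
  octant_size k + arc_sum 8 k.
Proof.
rewrite /octant_size /arc_sum mulr_sumr -big_split /= big_nat_cond [RHS]big_nat_cond.
apply: eq_bigr => t /andP[/andP[_ tp] _].
have : (psi t == 0) = (t == 0)%N.
  rewrite psi_eq0; case: (posnP t) => [->|t0]; first by rewrite dvdn0.
  by rewrite gtnNdvd.
by case/or3P: (psi_cases t) => /eqP -> /=; case: (t == 0)%N.
Qed.

Hypothesis order8 : ((p - 1) %/ 2)%N.-primitive_root (8%:R : 'F_p).

Lemma sum_powers8 (G : nat -> int) :
  \sum_(0 <= i < (p - 1) %/ 2) G (8 ^ i %% p)%N =
  \sum_(0 <= t < p | psi t == 1) G t.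
Proof.
rewrite /index_iota !subn0.
have inF (m n : nat) : (m%:R == n%:R :> 'F_p) = (m %% p == n %% p)%N.
  by rewrite -(inj_eq val_inj) /= !val_Fp_nat.
have pw i : (8 ^ i %% p)%N%:R = (8%:R : 'F_p) ^+ i.
  by apply/eqP; rewrite -natrX inF modn_mod.
have p1 i : psi (8 ^ i %% p) = 1.
  by rewrite psi_mod; elim: i => [|i IH]; rewrite ?expnS ?psiM ?psi8 ?IH // /psi leg1.
apply: (big_reindex_supp (g := fun i => (8 ^ i %% p)%N)); rewrite ?iota_uniq //.
- move=> i j; rewrite !mem_iota !add0n /= => im jm E.
  have /eqP : (8%:R : 'F_p) ^+ i = 8%:R ^+ j by rewrite -!pw E.
  by rewrite (eq_prim_root_expr order8) !modn_small // => /eqP.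
- by move=> i _ _; rewrite mem_iota add0n /= ltn_pmod // p1.
- move=> t; rewrite mem_iota add0n /= => tp /eqP pt _.
  have tm : (t%:R : 'F_p) ^+ ((p - 1) %/ 2) = 1.
    by rewrite -intr_leg // -/(psi t) pt.
  have [i iE] := prim_rootP order8 tm; exists (i : nat).
    by rewrite mem_iota add0n /= ltn_ord.
  have /eqP : (t%:R : 'F_p) = (8 ^ i)%N%:R by rewrite natrX iE.
  by rewrite inF [(t %% p)%N]modn_small // => /eqP <-.
Qed.

End Fields.

(** * Octal digits *)

Fixpoint octal_prefix (a : nat -> nat) (n : nat) : nat :=
  if n is m.+1 then (8 * octal_prefix a m + a n)%N else 0%N.

Lemma octal_partial_sum (R : realType) (a : nat -> nat) n :
  \sum_(1 <= j < n.+1) (a j)%:R * 8 ^- j = (octal_prefix a n)%:R * 8 ^- n :> R.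
Proof.
elim: n => [|n IH]; first by rewrite big_geq // mul0r.
rewrite big_nat_recr //= IH natrD natrM exprS.
have hn : 8 ^+ n != 0 :> R by rewrite expf_neq0.
by field; rewrite hn.
Qed.

(** The partial sums satisfy [s n <= 1/p <= s n + 8^-n], which identifies the integer written by the
    first n digits with the integer part of 8^n / p. The digit is the difference of two such
    prefixes, one of them multiplied by 8. *)
Lemma octal_digitE (R : realType) (p : nat) (a : nat -> nat) (j : nat) :
  (1 < p)%N -> coprime p 8 -> is_octal_expansion a (p%:R^-1 : R) ->
  a j.+1 = ((8 * (8 ^ j %% p)) %/ p)%N.
Proof.
move=> p1 co [a7 cv]; pose s n : R := (octal_prefix a n)%:R * 8 ^- n.
have p0 : (0 < p)%N by apply: ltnW.
have pR : 0 < p%:R :> R by rewrite ltr0n.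
have sE : (fun n => \sum_(1 <= j < n.+1) (a j)%:R * 8 ^- j : R) = s.
  by apply/funext => n; rewrite octal_partial_sum.
rewrite sE in cv.
have h8 n : 0 < 8 ^+ n :> R by rewrite exprn_gt0.
have sS n : s n.+1 = s n + (a n.+1)%:R * 8 ^- n.+1.
  rewrite /s /= natrD natrM exprS; have hn := lt0r_neq0 (h8 n).
  by field; rewrite hn.
have cvs : cvgn s by apply/cvg_ex; exists (p%:R^-1).
have ls : limn s = p%:R^-1 by apply/cvg_lim.
have lower n : s n <= p%:R^-1.
  rewrite -ls; apply: nondecreasing_cvgn_le => //; apply/nondecreasing_seqP => m.
  by rewrite sS lerDl mulr_ge0 // invr_ge0 ltW.
(* As digits are at most 7, this sequence is nonincreasing; it has the same limit as [s] and bounds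
   it from above. *)
pose t n := s n + (8^-1) ^+ n.
have cvt : (t n @[n --> \oo] --> (p%:R^-1 : R))%classic.
  rewrite -[p%:R^-1]addr0; apply: cvgD => //; apply: cvg_expr.
  by rewrite ger0_norm ?invr_ge0 // invf_lt1 // ltr1n.
have upper n : p%:R^-1 <= t n.
  have cvt' : cvgn t by apply/cvg_ex; exists (p%:R^-1).
  have <- : limn t = p%:R^-1 by apply/cvg_lim.
  apply: nonincreasing_cvgn_ge => //; apply/nonincreasing_seqP => m.
  rewrite /t sS -addrA lerD2l !exprVn exprS.
  have am : (a m.+1)%:R <= 7 :> R by rewrite (ler_nat _ _ 7) a7.
  have -> : (8 ^+ m)^-1 = 8 * (8 * 8 ^+ m)^-1 :> R.
    by rewrite invfM mulrA divff // mul1r.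
  have i0 : 0 <= (8 * 8 ^+ m)^-1 :> R by rewrite invr_ge0 -exprS ltW.
  have : (a m.+1)%:R * (8 * 8 ^+ m)^-1 <= 7 * (8 * 8 ^+ m)^-1 :> R by rewrite ler_wpM2r.
  by lra.
have main n : octal_prefix a n = (8 ^ n %/ p)%N.
  have l1 : (octal_prefix a n * p <= 8 ^ n)%N.
    rewrite -(ler_nat R) natrM natrX.
    by have := lower n; rewrite /s ler_pdivrMr // mulrC ler_pdivlMr.
  have l2 : (8 ^ n <= (octal_prefix a n).+1 * p)%N.
    rewrite -(ler_nat R) natrM natrX -[(octal_prefix a n).+1%:R]natr1.
    have := upper n; rewrite /t /s exprVn -[X in _ + X]mul1r -mulrDl.
    by rewrite ler_pdivlMr // mulrC ler_pdivrMr.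
  (* Equality would be an expansion ending in digits 7 only; it cannot occur since p does not divide
     8^n. *)
  have nd : (8 ^ n)%N != ((octal_prefix a n).+1 * p)%N.
    apply/eqP => E; have : (p %| 8 ^ n)%N by rewrite E dvdn_mull.
    have := coprimeXr n co; rewrite /coprime => /eqP g; move/gcdn_idPl; rewrite g => p1'.
    by rewrite -p1' in p1.
  apply/eqP; rewrite eqn_leq leq_divRL // l1 /= -ltnS ltn_divLR //.
  by rewrite ltn_neqAle nd l2.
have := main j.+1; rewrite /= main expnS {2}(divn_eq (8 ^ j) p) mulnDr mulnA divnMDl //.
by move/addnI.
Qed.

Lemma digit_count_sum (a : nat -> nat) (m k : nat) :
  (digit_count a m k)%:Z = \sum_(0 <= i < m) ((a i.+1 == k) : nat)%:Z.
Proof.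
rewrite /digit_count cardsE -sum1_card.
transitivity (\sum_(0 <= j < m.+1) ((0 < j)%N && (a j == k) : nat)%:Z).
  rewrite big_mkord -[LHS]natz natr_sum big_mkcond /=.
  by apply: eq_bigr => j _; rewrite unfold_in; case: (_ && _).
by rewrite big_nat_recl // add0r.
Qed.

Lemma floor_nat_div (n d : nat) : (0 < d)%N ->
  Num.floor (n%:R / d%:R : rat) = (n %/ d)%N%:Z.
Proof.
move=> d0; have dR : 0 < d%:R :> rat by rewrite ltr0n.
apply: floor_def; rewrite ler_pdivlMr // ltr_pdivrMr //.
rewrite -pmulrn -natrM ler_nat leq_trunc_div /=.
have -> : (n %/ d)%N%:Z + 1 = (n %/ d).+1%:Z by rewrite intS addrC.
by rewrite -pmulrn -natrM ltr_nat -ltn_divLR.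
Qed.

Theorem theorem3 (R : realType) (p : nat) (a : nat -> nat)
    (p_prime : prime p) (p_mod4 : (p %% 4 = 3)%N) (p_gt3 : (3 < p)%N)
    (order8 : ((p - 1) %/ 2)%N.-primitive_root (8%:R : 'F_p))
    (octal : is_octal_expansion a (p%:R^-1 : R)) :
  let n k := digit_count a ((p - 1) %/ 2) k in
  let h1 := class_number (quadratic_field (- p%:Z)) in
  let h2 := class_number (quadratic_field (- (2 * p)%N%:Z)) in
  forall k : nat, (k <= 3)%N ->
    (n k)%:R = 2^-1 * ((Num.floor ((k.+1 * p)%N%:R / 8 : rat))%:~R
                       - (Num.floor ((k * p)%N%:R / 8 : rat))%:~R
                       + delta h1 h2 k) :> rat /\
    (n (7 - k)%N)%:R = (n k)%:R - delta h1 h2 k :> rat.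
Proof.
have p_odd : odd p by move: p_mod4; clear; lia.
(* The order of 8 makes [leg 8] equal to 1 by Euler's criterion. Since [leg 8] is the cube of
   [leg 2], also [leg 2] is 1, and with p = 3 mod 4 this leaves 7 modulo 8. *)
have p_mod8 : (p %% 8 = 7)%N.
  have e0 : (8%:R : 'F_p) != 0.
    rewrite -(dvdn_pcharf (pchar_Fp p_prime)) (Euclid_dvdX 2 3) // andbT.
    by rewrite gtnNdvd //; apply: ltn_trans p_gt3.
  have l8 : leg (8%:R : 'F_p) = 1 by rewrite /leg (negbTE e0) (prim_expr_order order8) eqxx.
  have : leg (2%:R : 'F_p) = 1.
    have : leg (2%:R : 'F_p) * (leg (2%:R : 'F_p) * leg (2%:R : 'F_p)) = 1.
      by rewrite -!legM // -!natrM.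
    by case/or3P: (leg_cases (2%:R : 'F_p)) => /eqP ->.
  rewrite leg2 // /chi8; move: p_mod4; clear => p4.
  have : (p %% 8 = 3 \/ p %% 8 = 7)%N by lia.
  by case=> ->.
move=> n h1 h2 k k3.
have co : coprime p 8.
  rewrite prime_coprime // (Euclid_dvdX 2 3) // andbT gtnNdvd //.
  exact: ltn_trans p_gt3.
have nE i : (n i)%:Z = \sum_(0 <= t < p | ((8 * t) %/ p == i)%N) ((psi p t == 1) : nat)%:Z.
  rewrite /n digit_count_sum.
  under eq_bigr => j _ do rewrite (octal_digitE j (prime_gt1 p_prime) co octal).
  rewrite (sum_powers8 p_prime p_mod8 order8 (fun t => (((8 * t) %/ p == i)%N : nat)%:Z)).
  rewrite big_mkcond [RHS]big_mkcond; apply: eq_bigr => t _.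
  by case: (psi p t == 1); case: (_ == i).
have nU i : 2 * (n i)%:Z = octant_size p i + arc_sum p 8 i by rewrite nE twice_residue_count.
have k7 : (k <= 7)%N by apply: leq_trans k3 _.
(* [delta] is the excess of residues over nonresidues in octant k. Octants 0 and 1 together
   contribute h1 and octant 1 alone h2 / 4, hence the difference at k = 0. *)
have dE : delta h1 h2 k = (arc_sum p 8 k)%:~R.
  have H1 := class_number_p_octants p_prime p_mod8.
  have H2 := class_number_2p_octants p_prime p_mod8.
  have [U2 U3] := arc_sum_relations p_prime p_mod8.
  have h1E : h1%:R = (arc_sum p 8 0)%:~R + (arc_sum p 8 1)%:~R :> rat.
    by rewrite -intrD -H1 -pmulrn.
  have h2E : h2%:R / 4 = (arc_sum p 8 1)%:~R :> rat.
    have -> : h2%:R = 4 * (arc_sum p 8 1)%:~R :> rat by rewrite pmulrn H2 intrM.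
    by field.
  case: (k) k3 => [|[|[|[|]]]] // _ /=; rewrite ?h1E h2E ?U2 ?U3 //.
    by rewrite addrK.
  by rewrite mulrNz.
have n2 : 2 * (n k)%:R = (octant_size p k)%:~R + (arc_sum p 8 k)%:~R :> rat.
  by rewrite -intrD -nU intrM -pmulrn.
have n2' : 2 * (n (7 - k)%N)%:R = (octant_size p k)%:~R - (arc_sum p 8 k)%:~R :> rat.
  by rewrite -octant_size_reflect // -intrB -arc_sum_reflect // -nU intrM -pmulrn.
rewrite dE (floor_nat_div _ (isT : 0 < 8)%N) (floor_nat_div _ (isT : 0 < 8)%N) -intrB.
rewrite -octant_sizeE //; split; first by rewrite -n2 mulKf.
by apply: (@mulfI _ 2) => //; rewrite n2' mulrBr n2; ring.
Qed.
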